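(* Assume that $\mathfrak{g}=\mathfrak{sl}_{r+1}$ or $\mathfrak{g}=\mathfrak{sp}_{2r}$. Then for every integer $m\ge 1$ or $m=0$, i.e. for every $m\in\mathbb{Z}_{\geqslant 0}$, the symmetric filtration and the enveloping filtration of the Cartan subalgebra $\mathfrak{h}$ coincide: $$\mathscr{F}_S^{(m)}\mathfrak{h}=\mathscr{F}_U^{(m)}\mathfrak{h}.$$
   Context: All Lie algebras are over $\mathbb{C}$, $r\ge 1$. Fix a triangular decomposition $\mathfrak{g}=\mathfrak{n}_-\oplus\mathfrak{h}\oplus\mathfrak{n}_+$ of the simple Lie algebra $\mathfrak{g}$, and let $\rho\in\mathfrak{h}^*$ be the half-sum of the positive roots (the roots of $\mathfrak{n}_+$). Let $S(\mathfrak{g})$ be the symmetric algebra, with standard filtration $(S^m(\mathfrak{g}))_{m}$ given by degree ($S^m(\mathfrak g)$ is the set of elements of degree at most $m$), and $U(\mathfrak{g})$ the enveloping algebra with its standard filtration $(U^m(\mathfrak{g}))_m$. The Chevalley projection $\mathrm{Ch}\colon S(\mathfrak{g})\to S(\mathfrak{h})$ is the projection with respect to $S(\mathfrak{g})=S(\mathfrak{h})\oplus(\mathfrak{n}_-+\mathfrak{n}_+)S(\mathfrak{g})$. The Harish-Chandra projection $\mathrm{hc}\colon U(\mathfrak{g})\to U(\mathfrak{h})=S(\mathfrak{h})$ is the projection with respect to $U(\mathfrak{g})=U(\mathfrak{h})\oplus(\mathfrak{n}_-U(\mathfrak{g})+U(\mathfrak{g})\mathfrak{n}_+)$. The map $\mathrm{ev}_\rho\colon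 S(\mathfrak{h})\cong\mathbb{C}[\mathfrak{h}^*]\to\mathbb{C}$ is evaluation at $\rho$. Let $\mathfrak{g}$ act diagonally (by the adjoint actions) on $S(\mathfrak{g})\otimes\mathfrak{g}$ and on $U(\mathfrak{g})\otimes\mathfrak{g}$; superscript $\mathfrak{g}$ denotes invariants. One has $(\mathrm{Ch}\otimes 1)((S(\mathfrak{g})\otimes\mathfrak{g})^{\mathfrak{g}})\subset S(\mathfrak{h})\otimes\mathfrak{h}$ and $(\mathrm{hc}\otimes 1)((U(\mathfrak{g})\otimes\mathfrak{g})^{\mathfrak{g}})\subset S(\mathfrak{h})\otimes\mathfrak{h}$. Define, for $m\in\mathbb{Z}_{\geqslant 0}$, $$\mathscr{F}_S^{(m)}\mathfrak{h}:=(\mathrm{ev}_\rho\otimes 1)\circ(\mathrm{Ch}\otimes 1)\big((S^m(\mathfrak{g})\otimes\mathfrak{g})^{\mathfrak{g}}\big),\qquad \mathscr{F}_U^{(m)}\mathfrak{h}:=(\mathrm{ev}_\rho\otimes 1)\circ(\mathrm{hc}\otimes 1)\big((U^m(\mathfrak{g})\otimes\mathfrak{g})^{\mathfrak{g}}\big),$$ which are subspaces of $\mathfrak{h}$. *)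

(* Defs.v *)
From HB Require Import structures.
From mathcomp Require Import all_boot all_order all_algebra ring.
From mathcomp Require Import boolp classical_sets reals complex.
From mathcomp Require Import mpoly.
From mathcomp Require monalg.

Set Implicit Arguments.
Unset Strict Implicit.
Unset Printing Implicit Defensive.
Import GRing.Theory.
Local Open Scope classical_set_scope.
Local Open Scope ring_scope.

(** * Finite-dimensional Lie algebras *)

HB.mixin Record Vector_isLie (F : fieldType) L of Vector F L := {
  bracket : L -> L -> L;
  linear_bracketr : forall x, linear (bracket x);
  linear_bracketl : forall y, linear (bracket^~ y);
  bracketxx : forall x, bracket x x = 0;
  bracket_jacobi : forall x y z,
    bracket x (bracket y z) + bracket y (bracket z x)
      + bracket z (bracket x y) = 0
}.

#[short(type="lieType")]
HB.structure Definition Lie (F : fieldType) :=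
  {L of Vector F L & Vector_isLie F L}.

(** * The Lie algebras sl_n and sp_2r *)

Section Commutator.
Variables (F : fieldType) (n : nat).

Definition commx (A B : 'M[F]_n) : 'M[F]_n := A *m B - B *m A.

Lemma commx_linear_r A : linear (commx A).
Proof.
move=> c B C; rewrite /commx mulmxDr mulmxDl -scalemxAr -scalemxAl.
by rewrite scalerBr opprD addrACA.
Qed.

Lemma commx_linear_l B : linear (commx^~ B).
Proof.
move=> c A C; rewrite /commx mulmxDr mulmxDl -scalemxAr -scalemxAl.
by rewrite scalerBr opprD addrACA.
Qed.

Lemma commxx A : commx A A = 0.
Proof. by rewrite /commx subrr. Qed.

Lemma commx_jacobi A B C :
  commx A (commx B C) + commx B (commx C A) + commx C (commx A B) = 0.
Proof.
rewrite /commx !(mulmxBr, mulmxBl) !mulmxA.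
by apply/matrixP => i j; rewrite !mxE; ring.
Qed.

End Commutator.

(* A subspace of 'M_n closed under commutators is a Lie algebra. *)
Section MatrixLie.
Variables (F : fieldType) (n : nat) (V : {vspace 'M[F]_n}).
Hypothesis commV : forall A B, A \in V -> B \in V -> commx A B \in V.

Definition mxlie_bracket (x y : subvs_of V) : subvs_of V :=
  Subvs (commV (valP x) (valP y)).

Lemma mxlie_linear_r x : linear (mxlie_bracket x).
Proof. by move=> c y z; apply: val_inj; exact: commx_linear_r. Qed.

Lemma mxlie_linear_l y : linear (mxlie_bracket^~ y).
Proof. by move=> c x z; apply: val_inj; exact: commx_linear_l. Qed.

Lemma mxlie_bracketxx x : mxlie_bracket x x = 0.
Proof. by apply: val_inj; exact: commxx. Qed.

Lemma mxlie_jacobi x y z :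
  mxlie_bracket x (mxlie_bracket y z) + mxlie_bracket y (mxlie_bracket z x)
    + mxlie_bracket z (mxlie_bracket x y) = 0.
Proof. by apply: val_inj; exact: commx_jacobi. Qed.

End MatrixLie.

Section SpecialLinear.
Variables (F : fieldType) (n : nat).

Definition sl_space : {vspace 'M[F]_n} :=
  lker (linfun (mxtrace : 'M[F]_n -> F^o)).

Lemma sl_spaceE A : (A \in sl_space) = (\tr A == 0).
Proof. by rewrite memv_ker lfunE. Qed.

Lemma sl_comm A B : A \in sl_space -> B \in sl_space -> commx A B \in sl_space.
Proof. by rewrite !sl_spaceE linearB /= mxtrace_mulC subrr. Qed.

Definition sl : Type := subvs_of sl_space.

HB.instance Definition _ := Vector.on sl.
HB.instance Definition _ := Vector_isLie.Build F sl
  (mxlie_linear_r sl_comm) (mxlie_linear_l sl_comm)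
  (mxlie_bracketxx sl_comm) (mxlie_jacobi sl_comm).

End SpecialLinear.

Section Symplectic.
Variables (F : fieldType) (r : nat).

Definition symp_form : 'M[F]_(r + r) := block_mx 0 1%:M (- 1%:M) 0.

Definition symp_def (A : 'M[F]_(r + r)) := A^T *m symp_form + symp_form *m A.

Lemma symp_def_linear : linear symp_def.
Proof.
move=> c A B; rewrite /symp_def linearP /= mulmxDl mulmxDr.
by rewrite -scalemxAl -scalemxAr scalerDr addrACA.
Qed.

HB.instance Definition _ := GRing.isLinear.Build F _ _ _ symp_def
  symp_def_linear.

Definition sp_space : {vspace 'M[F]_(r + r)} := lker (linfun symp_def).

Lemma sp_spaceE A :
  (A \in sp_space) = (A^T *m symp_form + symp_form *m A == 0).
Proof. by rewrite memv_ker lfunE. Qed.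

Lemma sp_comm A B : A \in sp_space -> B \in sp_space -> commx A B \in sp_space.
Proof.
rewrite !sp_spaceE !addr_eq0 => /eqP hA /eqP hB; apply/eqP.
rewrite /commx linearB /= !trmx_mul mulmxBl mulmxBr opprB.
by rewrite -!mulmxA hA hB !mulmxN !mulmxA hA hB !mulNmx !opprK addrC.
Qed.

Definition sp : Type := subvs_of sp_space.

HB.instance Definition _ := Vector.on sp.
HB.instance Definition _ := Vector_isLie.Build F sp
  (mxlie_linear_r sp_comm) (mxlie_linear_l sp_comm)
  (mxlie_bracketxx sp_comm) (mxlie_jacobi sp_comm).

End Symplectic.

(** * Triangular decompositions *)

Section Roots.
Variables (F : fieldType) (L : lieType F) (h : {vspace L}).

(* Linear forms on h. *)
Definition weight := 'Hom(subvs_of h, F^o).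

Definition rootspace (a : weight) : {vspace L} :=
  (\bigcap_(i < \dim {: subvs_of h})
    let H := tnth (vbasis {: subvs_of h}) i in
    lker (linfun (fun x : L => bracket (vsval H) x - (a H : F) *: x)))%VS.

Lemma rootspaceP (a : weight) (x : L) :
  reflect (forall H : subvs_of h, bracket (vsval H) x = (a H : F) *: x)
          (x \in rootspace a).
Proof.
pose f (H : subvs_of h) (y : L) := bracket (vsval H) y - (a H : F) *: y.
have linf H : linear (f H).
  move=> c y z; rewrite /f linear_bracketr !scalerDr scalerN !scalerA mulrC.
  by rewrite opprD addrACA.
have fE H y : linfun (f H) y = f H y.
  pose M := GRing.isLinear.Build _ _ _ _ _ (linf H).
  pose g : {linear L -> L} := HB.pack (f H) M.
  by rewrite -[f H]/(g : L -> L) lfunE.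
have -> : (x \in rootspace a) =
    [forall i, f (tnth (vbasis {: subvs_of h}) i) x == 0].
  rewrite memvE; apply/subv_bigcapP/forallP => hx i.
    by have := hx i isT; rewrite -memvE memv_ker fE.
  by move=> _; rewrite -memvE memv_ker fE.
apply: (iffP forallP) => hx H; last by rewrite /f hx subrr.
rewrite (coord_vbasis (memvf H)) raddf_sum [a _]raddf_sum scaler_suml.
pose g : {linear L -> L} := HB.pack (bracket^~ x)
  (GRing.isLinear.Build _ _ _ _ _ (linear_bracketl x)).
rewrite -[LHS]/(g _) raddf_sum; apply: eq_bigr => i _ /=.
have := hx i; rewrite (tnth_nth 0) subr_eq0 => /eqP hi.
by rewrite !linearZ /= -[LHS]/(g (_ *: _)) linearZ /= hi scalerA.
Qed.

End Roots.

(* A triangular decomposition of a semisimple Lie algebra: a Cartan subalgebra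
   h (ad-diagonalizable and equal to its own centralizer) together with the set
   of roots of n_+, which has to be a positive system: closed under addition in
   the root system, which is its disjoint union with its opposite. *)
Record tridec (F : fieldType) (L : lieType F) := Tridec {
  cartan : {vspace L};
  posroots : seq (weight cartan);
  nplus := (\sum_(a <- posroots) rootspace a)%VS;
  nminus := (\sum_(a <- posroots) rootspace (- a))%VS;
  cartan_centralizer : rootspace (0 : weight cartan) = cartan;
  tridec_full : (nminus + cartan + nplus)%VS = fullv;
  tridec_direct : directv (nminus + cartan + nplus);
  posroots_uniq : uniq posroots;
  posroots_root : forall a, a \in posroots -> a != 0 /\ rootspace a != 0%VS;
  posroots_opp : forall a, a \in posroots -> - a \notin posroots;
  posroots_add : forall a b, a \in posroots -> b \in posroots ->
    rootspace (a + b) != 0%VS -> a + b \in posroots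
}.

Definition rho (F : fieldType) (L : lieType F) (T : tridec L) :
  weight (cartan T) := 2^-1 *: \sum_(a <- posroots T) a.

(** * The symmetric algebra *)

Section Symmetric.
Variables (F : fieldType) (V : vectType F).

(* The i-th variable stands for the i-th vector of the basis [vbasis {:V}]. *)
Definition Sym : Type := {mpoly F[\dim {:V}]}.

HB.instance Definition _ := GRing.ComAlgebra.on Sym.

Definition sym_in (v : V) : Sym :=
  \sum_(i < \dim {:V}) coord (vbasis {:V}) i v *: 'X_i.

(* The extension to S(V) of a linear map into an algebra with pairwise
   commuting values. *)
Definition sym_ext (A : algType F) (f : V -> A) (p : Sym) : A :=
  mmap (in_alg A) (fun i => f (tnth (vbasis {:V}) i)) p.

End Symmetric.

(** * The enveloping algebra *)

(* U(L) is the quotient of the free associative algebra on the set L by the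
   two-sided ideal generated by the relations making the inclusion of L linear
   (they cut out the tensor algebra) and a morphism of Lie algebras. *)
Section Enveloping.
Import monalg.
Variables (F : fieldType) (L : lieType F).

Local Notation freealg := {malg F[{fmonom L}]}.

Definition letter (x : L) : freealg := mkmalgU (fmu x) 1.

Lemma freealg_scaleAr (c : F) (a b : freealg) : c *: (a * b) = a * (c *: b).
Proof.
apply/malgP => k; rewrite mcoeffZ.
have ha := finmap.fsubset_refl (msupp a).
rewrite [X in c * X](mcoeffMlw k ha (finmap.fsubset_refl (msupp b))).
rewrite [RHS](mcoeffMlw k ha (msuppZ_le c b)).
rewrite mulr_sumr; apply: eq_bigr => k1 _.
rewrite mulr_sumr; apply: eq_bigr => k2 _.
by rewrite mcoeffZ mulrnAr mulrCA.
Qed.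

Definition env_rel (a : freealg) : Prop :=
  (exists c x y, a = letter (c *: x + y) - (c *: letter x + letter y)) \/
  (exists x y,
     a = letter x * letter y - letter y * letter x - letter (bracket x y)).

Definition env_ideal : {pred freealg} := fun a => `[<
  exists s : seq (freealg * freealg * freealg),
    (forall t, t \in s -> env_rel t.1.2) /\
    a = \sum_(t <- s) t.1.1 * t.1.2 * t.2 >].

Lemma env_ideal_zmod : zmod_closed env_ideal.
Proof.
split; first by apply/asboolP; exists [::]; rewrite big_nil.
move=> a b /asboolP[s [hs ->]] /asboolP[t [ht ->]]; apply/asboolP.
exists (s ++ [seq (- u.1.1, u.1.2, u.2) | u <- t]); split.
  move=> u; rewrite mem_cat => /orP[/hs //|/mapP[v /ht hv ->]] //.
rewrite big_cat big_map /= -sumrN; congr (_ + _).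
by apply: eq_bigr => u _; rewrite !mulNr.
Qed.

HB.instance Definition _ :=
  GRing.isZmodClosed.Build freealg env_ideal env_ideal_zmod.

Lemma env_idealMl a b : b \in env_ideal -> a * b \in env_ideal.
Proof.
move=> /asboolP[s [hs ->]]; apply/asboolP.
exists [seq (a * u.1.1, u.1.2, u.2) | u <- s]; split.
  by move=> u /mapP[v /hs hv ->].
by rewrite big_map mulr_sumr; apply: eq_bigr => u _; rewrite !mulrA.
Qed.

Lemma env_idealMr a b : a \in env_ideal -> a * b \in env_ideal.
Proof.
move=> /asboolP[s [hs ->]]; apply/asboolP.
exists [seq (u.1.1, u.1.2, u.2 * b) | u <- s]; split.
  by move=> u /mapP[v /hs hv ->].
by rewrite big_map mulr_suml; apply: eq_bigr => u _ /=; exact/esym/mulrA.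
Qed.

Lemma env_ideal_rel a : env_rel a -> a \in env_ideal.
Proof.
move=> ha; apply/asboolP; exists [:: (1, a, 1)]; split.
  by move=> t; rewrite inE => /eqP ->.
by rewrite big_seq1 mul1r mulr1.
Qed.

Lemma env_ideal1 : 1 \notin env_ideal.
Proof.
pose eps : {rmorphism freealg -> F} := mcoeff (@mone {fmonom L}).
have epsM u v : eps (u * v) = eps u * eps v by exact: rmorphM.
have epsl x : eps (letter x) = 0.
  by rewrite /eps /= /letter mcoeffU fmP fmU fm1.
have epsr a : env_rel a -> eps a = 0.
  case=> [[c [x [y ->]]]|[x [y ->]]]; last first.
    move: (letter x) (letter y) (letter _) (epsl x) (epsl y) (epsl (bracket x y)).
    move=> u v w eu ev ew; rewrite rmorphB rmorphB !epsM.
    by rewrite eu ev ew mulr0 !subr0.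
  by rewrite rmorphB rmorphD /= !epsl /= mcoeffZ [mcoeff _ _]epsl mulr0 addr0 subr0.
apply/asboolP => -[s [hs /(congr1 eps)]]; rewrite rmorph1 rmorph_sum /= big_seq.
rewrite big1 => [/eqP|t /hs /epsr h]; first by rewrite oner_eq0.
by rewrite !rmorphM /= h mulr0 mul0r.
Qed.

Definition Uenv : Type := {ideal_quot env_ideal}.

HB.instance Definition _ := Choice.on Uenv.
HB.instance Definition _ := GRing.Zmodule.on Uenv.

Definition env_pi : freealg -> Uenv := (\pi_({ideal_quot env_ideal}))%qT.

Definition env_one : Uenv := env_pi 1.
Definition env_mul (u v : Uenv) : Uenv := env_pi (repr u * repr v).
Definition env_scale (c : F) (u : Uenv) : Uenv := env_pi (c *: repr u).

Lemma env_piP a b : reflect (env_pi a = env_pi b) (a - b \in env_ideal).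
Proof. by rewrite Quotient.idealrBE; apply: eqP. Qed.

Lemma env_repr (u : Uenv) : env_pi (repr u) = u.
Proof. exact: reprK. Qed.

Lemma env_piD a b : env_pi (a + b) = env_pi a + env_pi b.
Proof. exact: raddfD. Qed.

Lemma env_piM a b : env_pi (a * b) = env_mul (env_pi a) (env_pi b).
Proof.
set a' := repr (env_pi a); set b' := repr (env_pi b); apply/env_piP.
have ha : a - a' \in env_ideal by apply/env_piP; rewrite env_repr.
have hb : b - b' \in env_ideal by apply/env_piP; rewrite env_repr.
rewrite -/a' -/b'.
have -> : a * b - a' * b' = (a - a') * b + a' * (b - b').
  by rewrite mulrBl mulrBr addrA subrK.
by apply: rpredD; [apply: env_idealMr | apply: env_idealMl].
Qed.

Lemma env_piZ c a : env_pi (c *: a) = env_scale c (env_pi a).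
Proof.
apply/env_piP; rewrite -scalerBr -[_ - _]mul1r scalerAl.
by rewrite env_idealMl //; apply/env_piP; rewrite env_repr.
Qed.

Lemma env_mulA : associative env_mul.
Proof.
move=> u v w; rewrite -(env_repr u) -(env_repr v) -(env_repr w).
by rewrite -!env_piM mulrA.
Qed.

Lemma env_mul1 : left_id env_one env_mul.
Proof. by move=> u; rewrite -(env_repr u) -env_piM mul1r. Qed.

Lemma env_mulr1 : right_id env_one env_mul.
Proof. by move=> u; rewrite -(env_repr u) -env_piM mulr1. Qed.

Lemma env_mulDl : left_distributive env_mul +%R.
Proof.
move=> u v w; rewrite -(env_repr u) -(env_repr v) -(env_repr w).
by rewrite -env_piD -!env_piM mulrDl env_piD.
Qed.

Lemma env_mulDr : right_distributive env_mul +%R.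
Proof.
move=> u v w; rewrite -(env_repr u) -(env_repr v) -(env_repr w).
by rewrite -env_piD -!env_piM mulrDr env_piD.
Qed.

Lemma env_one_neq0 : env_one != 0.
Proof.
apply: contra env_ideal1 => /eqP h; rewrite -[1]subr0; apply/env_piP.
by rewrite -/env_one h [RHS]raddf0.
Qed.

HB.instance Definition _ := GRing.Zmodule_isNzRing.Build Uenv
  env_mulA env_mul1 env_mulr1 env_mulDl env_mulDr env_one_neq0.

Lemma env_scaleA a b (u : Uenv) :
  env_scale a (env_scale b u) = env_scale (a * b) u.
Proof. by rewrite -(env_repr u) -!env_piZ scalerA. Qed.

Lemma env_scale1 : left_id 1 env_scale.
Proof. by move=> u; rewrite -(env_repr u) -env_piZ scale1r. Qed.

Lemma env_scaleDr : right_distributive env_scale +%R.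
Proof.
move=> c u v; rewrite -(env_repr u) -(env_repr v).
by rewrite -env_piD -!env_piZ scalerDr env_piD.
Qed.

Lemma env_scaleDl u : {morph env_scale^~ u : a b / a + b}.
Proof.
by move=> a b; rewrite -(env_repr u) -!env_piZ scalerDl env_piD.
Qed.

HB.instance Definition _ := GRing.Zmodule_isLmodule.Build F Uenv
  env_scaleA env_scale1 env_scaleDr env_scaleDl.

Lemma env_scaleAl (c : F) (u v : Uenv) : c *: (u * v) = (c *: u) * v.
Proof.
rewrite -(env_repr u) -(env_repr v).
by rewrite -[LHS]/(env_scale _ (env_mul _ _)) -[RHS]/(env_mul (env_scale _ _) _)
  -env_piM -!env_piZ -env_piM scalerAl.
Qed.

HB.instance Definition _ := GRing.Lmodule_isLalgebra.Build F Uenv env_scaleAl.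

Lemma env_scaleAr (c : F) (u v : Uenv) : c *: (u * v) = u * (c *: v).
Proof.
rewrite -(env_repr u) -(env_repr v).
by rewrite -[LHS]/(env_scale _ (env_mul _ _)) -[RHS]/(env_mul _ (env_scale _ _))
  -env_piM -!env_piZ -env_piM freealg_scaleAr.
Qed.

HB.instance Definition _ := GRing.Lalgebra_isAlgebra.Build F Uenv env_scaleAr.

Definition env_in (x : L) : Uenv := env_pi (letter x).

Lemma env_in_linear : linear env_in.
Proof.
move=> c x y; rewrite -[c *: env_in x]/(env_scale c (env_in x)) /env_in -env_piZ -env_piD.
by apply/env_piP/env_ideal_rel; left; exists c, x, y.
Qed.

Lemma env_in_bracket x y :
  env_in (bracket x y) = env_in x * env_in y - env_in y * env_in x.
Proof.
rewrite -![_ * _]/(env_mul _ _) /env_in -!env_piM -[RHS]raddfB.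
apply/esym/env_piP/env_ideal_rel.
by right; exists x, y.
Qed.

(* The universal property of the enveloping algebra. *)
Lemma env_universal (A : algType F) (f : L -> A) :
    linear f -> (forall x y, f (bracket x y) = f x * f y - f y * f x) ->
  exists phi : {lrmorphism Uenv -> A}, (forall x, phi (env_in x) = f x) /\
    forall psi : {lrmorphism Uenv -> A}, (forall x, psi (env_in x) = f x) ->
      psi =1 phi.
Proof.
move=> linf brf.
pose h (m : {fmonom L}) : A := \prod_(x <- fmonom_val m) f x.
have hM : mmorphism h.
  by split=> [m1 m2|]; rewrite /h ?fmM ?big_cat // fm1 big_nil.
pose hm : {mmorphism {fmonom L} -> A} :=
  HB.pack h (isMultiplicative.Build _ _ h hM).
pose e : {malg F[{fmonom L}]} -> A := mmap (in_alg A) hm.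
have [eM e1] : {morph e : a b / a * b} * (e 1 = 1).
  apply: commr_mmap_is_multiplicative => g m m'.
  by rewrite /GRing.comm /= mulr_algl mulr_algr.
have eB : {morph e : a b / a - b} by move=> a b; rewrite /e raddfB.
have eD a b : e (a + b) = e a + e b by rewrite /e raddfD.
have eZ c a : e (c *: a) = c *: e a by rewrite /e mmapZ /= mulr_algl.
have el x : e (letter x) = f x.
  by rewrite /e mmapU /= scale1r mul1r /h fmU big_seq1.
have er a : env_rel a -> e a = 0.
  case=> [[c [x [y ->]]]|[x [y ->]]].
    by rewrite eB eD eZ !el linf subrr.
  have := brf x y; rewrite -!el.
  move: (letter x) (letter y) (letter _) => u v w ew.
  by rewrite 2!eB (eM u v) (eM v u) ew subrr.
pose e' : {additive freealg -> A} := HB.pack e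
  (GRing.isZmodMorphism.Build freealg A e eB).
have eI a : a \in env_ideal -> e a = 0.
  move=> /asboolP[s [hs ->]]; rewrite -[LHS]/(e' _) raddf_sum /= big_seq big1 // => t /hs ht.
  by rewrite !eM (er _ ht) mulr0 mul0r.
pose p (u : Uenv) := e (repr u).
have pE a : p (env_pi a) = e a.
  apply/eqP; rewrite -subr_eq0 -eB; apply/eqP/eI/env_piP.
  by rewrite env_repr.
have plin : linear p.
  move=> c u v; rewrite -(env_repr u) -(env_repr v).
  by rewrite -[c *: _]/(env_scale _ _) -env_piZ -env_piD !pE eD eZ.
have pM : monoid_morphism p.
  split=> [|u v]; first by rewrite -[1]/(env_pi 1) pE e1.
  rewrite -(env_repr u) -(env_repr v) -[_ * _ in LHS]/(env_mul _ _).
  by rewrite -env_piM !pE eM.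
pose phi : {lrmorphism Uenv -> A} := HB.pack p
  (GRing.isLinear.Build _ _ _ _ p plin) (GRing.isMonoidMorphism.Build _ _ p pM).
exists phi; split=> [x|psi hpsi u]; first by rewrite /= pE el.
rewrite -(env_repr u) [RHS]pE; move: (repr u) => a {u}.
have env_piB : zmod_morphism env_pi by move=> b c; rewrite /env_pi raddfB.
pose q : {additive freealg -> Uenv} := HB.pack env_pi
  (GRing.isZmodMorphism.Build _ _ env_pi env_piB).
have mZ c k : mkmalgU k c = c *: (mkmalgU k 1 : freealg) :> freealg.
  by apply/malgP => m; rewrite mcoeffZ !mcoeffU mulr_natr.
rewrite -[env_pi a]/(q a) -[e a]/(e' a) (monalgE a : a = _ :> freealg) !raddf_sum.
apply: eq_bigr => k _; rewrite mZ.
rewrite /= eZ env_piZ -[env_scale _ _]/(_ *: env_pi _) linearZ; congr (_ *: _).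
rewrite -[k]fmK; elim: (fmonom_val k) => [|x w IH].
  by rewrite -fm1 fmK -[env_pi _]/(1 : Uenv) rmorph1 e1.
have -> : mkmalgU (FMonom (x :: w)) 1 =
    letter x * mkmalgU (FMonom w) 1 :> freealg.
  rewrite /letter [RHS]malgM_def fgmulUU mulr1; congr mkmalgU.
  by apply/eqP; rewrite fmP fmM fmU.
transitivity (psi (env_in x) * psi (env_pi (mkmalgU (FMonom w) 1))).
  by rewrite env_piM; apply: (rmorphM psi).
by rewrite hpsi eM el; congr (_ * _).
Qed.


End Enveloping.

(** * Adjoint actions, filtrations and invariants *)

Section Invariants.
Variables (F : fieldType) (L : lieType F).

Notation dimL := (\dim {: L}).
Notation basisL := (tnth (vbasis {: L})).

(* The derivation of S(L) extending y |-> bracket x y. *)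
Definition sym_ad (x : L) (p : Sym L) : Sym L :=
  \sum_(i < dimL) sym_in (bracket x (basisL i)) * mderiv i p.

Definition env_ad (x : L) (u : Uenv L) : Uenv L :=
  env_in x * u - u * env_in x.

Definition sym_filt (m : nat) : set (Sym L) :=
  [set p : Sym L | (msize p <= m.+1)%N].

(* The span of the products of at most m elements of L. *)
Definition env_filt (m : nat) : set (Uenv L) :=
  [set u : Uenv L | exists s : seq (F * seq L),
     all (fun t => size t.2 <= m)%N s /\
     u = \sum_(t <- s) t.1 *: \prod_(x <- t.2) env_in x].

(* An element t of [tens A] stands for \sum_j t j \otimes e_j in A \otimes L,
   where (e_j) is the basis [vbasis {:L}] of L. *)
Definition tens (A : Type) := 'I_dimL -> A.

Definition tens_map (A B : Type) (f : A -> B) (t : tens A) : tens B :=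
  fun j => f (t j).

(* The identification of F \otimes L with L. *)
Definition tens_val (t : tens F) : L := \sum_(j < dimL) t j *: basisL j.

(* The diagonal action on A \otimes L, given the action of L on A. *)
Definition tens_act (A : lmodType F) (act : L -> A -> A) (x : L) (t : tens A) :
    tens A :=
  fun j => act x (t j) +
    \sum_(i < dimL) coord (vbasis {: L}) j (bracket x (basisL i)) *: t i.

Definition tens_inv (A : lmodType F) (act : L -> A -> A) : set (tens A) :=
  [set t | forall x j, tens_act act x t j = 0].

Definition tens_filt (A : lmodType F) (filt : set A) : set (tens A) :=
  [set t | forall j, filt (t j)].

(* The one-sided ideals N A and A N generated by a subspace N of L. *)
Definition ideal_r (A : algType F) (iota : L -> A) (N : {vspace L}) : set A :=
  [set a | exists s : seq (L * A),
     all (fun t => t.1 \in N) s /\ a = \sum_(t <- s) iota t.1 * t.2].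

Definition ideal_l (A : algType F) (iota : L -> A) (N : {vspace L}) : set A :=
  [set a | exists s : seq (L * A),
     all (fun t => t.1 \in N) s /\ a = \sum_(t <- s) t.2 * iota t.1].

End Invariants.

(** * Chevalley and Harish-Chandra projections, and the two filtrations *)

Section Filtrations.
Variables (F : fieldType) (L : lieType F) (T : tridec L).

Local Notation h := (cartan T).

(* S(h); it is identified with the subalgebras of S(L) and of U(L) generated
   by h through [sym_ext (sym_in \o vsval)] and [sym_ext (env_in \o vsval)]. *)
Definition Sh := Sym (subvs_of h).

Definition Sh_to_S : Sh -> Sym L := sym_ext (fun H => sym_in (vsval H)).
Definition Sh_to_U : Sh -> Uenv L := sym_ext (fun H => env_in (vsval H)).

(* The component in S(h) with respect to the direct sum decomposition
   S(L) = S(h) + (n_- + n_+) S(L). *)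
Definition Ch (p : Sym L) : Sh :=
  xget 0 [set q : Sh |
    ideal_r (@sym_in F L) (nminus T + nplus T)%VS (p - Sh_to_S q)].

(* The component in U(h) = S(h) with respect to the direct sum decomposition
   U(L) = U(h) + (n_- U(L) + U(L) n_+). *)
Definition hc (u : Uenv L) : Sh :=
  xget 0 [set q : Sh | exists a b : Uenv L,
    [/\ ideal_r (@env_in F L) (nminus T) a, ideal_l (@env_in F L) (nplus T) b &
        u - Sh_to_U q = a + b]].

Definition ev (lam : weight h) (q : Sh) : F :=
  meval (fun i => lam (tnth (vbasis {: subvs_of h}) i)) q.

Definition filtS (m : nat) : set L :=
  (fun t => tens_val (tens_map (ev (rho T)) (tens_map Ch t))) @`
    (tens_inv (@sym_ad F L) `&` tens_filt (@sym_filt F L m)).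

Definition filtU (m : nat) : set L :=
  (fun t => tens_val (tens_map (ev (rho T)) (tens_map hc t))) @`
    (tens_inv (@env_ad F L) `&` tens_filt (@env_filt F L m)).

End Filtrations.

(* Main.v *)
(* Choose matrices for g in which h is diagonal and n_+ is strictly upper
   triangular. On A = S(g) (hb = 0) and on A = U(g) (hb = 1) there are linear
   functionals om_b, b ranging over monomials in the simple roots: for S(g) the
   Taylor coefficients of the restriction to rho + sum_k z_k e_k, for U(g) the
   value at 1 of u applied to an explicit Whittaker function on the big cell.
   In both cases om_0 is ev_rho composed with the Chevalley or Harish-Chandra
   projection, om_b kills the elements of degree < |b|, and
   sum_i y_i om_(b - e_i) (ad e_i u) = kap_b om_b (u) with kap_b > 0 for b a path.
   An invariant of degree <= m in A (x) g is an equivariant matrix X over A; by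
   this recurrence the diagonal om_0 (X_pp) is determined by any m + 1
   consecutive entries (for sp and even m, by m entries and the skew symmetry of
   X). Multiplying by the matrix of generators of g, starting from the identity
   matrix, produces enough invariants to fill this space: the diagonals are the
   polynomials of degree <= m in p for sl, and the odd polynomials of degree
   <= m in the weight coordinate for sp. This answer does not depend on hb. *)

From HB Require Import structures.
From mathcomp Require Import all_boot all_order all_fingroup all_algebra ring zify.
From mathcomp Require Import boolp classical_sets functions reals complex.
From mathcomp Require Import mpoly.
From mathcomp Require monalg.
(* Imported last, because [Sym] is also a notion of permutation groups. *)
Require Import Defs.

Set Implicit Arguments.
Unset Strict Implicit.
Unset Printing Implicit Defensive.
Import Order.TTheory GRing.Theory Num.Theory.
Local Open Scope ring_scope.

(** Symmetrization from S(g) to U(g) does not intertwine the Chevalley and Harish-Chandra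
    projections, so each filtration is computed on its own and the answers are compared. The
    obstacle is the upper bound, since om_0 alone does not see the degree of an invariant. The
    degree enters at entries far from the diagonal, where a path longer than m has coefficient 0,
    and the recurrence carries this vanishing back to the diagonal. The recurrence closes up for two
    reasons: rho is 1 on every simple coroot h_i, and the strictly lower part of [e_i, x]
    contributes terms that are antisymmetric by invariance of the trace form, so they cancel. The
    constant kap_b is an eigenvalue of a weighted Euler field for S(g), and half a difference of
    Casimir eigenvalues for U(g). Since it is nonzero along paths, an entry is determined by its two
    neighbours closer to the diagonal. The triangular decomposition is arbitrary, so the matrices
    have to be found: common eigenvectors over an algebraically closed field diagonalize h, the
    positive system orders the basis, and for sp a rescaling normalizes the form. *)

Lemma tridec_split (F : fieldType) (L : lieType F) (T : tridec L) (x : L) : exists a h b,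
  [/\ a \in nminus T, h \in cartan T, b \in nplus T & x = a + h + b].
Proof.
have : x \in (nminus T + cartan T + nplus T)%VS by rewrite tridec_full memvf.
by case/memv_addP => y /memv_addP[a ha [h hh ->]] [b hb ->]; exists a, h, b.
Qed.

(** * Words in a Lie algebra *)

Section LieMorphisms.
Variables (F : fieldType) (L : lieType F) (A : algType F).
Variable iota : {linear L -> A}.

Definition lie_word (w : seq L) : A := \prod_(x <- w) iota x.

Lemma lie_word_cons x w : lie_word (x :: w) = iota x * lie_word w.
Proof. by rewrite /lie_word big_cons. Qed.

Hypothesis iota_bracket :
  forall x y, iota (bracket x y) = iota x * iota y - iota y * iota x.

(** Each commutation replaces one letter of [w] by its bracket with [x], so the corrections keep the
    length of [w]. Inductions on length and degree bounds rest on this. *)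
Lemma lie_word_move x w : exists s : seq (seq L),
  all (fun v => size v == size w) s /\
  iota x * lie_word w = lie_word w * iota x + \sum_(v <- s) lie_word v.
Proof.
elim: w => [|y w [s [hs es]]].
  by exists [::]; rewrite /lie_word !big_nil mul1r mulr1 addr0.
exists ((bracket x y :: w) :: [seq y :: v | v <- s]); split.
  by rewrite /= eqxx all_map.
rewrite big_cons big_map lie_word_cons mulrA.
under eq_bigr do rewrite lie_word_cons.
rewrite -mulr_sumr lie_word_cons iota_bracket mulrBl -[iota y * lie_word w * _]mulrA.
rewrite addrCA -mulrDr -es -!mulrA.
by rewrite mulrA mulrA subrK.
Qed.

Hypothesis iota_span : forall u : A, exists s : seq (F * seq L),
  u = \sum_(t <- s) t.1 *: lie_word t.2.

Variable T : tridec L.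

Lemma lie_tri_ind (P : A -> Prop) :
  (forall c u v, P u -> P v -> P (c *: u + v)) -> P 1 ->
  (forall h u, h \in cartan T -> P u -> P (u * iota h)) ->
  (forall x u, x \in nplus T -> P (u * iota x)) ->
  (forall x u, x \in nminus T -> P u -> P (iota x * u)) ->
  forall u, P u.
Proof.
move=> Plin P1 Ph Pp Pm u.
have PD v w : P v -> P w -> P (v + w) by move=> pv; rewrite -[v]scale1r; apply: Plin.
have P0 : P 0 by have := Plin (-1) 1 1 P1 P1; rewrite scaleN1r addNr.
have [s ->] := iota_span u.
apply: (big_ind P P0 PD) => t _; rewrite -[_ *: _]addr0; apply: Plin => //.
move: t.2 => {s t u} w.
elim: {w}(size w) {-2}w (leqnn (size w)) => [|l IH] w.
  by rewrite leqn0 => /nilP ->; rewrite /lie_word big_nil.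
case: w => [|x w] hw; first exact: IH.
rewrite /= ltnS in hw; rewrite lie_word_cons.
have [a [h [b [ha hh hb ->]]]] := tridec_split T x.
(* A letter of h or n_+ is brought to the right end. The correcting words are one letter shorter
   than [x :: w], so [IH] covers them. *)
have mv z : P (lie_word w * iota z) -> P (iota z * lie_word w).
  have [v [hv ->]] := lie_word_move z w => pz; apply: (PD _ _) => //.
  rewrite big_seq; apply: (big_ind P P0 PD) => y yv; apply: IH.
  by rewrite (eqP (allP hv _ yv)).
rewrite !raddfD !mulrDl; apply: (PD _ _); first apply: (PD _ _).
- by apply: Pm => //; apply: IH.
- by apply: mv; apply: Ph => //; apply: IH.
- by apply: mv; apply: Pp.
Qed.

End LieMorphisms.

(** * Words span the enveloping algebra *)

Section EnvelopingWords.
Variables (F : fieldType) (L : lieType F).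

HB.instance Definition _ :=
  GRing.isLinear.Build F L (Uenv L) _ (@env_in F L) (@env_in_linear F L).

Import monalg.

Lemma env_span (u : Uenv L) : exists s : seq (F * seq L),
  u = \sum_(t <- s) t.1 *: lie_word (@env_in F L) t.2.
Proof.
pose P (u : Uenv L) := exists s : seq (F * seq L), u = \sum_(t <- s) t.1 *: lie_word (@env_in F L) t.2.
have PD a b : P a -> P b -> P (a + b).
  by move=> [s ->] [t ->]; exists (s ++ t); rewrite big_cat.
rewrite -/(P u) -(env_repr u); move: (generic_quotient.repr u) => a {u}.
rewrite (monalgE a).
have -> : env_pi (\sum_(k <- finmap.enum_fset (msupp a)) mkmalgU k (mcoeff k a)) =
    \sum_(k <- finmap.enum_fset (msupp a)) env_pi (mkmalgU k (mcoeff k a)).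
  apply: (big_morph (@env_pi F L)) => [x y|]; first exact: env_piD.
  by rewrite -[LHS]/(env_pi 0) /env_pi raddf0.
apply: big_ind; [by exists [::]; rewrite big_nil | exact: PD |] => k _.
exists [:: (mcoeff k a, fmonom_val k)]; rewrite big_seq1 /=.
have -> : mkmalgU k (mcoeff k a) = mcoeff k a *: (mkmalgU k 1) :> {malg F[{fmonom L}]}.
  by apply/malgP => m; rewrite mcoeffZ !mcoeffU mulr_natr.
rewrite env_piZ -[env_scale _ _]/(_ *: env_pi _); congr (_ *: _).
rewrite -{1}[k]fmK; elim: (fmonom_val k) => [|x w IH].
  by rewrite /lie_word big_nil -fm1 fmK.
have -> : mkmalgU (FMonom (x :: w)) 1 =
    letter x * mkmalgU (FMonom w) 1 :> {malg F[{fmonom L}]}.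
  rewrite /letter [RHS]malgM_def fgmulUU mulr1; congr mkmalgU.
  by apply/eqP; rewrite fmP fmM fmU.
by rewrite env_piM lie_word_cons /= -IH.
Qed.

End EnvelopingWords.

(** * Vector fields *)

Section Endomorphisms.
Variables (F : fieldType) (V : algType F).

(** Linear endomorphisms of an infinite-dimensional space have to form an algebra, to serve as
    target in [env_universal]. They are cut out of the module of all functions, which supplies the
    linear structure; the unit of [V] is the nonzero vector that shows this algebra nontrivial. *)
Definition linear_pred : {pred V -> V} := fun f => `[< linear f >].

Lemma linear_pred_submod : submod_closed linear_pred.
Proof.
split=> [|c f g /asboolP lf /asboolP lg]; apply/asboolP => a u v.
  by rewrite /GRing.zero /= /GRing.zero /= scaler0 addr0.
rewrite -[LHS]/(c *: f (a *: u + v) + g (a *: u + v)) lf lg.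
rewrite -[(c *: f + g) u]/(c *: f u + g u) -[(c *: f + g) v]/(c *: f v + g v).
by rewrite !scalerDr !scalerA mulrC addrACA.
Qed.

HB.instance Definition _ :=
  GRing.isSubmodClosed.Build F (V -> V) linear_pred linear_pred_submod.

Record endo := Endo { endo_fun : V -> V; endo_linP : endo_fun \in linear_pred }.
HB.instance Definition _ := [isSub for endo_fun].
HB.instance Definition _ := [Choice of endo by <:].
HB.instance Definition _ := [SubChoice_isSubLmodule of endo by <:].

Lemma endo_ext (f g : endo) : endo_fun f =1 endo_fun g -> f = g.
Proof. by move=> fg; apply: val_inj; apply/funext. Qed.

Lemma endoP (f : endo) c u v :
  endo_fun f (c *: u + v) = c *: endo_fun f u + endo_fun f v.
Proof. by have /asboolP -> := endo_linP f. Qed.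

Lemma endoB (f g : endo) u : endo_fun (f - g) u = endo_fun f u - endo_fun g u.
Proof. by []. Qed.

Lemma endo1_lin : (id : V -> V) \in linear_pred.
Proof. by apply/asboolP. Qed.

Lemma endo_comp_lin (f g : endo) : endo_fun f \o endo_fun g \in linear_pred.
Proof. by apply/asboolP => c u v /=; rewrite !endoP. Qed.

Definition endo1 := Endo endo1_lin.
Definition endo_mul f g := Endo (endo_comp_lin f g).

Lemma endo_mulA : associative endo_mul.
Proof. by move=> f g k; apply: endo_ext. Qed.

Lemma endo_mul1 : left_id endo1 endo_mul.
Proof. by move=> f; apply: endo_ext. Qed.

Lemma endo_mulr1 : right_id endo1 endo_mul.
Proof. by move=> f; apply: endo_ext. Qed.

Lemma endo_mulDl : left_distributive endo_mul +%R.
Proof. by move=> f g k; apply: endo_ext. Qed.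

Lemma endo_mulDr : right_distributive endo_mul +%R.
Proof.
move=> f g k; apply: endo_ext => u.
rewrite -[LHS]/(endo_fun f (endo_fun g u + endo_fun k u)).
by rewrite -[endo_fun g u]scale1r endoP !scale1r.
Qed.

Lemma endo1_neq0 : endo1 != 0.
Proof.
apply/eqP => /(congr1 (fun f => endo_fun f 1)) /= /eqP.
by rewrite oner_eq0.
Qed.

HB.instance Definition _ := GRing.Zmodule_isNzRing.Build endo
  endo_mulA endo_mul1 endo_mulr1 endo_mulDl endo_mulDr endo1_neq0.

Lemma endo_scaleAl (c : F) (f g : endo) : c *: (f * g) = (c *: f) * g.
Proof. by apply: endo_ext. Qed.

HB.instance Definition _ := GRing.Lmodule_isLalgebra.Build F endo endo_scaleAl.

Lemma endo_scaleAr (c : F) (f g : endo) : c *: (f * g) = f * (c *: g).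
Proof.
apply: endo_ext => u.
rewrite -[LHS]/(c *: endo_fun f (endo_fun g u)) -[RHS]/(endo_fun f (c *: endo_fun g u)).
have f0 : endo_fun f 0 = 0 by have := endoP f (-1) 0 0; rewrite !scaleN1r oppr0 addr0 addNr.
by rewrite -[_ *: endo_fun g u]addr0 endoP f0 addr0.
Qed.

HB.instance Definition _ := GRing.Lalgebra_isAlgebra.Build F endo endo_scaleAr.

Lemma endoM (f g : endo) u : endo_fun (f * g) u = endo_fun f (endo_fun g u).
Proof. by []. Qed.

End Endomorphisms.

Section VectorFields.
Variables (F : fieldType) (n : nat).
Local Notation R := {mpoly F[n]}.

Definition vfield (v : 'I_n -> R) (p : R) : R := \sum_(i < n) v i * mderiv i p.

Lemma vfield_linear v : linear (vfield v).
Proof.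
move=> c p q; rewrite /vfield scaler_sumr -big_split; apply: eq_bigr => i _ /=.
by rewrite linearP /= mulrDr scalerAr.
Qed.

Lemma vfieldM v p q : vfield v (p * q) = vfield v p * q + p * vfield v q.
Proof.
rewrite /vfield mulr_suml mulr_sumr -big_split; apply: eq_bigr => i _ /=.
by rewrite mderivM mulrDr !mulrA [v i * p]mulrC.
Qed.

Lemma vfieldX v i : vfield v 'X_i = v i.
Proof.
have U0 : (U_(i) - U_(i) = 0 :> 'X_{1..n})%MM.
  by apply/mnmP => k; rewrite mnmBE mnm0E subnn.
rewrite /vfield (bigD1 i) //= mderivX mnm1E eqxx scale1r U0 mpolyX0 mulr1.
by rewrite big1 ?addr0 // => j ji; rewrite mderivX mnm1E eq_sym (negPf ji) scale0r mulr0.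
Qed.

(** Both maps are derivations along [th] and vanish at 1, so the product rule reduces everything to
    the variables. It is applied with [th] the identity, the slice map and the constant coefficient
    of the slice map. *)
Lemma derivation_ext (S : algType F) (th D E : R -> S) : th 1 = 1 ->
  linear D -> linear E ->
  (forall p q, D (p * q) = D p * th q + th p * D q) ->
  (forall p q, E (p * q) = E p * th q + th p * E q) ->
  (forall i, D 'X_i = E 'X_i) -> D =1 E.
Proof.
move=> th1 lD lE DM EM DX p.
have D1 : D 1 = 0.
  by apply: (addrI (D 1)); rewrite addr0 -{3}[1]mulr1 DM th1 mulr1 mul1r.
have E1 : E 1 = 0.
  by apply: (addrI (E 1)); rewrite addr0 -{3}[1]mulr1 EM th1 mulr1 mul1r.
have D0 : D 0 = 0 by have := lD (-1) 0 0; rewrite !scaleN1r oppr0 addr0 addNr.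
have E0 : E 0 = 0 by have := lE (-1) 0 0; rewrite !scaleN1r oppr0 addr0 addNr.
elim/mpolyind: p => [|c m p _ _ IH]; first by rewrite D0 E0.
rewrite lD lE IH; congr (c *: _ + _) => {c p IH}.
rewrite mpolyXE_id; apply: (big_ind (fun p => D p = E p)).
- by rewrite D1 E1.
- by move=> p q hp hq; rewrite DM EM hp hq.
move=> i _; elim: (m i) => [|k IH]; first by rewrite expr0 D1 E1.
by rewrite exprS DM EM DX IH.
Qed.

HB.instance Definition _ v :=
  GRing.isLinear.Build F R R _ (vfield v) (vfield_linear v).

Lemma vfield_comm v w u :
  (forall i, vfield v (w i) - vfield w (v i) = u i) ->
  forall p, vfield v (vfield w p) - vfield w (vfield v p) = vfield u p.
Proof.
move=> huv; apply: (@derivation_ext _ id) => //.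
- by move=> c p q /=; rewrite !vfield_linear scalerBr opprD addrACA.
- exact: vfield_linear.
- by move=> p q; rewrite !vfieldM !linearD /= !vfieldM; ring.
- exact: vfieldM.
- by move=> i; rewrite !vfieldX.
Qed.

Lemma vfieldC v c : vfield v c%:MP = 0.
Proof. by rewrite /vfield big1 // => i _; rewrite mderivC mulr0. Qed.

Lemma vfield1 v : vfield v 1 = 0.
Proof. exact: vfieldC. Qed.

Lemma vfield_prod v (I : finType) (f g : I -> R) :
  (forall i, vfield v (f i) = g i * f i) ->
  vfield v (\prod_i f i) = (\sum_i g i) * \prod_i f i.
Proof.
move=> hf; apply: (big_rec2 (fun a b => vfield v a = b * a)) => [|i a b _ IH].
  by rewrite vfield1 mul0r.
by rewrite vfieldM IH hf; ring.
Qed.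

End VectorFields.

Section DerivationRules.
Variables (F : fieldType) (n : nat) (v : 'I_n -> {mpoly F[n]}).
Local Notation R := {mpoly F[n]}.
Local Notation D := (vfield v).

Lemma vfield_prodD (I : finType) (f : I -> R) :
  D (\prod_i f i) = \sum_i D (f i) * \prod_(j | j != i) f j.
Proof.
have gen (s : seq I) : uniq s -> D (\prod_(i <- s) f i) =
    \sum_(i <- s) D (f i) * \prod_(j <- s | j != i) f j.
  elim: s => [|i s IH] /=; first by rewrite !big_nil vfield1.
  case/andP=> his us; rewrite !big_cons vfieldM IH // eqxx; congr (_ * _ + _).
    rewrite big_seq [RHS]big_seq_cond; apply: eq_bigl => j.
    by case: eqP => [->|]; rewrite ?(negPf his) ?andbT.
  rewrite mulr_sumr [in LHS]big_seq [in RHS]big_seq; apply: eq_bigr => j js.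
  rewrite big_cons; have -> : i != j by apply: contraNneq his => ->.
  by rewrite mulrCA.
by have := gen (index_enum I) (index_enum_uniq I).
Qed.

Lemma vfieldXn p m : D (p ^+ m) = m%:R * p ^+ m.-1 * D p.
Proof.
elim: m => [|m IH]; first by rewrite expr0 vfield1 !mul0r.
rewrite exprS vfieldM IH /=; case: m {IH} => [|m] /=; first by rewrite expr0; ring.
by rewrite [p ^+ m.+1]exprS -[m.+2%:R]natr1; ring.
Qed.

(** Jacobi's formula for the derivative of a determinant. *)
Lemma vfield_det m (M : 'M[R]_m) :
  D (\det M) = \tr (\adj M *m map_mx D M).
Proof.
(* The product rule differentiates one row at a time. Expanding along that row gives the cofactors
   of [M] itself. *)
transitivity (\sum_(i < m) \det (\matrix_(k, j) if k == i then D (M k j) else M k j)); last first.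
  rewrite mxtrace_mulC /mxtrace; apply: eq_bigr => i _.
  rewrite (expand_det_row _ i) [RHS]mxE; apply: eq_bigr => j _.
  set M' := \matrix_(_, _) _.
  have -> : M' i j = D (M i j) by rewrite mxE eqxx.
  have -> : map_mx D M i j = D (M i j) by rewrite mxE.
  have -> : (\adj M) j i = cofactor M i j by rewrite mxE.
  suff -> : cofactor M' i j = cofactor M i j by [].
  rewrite /cofactor; congr (_ * \det _); apply/matrixP => k l; rewrite !mxE.
  by rewrite eq_sym (negPf (neq_lift _ _)).
rewrite /determinant [LHS]raddf_sum [RHS]exchange_big; apply: eq_bigr => s _.
rewrite -mulr_sumr /= vfieldM.
have -> : D ((-1) ^+ s) = 0.
  by case: (odd_perm s); rewrite ?expr1 ?expr0 ?linearN /= vfield1 ?oppr0.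
rewrite mul0r add0r vfield_prodD; congr (_ * _); apply: eq_bigr => i _.
rewrite [RHS](bigD1 i) //= mxE eqxx; congr (_ * _).
by apply: eq_bigr => j /negPf ji; rewrite mxE ji.
Qed.

End DerivationRules.

(** * The big cell of the space of matrices *)

Section BigCell.
Variables (F : fieldType) (n K : nat).
Hypothesis ltKn : (K <= n)%N.
Local Notation N := n.+1.

(** Coordinates on the locus where the leading minors are invertible: the matrix entries and one
    further variable for the inverse of each minor. The relations between them are not divided out;
    identities hold modulo [cell_ideal]. *)
Definition cell_var := ('I_N * 'I_N + 'I_K)%type.
Local Notation d := #|{: cell_var}|.
Local Notation R := {mpoly F[d]}.

Definition cell_row (k : 'I_K) (i : 'I_k.+1) : 'I_N := inord i.
(** The rows 0, ..., k-1, k+1: only the last one is moved down. *)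
Definition cell_row' (k : 'I_K) (i : 'I_k.+1) : 'I_N := inord (i + (i == k :> nat)).

Definition cellX : 'M[R]_N := \matrix_(i, j) 'X_(enum_rank (inl (i, j) : cell_var)).
Definition cellY (k : 'I_K) : R := 'X_(enum_rank (inr k : cell_var)).

Definition minor0 (k : 'I_K) : 'M[R]_k.+1 :=
  \matrix_(i, j) cellX (cell_row i) (cell_row j).
Definition minor1 (k : 'I_K) : 'M[R]_k.+1 :=
  \matrix_(i, j) cellX (cell_row' i) (cell_row j).
Definition Delta k : R := \det (minor0 k).
Definition Delta' k : R := \det (minor1 k).

Definition cell_field (W : 'M[R]_N) (y : 'I_K -> R) (a : 'I_d) : R :=
  match enum_val a with inl ij => W ij.1 ij.2 | inr k => y k end.

(* [cellY k] plays the role of the inverse of [Delta k]; vector fields in the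
   matrix coordinates are extended to it accordingly. *)
Definition cell_der0 W : R -> R := vfield (cell_field W (fun=> 0)).
Definition cell_der W : R -> R :=
  vfield (cell_field W (fun k => - (cellY k ^+ 2 * cell_der0 W (Delta k)))).

HB.instance Definition _ W := GRing.Linear.on (cell_der0 W).
HB.instance Definition _ W := GRing.Linear.on (cell_der W).

Lemma cell_fieldl W y ij : cell_field W y (enum_rank (inl ij : cell_var)) = W ij.1 ij.2.
Proof. by rewrite /cell_field enum_rankK. Qed.

Lemma cell_fieldr W y k : cell_field W y (enum_rank (inr k : cell_var)) = y k.
Proof. by rewrite /cell_field enum_rankK. Qed.

Lemma cell_derX W y : map_mx (vfield (cell_field W y)) cellX = W.
Proof.
by apply/matrixP => i j; rewrite !mxE vfieldX /cell_field enum_rankK.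
Qed.

Lemma cell_derXij W y i j : vfield (cell_field W y) (cellX i j) = W i j.
Proof. by have /matrixP/(_ i j) := cell_derX W y; rewrite mxE. Qed.

Lemma cell_derY W y k : vfield (cell_field W y) (cellY k) = y k.
Proof. by rewrite vfieldX /cell_field enum_rankK. Qed.

Lemma cell_derM W p q : cell_der W (p * q) = cell_der W p * q + p * cell_der W q.
Proof. exact: vfieldM. Qed.

Lemma cell_der_Y W k : cell_der W (cellY k) = - (cellY k ^+ 2 * cell_der0 W (Delta k)).
Proof. exact: cell_derY. Qed.

(** On polynomials free of the inverse variables [cell_der] and [cell_der0] agree, which lets the
    minors and their derivatives be handled with the simpler field. *)
Definition xonly (p : R) := forall k, mderiv (enum_rank (inr k : cell_var)) p = 0.

Lemma xonly_der W y z p : xonly p ->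
  vfield (cell_field W y) p = vfield (cell_field W z) p.
Proof.
move=> hp; apply: eq_bigr => a _; rewrite /cell_field.
case ea: (enum_val a) => [ij|k] //.
have -> : a = enum_rank (inr k : cell_var) by rewrite -ea enum_valK.
by rewrite hp !mulr0.
Qed.

Lemma xonly_cellX i j : xonly (cellX i j).
Proof.
move=> k; rewrite mxE mderivX mnm1E (can_eq enum_rankK) /=.
by rewrite scale0r.
Qed.

Lemma xonlyD p q : xonly p -> xonly q -> xonly (p + q).
Proof. by move=> hp hq k; rewrite linearD /= hp hq addr0. Qed.

Lemma xonlyM p q : xonly p -> xonly q -> xonly (p * q).
Proof. by move=> hp hq k; rewrite mderivM hp hq mul0r mulr0 addr0. Qed.

Lemma xonly0 : xonly 0. Proof. by move=> k; rewrite linear0. Qed.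
Lemma xonly1 : xonly 1. Proof. by move=> k; apply: mderivC. Qed.

Lemma xonly_sum (I : Type) (r : seq I) P (f : I -> R) :
  (forall i, xonly (f i)) -> xonly (\sum_(i <- r | P i) f i).
Proof. by move=> hf; apply: big_ind => //; [exact: xonly0 | exact: xonlyD]. Qed.

Lemma xonly_Delta k : xonly (Delta k).
Proof.
apply: xonly_sum => s; apply: xonlyM.
  by case: (odd_perm s) => l; rewrite ?expr1 ?expr0 ?linearN /= mderivC ?oppr0.
apply: big_ind => [||i _]; [exact: xonly1 | exact: xonlyM | rewrite mxE].
exact: xonly_cellX.
Qed.

Lemma xonly_der0 (W : 'M[R]_N) p : (forall i j, xonly (W i j)) -> xonly p -> xonly (cell_der0 W p).
Proof.
move=> hW hp; apply: xonly_sum => a; apply: xonlyM.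
  rewrite /cell_field; case: (enum_val a) => [ij|k]; [exact: hW | exact: xonly0].
by move=> k; rewrite mderiv_comm hp linear0.
Qed.

(** On matrix coordinates this is the hypothesis. For y the inverse of a minor D, applying two
    fields to y gives the term 2 y^3 D1(D) D2(D), symmetric in the two fields, and -y^2 D1(D2(D)),
    whose commutator is the expected one. *)
Lemma cell_der_comm (W1 W2 W3 : 'M[R]_N) :
  (forall i j, xonly (W1 i j)) -> (forall i j, xonly (W2 i j)) ->
  (forall i j, cell_der0 W1 (W2 i j) - cell_der0 W2 (W1 i j) = W3 i j) ->
  forall p, cell_der W1 (cell_der W2 p) - cell_der W2 (cell_der W1 p) = cell_der W3 p.
Proof.
move=> x1 x2 h12.
have h0 : forall p, cell_der0 W1 (cell_der0 W2 p) - cell_der0 W2 (cell_der0 W1 p) =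
    cell_der0 W3 p.
  apply: vfield_comm => a; rewrite /cell_field; case: (enum_val a) => [ij|k] //.
    exact: h12.
  by rewrite !linear0 addr0.
have xE W p : xonly p -> cell_der W p = cell_der0 W p by move=> hp; apply: xonly_der.
apply: vfield_comm => a; rewrite -[a]enum_valK; case: (enum_val a) => [ij|k].
  by rewrite !cell_fieldl -!/(cell_der _ _) !xE.
rewrite !cell_fieldr -!/(cell_der _ _) !linearN /=.
rewrite !cell_derM !cell_der_Y.
rewrite !(xE _ _ (xonly_der0 _ (xonly_Delta k))) // -h0 /=.
ring.
Qed.

(** The identity matrix, all of whose leading minors are 1. *)
Definition cell_pt (a : 'I_d) : F :=
  match enum_val a with inl ij => (ij.1 == ij.2)%:R | inr _ => 1 end.
Local Notation ev1 := (meval cell_pt).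

Lemma cell_ptX : map_mx ev1 cellX = 1%:M.
Proof.
by apply/matrixP => i j; rewrite !mxE mevalXU /cell_pt enum_rankK.
Qed.

Lemma cell_ptY k : ev1 (cellY k) = 1.
Proof. by rewrite mevalXU /cell_pt enum_rankK. Qed.

Lemma cell_rowK (k : 'I_K) (i : 'I_k.+1) : cell_row i = i :> nat.
Proof.
have hi := ltn_ord i; have hk := ltn_ord k; have hn := ltKn.
by apply: inordK; lia.
Qed.

Lemma cell_row'K (k : 'I_K) (i : 'I_k.+1) :
  cell_row' i = (i + (i == k :> nat))%N :> nat.
Proof.
have hi := ltn_ord i; have hk := ltn_ord k; have hn := ltKn.
by apply: inordK; lia.
Qed.

Lemma cell_ptDelta k : ev1 (Delta k) = 1.
Proof.
rewrite /Delta -det_map_mx (_ : map_mx _ _ = 1%:M) ?det1 //.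
apply/matrixP => i j; rewrite !mxE -[LHS]/(meval cell_pt _) mevalXU /cell_pt enum_rankK /=.
by rewrite -val_eqE /= !cell_rowK.
Qed.

Lemma cell_ptDelta' k : ev1 (Delta' k) = 0.
Proof.
rewrite /Delta' -det_map_mx (expand_det_row _ ord_max) big1 // => j _.
rewrite (_ : map_mx _ _ ord_max j = 0) ?mul0r //.
rewrite !mxE -[LHS]/(meval cell_pt _) mevalXU /cell_pt enum_rankK /=.
rewrite -val_eqE /= cell_rowK cell_row'K /= eqxx addn1 eqn_leq leqNgt.
by rewrite ltn_ord.
Qed.

(** A first-order operator evaluated at a point involves its coefficients only through their values
    there. This makes left and right translations agree at the identity. *)
Lemma cell_der_pt W1 W2 : map_mx ev1 W1 = map_mx ev1 W2 ->
  forall p, ev1 (cell_der W1 p) = ev1 (cell_der W2 p).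
Proof.
move=> /matrixP h12 p.
have h y z q : (forall k, ev1 (y k) = ev1 (z k)) ->
    ev1 (vfield (cell_field W1 y) q) = ev1 (vfield (cell_field W2 z) q).
  move=> hyz; rewrite !raddf_sum; apply: eq_bigr => a _.
  rewrite -![LHS]/(ev1 _) -![RHS]/(ev1 _) !mevalM; congr (_ * _); rewrite /cell_field.
  case: (enum_val a) => [ij|k] //.
  by have := h12 ij.1 ij.2; rewrite !mxE.
by apply: (h _ _ _ _) => k; rewrite !mevalN !mevalM; congr (- (_ * _)); apply: (h _ _ _ _).
Qed.

Definition cell_rel k : R := cellY k * Delta k - 1.
Definition cell_ideal (p : R) := exists a : 'I_K -> R, p = \sum_k a k * cell_rel k.

Lemma cell_idealD p q : cell_ideal p -> cell_ideal q -> cell_ideal (p + q).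
Proof.
move=> [a ->] [b ->]; exists (fun k => a k + b k).
by rewrite -big_split; apply: eq_bigr => k _; rewrite mulrDl.
Qed.

Lemma cell_idealM p q : cell_ideal q -> cell_ideal (p * q).
Proof.
move=> [b ->]; exists (fun k => p * b k).
by rewrite mulr_sumr; apply: eq_bigr => k _; rewrite mulrA.
Qed.

Lemma cell_ideal0 : cell_ideal 0.
Proof. by exists (fun=> 0); rewrite big1 // => k _; rewrite mul0r. Qed.

Lemma cell_ideal_rel k : cell_ideal (cell_rel k).
Proof.
exists (fun l => (l == k)%:R); rewrite (bigD1 k) //= eqxx mul1r big1 ?addr0 //.
by move=> l /negPf ->; rewrite mul0r.
Qed.

Lemma cell_ideal_sum (I : Type) (r : seq I) P (f : I -> R) :
  (forall i, cell_ideal (f i)) -> cell_ideal (\sum_(i <- r | P i) f i).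
Proof. by move=> hf; apply: big_ind => //; [exact: cell_ideal0 | exact: cell_idealD]. Qed.

Lemma cell_ideal_pt p : cell_ideal p -> ev1 p = 0.
Proof.
move=> [a ->]; rewrite raddf_sum big1 //= => k _.
by rewrite mevalM /cell_rel mevalB mevalM cell_ptY cell_ptDelta meval1 mulr1 subrr mulr0.
Qed.

Lemma cell_derDelta W k : cell_der W (Delta k) = cell_der0 W (Delta k).
Proof. exact/xonly_der/xonly_Delta. Qed.

(** If D' is the derivative of the minor D with inverse y, then y D - 1 has derivative - y D' (y D -
    1). The formula for the field on the inverse variables is chosen for this. *)
Lemma cell_ideal_der W p : cell_ideal p -> cell_ideal (cell_der W p).
Proof.
move=> [a ->]; rewrite linear_sum; apply: cell_ideal_sum => k.
rewrite -[X in cell_ideal X]/(cell_der W (a k * cell_rel k)) cell_derM.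
apply: cell_idealD.
  exact/cell_idealM/cell_ideal_rel.
apply: cell_idealM.
have -> : cell_der W (cell_rel k) = - (cellY k * cell_der0 W (Delta k)) * cell_rel k.
  rewrite /cell_rel linearB /= [cell_der W 1]vfield1 subr0 cell_derM cell_der_Y.
  by rewrite cell_derDelta; ring.
exact/cell_idealM/cell_ideal_rel.
Qed.

End BigCell.

(** * Translations by matrices and their action on minors *)

Section Translations.
Variables (F : numFieldType) (n K : nat).
Hypothesis ltKn : (K <= n)%N.
Local Notation N := n.+1.
Local Notation d := #|{: cell_var n K}|.
Local Notation R := {mpoly F[d]}.
Local Notation X := (cellX F n K).
Local Notation lift_mx := (map_mx (@mpolyC d F)).
Implicit Types (A B : 'M[F]_N) (k : 'I_K).

(** The velocity of X exp(tA) at t = 0. Right translations make functions on matrices a module, and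
    the left translations commute with them. *)
Definition right_field A : 'M[R]_N := X *m lift_mx A.
Definition left_field A : 'M[R]_N := lift_mx A *m X.

Lemma xonlyC c : xonly (c%:MP : R). Proof. by move=> k; apply: mderivC. Qed.

Lemma xonly_right A i j : xonly (right_field A i j).
Proof.
rewrite mxE; apply: xonly_sum => l; apply: xonlyM; first exact: xonly_cellX.
by rewrite mxE; exact: xonlyC.
Qed.

Lemma xonly_left A i j : xonly (left_field A i j).
Proof.
rewrite mxE; apply: xonly_sum => l; apply: xonlyM; last exact: xonly_cellX.
by rewrite mxE; exact: xonlyC.
Qed.

Lemma cell_der_right (W : 'M[R]_N) y A i j :
  vfield (cell_field W y) (right_field A i j) = (W *m lift_mx A) i j.
Proof.
rewrite mxE raddf_sum [RHS]mxE; apply: eq_bigr => l _ /=.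
by rewrite vfieldM cell_derXij mxE vfieldC mulr0 addr0.
Qed.

Lemma cell_der_left (W : 'M[R]_N) y A i j :
  vfield (cell_field W y) (left_field A i j) = (lift_mx A *m W) i j.
Proof.
rewrite mxE raddf_sum [RHS]mxE; apply: eq_bigr => l _ /=.
by rewrite vfieldM cell_derXij mxE vfieldC mul0r add0r.
Qed.

Lemma cell_der0_right (W : 'M[R]_N) A i j :
  cell_der0 W (right_field A i j) = (W *m lift_mx A) i j.
Proof. exact: cell_der_right. Qed.

Lemma cell_der0_left (W : 'M[R]_N) A i j :
  cell_der0 W (left_field A i j) = (lift_mx A *m W) i j.
Proof. exact: cell_der_left. Qed.

Lemma right_field_comm A B p :
  cell_der (right_field A) (cell_der (right_field B) p) -
  cell_der (right_field B) (cell_der (right_field A) p) =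
  cell_der (right_field (commx A B)) p.
Proof.
apply: cell_der_comm; [exact: xonly_right | exact: xonly_right|] => i j.
rewrite !cell_der0_right /right_field /commx map_mxB !map_mxM.
by rewrite mulmxBr !mulmxA [RHS]mxE [X in _ = _ + X]mxE.
Qed.

Lemma left_right_comm A B p :
  cell_der (left_field A) (cell_der (right_field B) p) =
  cell_der (right_field B) (cell_der (left_field A) p).
Proof.
apply/eqP; rewrite -subr_eq0; apply/eqP.
rewrite (@cell_der_comm _ _ _ _ _ 0); [|exact: xonly_left|exact: xonly_right|].
  rewrite /cell_der /vfield big1 // => a _; rewrite /cell_field.
  case: (enum_val a) => [ij|k]; first by rewrite mxE mul0r.
  rewrite /cell_der0 /vfield big1 ?mulr0 ?oppr0 ?mul0r // => b _; rewrite /cell_field.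
  by case: (enum_val b) => [ij|l]; rewrite ?mxE mul0r.
by move=> i j; rewrite cell_der0_right cell_der0_left mulmxA subrr mxE.
Qed.

Lemma left_right_pt A p :
  meval (@cell_pt F n K) (cell_der (left_field A) p) =
  meval (@cell_pt F n K) (cell_der (right_field A) p).
Proof.
apply: cell_der_pt; rewrite !map_mxM cell_ptX mul1mx mulmx1.
by [].
Qed.

(** On diagonal matrices [trk k] is a fundamental weight and [alk k] a simple root of gl; [psk k]
    reads the subdiagonal entry, the coordinate of n_- at the negative of that simple root. *)
Definition trk k A : F := \sum_(p < N | (p <= k)%N) A p p.
Definition psk k A : F := A (inord k.+1) (inord k).
Definition alk k A : F := A (inord k) (inord k) - A (inord k.+1) (inord k.+1).

Lemma sum_cell_row (V : nmodType) k (f : 'I_N -> V) :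
  (forall l : 'I_N, (k < l)%N -> f l = 0) ->
  \sum_l f l = \sum_(i < k.+1) f (cell_row n i).
Proof.
move=> f0; have hk := ltn_ord k; have hn := ltKn.
have lekN : (k.+1 <= N)%N by lia.
rewrite (big_ord_widen N (fun i => f (inord i)) lekN) [RHS]big_mkcond.
apply: eq_bigr => l _; rewrite inord_val; case: ltnP => // kl.
by rewrite f0.
Qed.

Lemma trkE k A : trk k A = \sum_(i < k.+1) A (cell_row n i) (cell_row n i).
Proof.
rewrite /trk big_mkcond (@sum_cell_row _ k) => [|l kl]; last by rewrite leqNgt kl.
by apply: eq_bigr => i _; rewrite cell_rowK // -ltnS ltn_ord.
Qed.

Lemma sum_cell_row' (V : nmodType) k (f : 'I_N -> V) :
  (forall l : 'I_N, (k.+1 < l)%N -> f l = 0) ->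
  \sum_l f l = \sum_(i < k.+1) f (cell_row' n i) + f (inord k).
Proof.
move=> f0; have hk := ltn_ord k; have hn := ltKn.
have lekN : (k.+2 <= N)%N by lia.
transitivity (\sum_(i < k.+2) f (inord i)).
  rewrite (big_ord_widen N (fun i => f (inord i)) lekN) [RHS]big_mkcond.
  by apply: eq_bigr => l _; rewrite inord_val; case: ltnP => // kl; rewrite f0.
rewrite !big_ord_recr /= -addrA [f (inord k) + _]addrC addrA; congr (_ + _ + _).
  apply: eq_bigr => i _; rewrite /cell_row' /=.
  by rewrite (ltn_eqF (ltn_ord i)) addn0.
by rewrite /cell_row' /= eqxx addn1.
Qed.

Lemma tr_lift m (B : 'M[F]_m) : \tr (lift_mx B) = (\tr B)%:MP.
Proof. by rewrite /mxtrace rmorph_sum; apply: eq_bigr => i _; rewrite mxE. Qed.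

(** Right multiplication by an upper triangular matrix mixes the first k+1 columns among themselves,
    whatever rows are selected. The matrix of the minor is thus multiplied by a block of trace
    [trk k A]. *)
Lemma vfield_minorR k (r : 'I_k.+1 -> 'I_N) (M := \matrix_(i, j) X (r i) (cell_row n j)) A :
  (forall p q : 'I_N, (q < p)%N -> A p q = 0) ->
  cell_der (right_field A) (\det M) = trk k A *: \det M.
Proof.
move=> upA; rewrite /cell_der vfield_det.
set D := vfield _; pose B := \matrix_(i < k.+1, j < k.+1) A (cell_row n i) (cell_row n j).
have -> : map_mx D M = M *m lift_mx B.
  apply/matrixP => i j; rewrite mxE [M i j]mxE /D cell_derXij [LHS]mxE [RHS]mxE.
  rewrite (@sum_cell_row _ k) => [|l kl]; last first.
    rewrite [lift_mx A _ _]mxE upA ?mulr0 // cell_rowK //.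
    by rewrite (leq_ltn_trans _ kl) // -ltnS.
  apply: eq_bigr => l _; congr (_ * _); last by rewrite !mxE.
  by rewrite [RHS]mxE.
rewrite mulmxA mul_adj_mx mul_scalar_mx linearZ /= tr_lift -mul_mpolyC mulrC trkE.
by congr (_%:MP * _); apply: eq_bigr => i _; rewrite mxE.
Qed.

Lemma derR_Delta k A : (forall p q : 'I_N, (q < p)%N -> A p q = 0) ->
  cell_der (right_field A) (Delta F n k) = trk k A *: Delta F n k.
Proof. exact: vfield_minorR. Qed.

Lemma derR_Delta' k A : (forall p q : 'I_N, (q < p)%N -> A p q = 0) ->
  cell_der (right_field A) (Delta' F n k) = trk k A *: Delta' F n k.
Proof. exact: vfield_minorR. Qed.

Lemma derL_Delta k A : (forall p q : 'I_N, (p < q)%N -> A p q = 0) ->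
  cell_der (left_field A) (Delta F n k) = trk k A *: Delta F n k.
Proof.
move=> loA; rewrite /cell_der vfield_det.
set D := vfield _; pose B := \matrix_(i < k.+1, j < k.+1) A (cell_row n i) (cell_row n j).
have -> : map_mx D (minor0 F n k) = lift_mx B *m minor0 F n k.
  apply/matrixP => i j; rewrite mxE [minor0 _ _ _ i j]mxE /D cell_derXij [LHS]mxE [RHS]mxE.
  rewrite (@sum_cell_row _ k) => [|l kl]; last first.
    rewrite [lift_mx A _ _]mxE loA ?mul0r // cell_rowK //.
    by rewrite (leq_ltn_trans _ kl) // -ltnS.
  apply: eq_bigr => l _; congr (_ * _); first by rewrite !mxE.
  by rewrite [RHS]mxE.
rewrite mxtrace_mulC -mulmxA mul_mx_adj mul_mx_scalar linearZ /= tr_lift -mul_mpolyC mulrC trkE.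
by congr (_%:MP * _); apply: eq_bigr => i _; rewrite mxE.
Qed.

(** A lower triangular matrix preserves the span of the rows 0, ..., k-1, k+1 except that row k+1
    also receives row k, with coefficient [psk k A]; this turns the minor into [Delta]. The trace
    over the selected rows is [trk k A] with the k-th diagonal entry exchanged for the next one,
    hence the [alk] term. *)
Lemma derL_Delta' k A : (forall p q : 'I_N, (p < q)%N -> A p q = 0) ->
  cell_der (left_field A) (Delta' F n k) =
    (trk k A - alk k A) *: Delta' F n k + psk k A *: Delta F n k.
Proof.
move=> loA; rewrite /cell_der vfield_det.
have hk := ltn_ord k; have hn := ltKn.
set D := vfield _; pose B := \matrix_(i < k.+1, j < k.+1) A (cell_row' n i) (cell_row' n j).
(* The contribution of the omitted row k; only the last row of [C] is nonzero. *)
pose C : 'M[R]_k.+1 :=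
  \matrix_(i, j) ((A (cell_row' n i) (inord k))%:MP * X (inord k) (cell_row n j)).
have -> : map_mx D (minor1 F n k) = lift_mx B *m minor1 F n k + C.
  apply/matrixP => i j; rewrite mxE [minor1 _ _ _ i j]mxE /D cell_derXij [LHS]mxE [RHS]mxE.
  rewrite (@sum_cell_row' _ k) => [|l kl]; last first.
    rewrite [lift_mx A _ _]mxE loA ?mul0r // (leq_ltn_trans _ kl) //.
    rewrite cell_row'K //; have := ltn_ord i; case: eqP => [->|]; lia.
  congr (_ + _); last by rewrite [RHS]mxE [lift_mx A _ _]mxE.
  rewrite [RHS]mxE; apply: eq_bigr => l _; congr (_ * _); first by rewrite !mxE.
  by rewrite [RHS]mxE.
rewrite mulmxDr linearD /=; congr (_ + _).
  rewrite mxtrace_mulC -mulmxA mul_mx_adj mul_mx_scalar linearZ /= tr_lift -mul_mpolyC mulrC.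
  congr (_%:MP * _); rewrite /mxtrace big_ord_recr /= mxE trkE big_ord_recr /= /alk.
  have -> : cell_row n (ord_max : 'I_k.+1) = inord k by [].
  have -> : cell_row' n (ord_max : 'I_k.+1) = inord k.+1.
    by rewrite /cell_row' /= eqxx addn1.
  have eqR (x a b : F) : x + a - (a - b) = x + b by ring.
  rewrite eqR; congr (_ + _); apply: eq_bigr => i _; rewrite mxE.
  have -> // : cell_row' n (widen_ord (leqnSn k) i) = cell_row n (widen_ord (leqnSn k) i).
  by rewrite /cell_row' /cell_row /= (ltn_eqF (ltn_ord i)) addn0.
rewrite mxtrace_mulC /mxtrace big_ord_recr /= big1 ?add0r => [|i _]; last first.
  rewrite mxE big1 // => j _; rewrite [C _ _]mxE loA ?mul0r //.
  rewrite /cell_row' /= (ltn_eqF (ltn_ord i)) addn0 !inordK //; have := ltn_ord i; lia.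
rewrite mxE /Delta (expand_det_row _ ord_max) scaler_sumr; apply: eq_bigr => j _.
rewrite [C _ _]mxE [minor0 _ _ _ _ _]mxE -mul_mpolyC -mulrA.
have -> : (\adj (minor1 F n k)) j ord_max = cofactor (minor1 F n k) ord_max j.
  by rewrite mxE.
have -> : cell_row' n (ord_max : 'I_k.+1) = inord k.+1.
  by rewrite /cell_row' /= eqxx addn1.
(* The two minors differ only in their last row, so they have the same cofactors along it. *)
suff -> : cofactor (minor1 F n k) ord_max j = cofactor (minor0 F n k) ord_max j by [].
rewrite /cofactor; congr (_ * \det _); apply/matrixP => p q; rewrite !mxE.
suff -> : cell_row' n (lift ord_max p) = cell_row n (lift ord_max p) by [].
rewrite /cell_row' /cell_row lift_max; congr (inord _).
have hp := ltn_ord p; rewrite (_ : (_ == _) = false) ?addn0 //.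
by apply/negbTE; rewrite neq_ltn [X in X || _]hp.
Qed.

End Translations.

(** * Whittaker functions *)

Section WhittakerFunctions.
Variables (F : numFieldType) (n K : nat).
Hypothesis ltKn : (K <= n)%N.
Local Notation N := n.+1.
Local Notation d := #|{: cell_var n K}|.
Local Notation R := {mpoly F[d]}.
Implicit Types (A B : 'M[F]_N) (k : 'I_K) (b : 'X_{1..K}).
Local Notation inI := (@cell_ideal F n K).

(** On the big cell X = U B, with U lower unipotent and B upper triangular, this is the entry (k+1,
    k) of U. *)
Definition lower_ratio k : R := cellY F n k * Delta' F n k.
Definition div_power k m : R := (m`!%:R : F)^-1 *: lower_ratio k ^+ m.
(** The product of the minors is a highest weight function of weight rho. The sum of z^b
    [whittaker b] is the Whittaker function given by the product of all Delta_k exp(z_k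
    lower_ratio_k); the factorials make derivations act on the coefficients by plain shifts of
    [b]. *)
Definition whittaker b : R := \prod_k Delta F n k * \prod_k div_power k (b k).

(** Multiplication by z_k, read on coefficients indexed by [b]. *)
Definition shift_idx (V : zmodType) (f : 'X_{1..K} -> V) k b : V :=
  if (0 < b k)%N then f (b - U_(k))%MM else 0.

Definition div_power' k m : R := if (0 < m)%N then div_power k m.-1 else 0.

Lemma der_div_power W k m :
  cell_der W (div_power k m) = cell_der W (lower_ratio k) * div_power' k m.
Proof.
rewrite /div_power linearZ /= /cell_der vfieldXn -/(cell_der _ _) /div_power'.
case: m => [|m] /=; first by rewrite !mul0r scaler0 mulr0.
have -> : (m.+1%:R : R) = (m.+1%:R : F)%:MP by rewrite rmorph_nat.
rewrite -mulrA mul_mpolyC scalerA factS natrM invfM mulrC mulrA divff ?pnatr_eq0 //.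
by rewrite mul1r /div_power -scalerAr [in RHS]mulrC.
Qed.

Lemma lower_ratio_div_power' k m :
  lower_ratio k * div_power' k m = m%:R *: div_power k m.
Proof.
rewrite /div_power'; case: m => [|m] /=; first by rewrite mulr0 scale0r.
rewrite /div_power -scalerAr -exprS scalerA factS natrM invfM mulrA divff ?pnatr_eq0 //.
by rewrite mul1r.
Qed.

Lemma div_powers_shift b k :
  div_power' k (b k) * \prod_(l | l != k) div_power l (b l) =
    shift_idx (fun b => \prod_l div_power l (b l)) k b.
Proof.
rewrite /div_power' /shift_idx; case: ltnP => b0; last by rewrite mul0r.
rewrite [RHS](bigD1 k) //= mnmBE mnm1E eqxx subn1; congr (_ * _).
by apply: eq_bigr => l /negPf lk; rewrite mnmBE mnm1E eq_sym lk subn0.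
Qed.

(** The product rule for a field that scales each minor and acts on each ratio as an affine function
    of that ratio: the constant [c k] lowers the exponent by one, the slope [a k] counts it. *)
Lemma der_whittaker W b (t a c : 'I_K -> F) :
  (forall k, cell_der W (Delta F n k) = t k *: Delta F n k) ->
  (forall k, inI (cell_der W (lower_ratio k) - (c k *: 1 - a k *: lower_ratio k))) ->
  inI (cell_der W (whittaker b) -
    (\sum_k c k *: shift_idx whittaker k b
      + (\sum_k t k - \sum_k (b k)%:R * a k) *: whittaker b)).
Proof.
move=> ht hac; pose P : R := \prod_k Delta F n k.
pose H b := \prod_k div_power k (b k).
have DP : cell_der W P = (\sum_k t k) *: P.
  rewrite /P /cell_der (vfield_prod (g := fun k => (t k)%:MP)) => [|k].
    by rewrite -rmorph_sum -mul_mpolyC.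
  by rewrite mul_mpolyC -ht.
have DH : cell_der W (H b) = \sum_k cell_der W (lower_ratio k) * shift_idx H k b.
  rewrite /H /cell_der vfield_prodD; apply: eq_bigr => k _.
  by rewrite -!/(cell_der _ _) der_div_power -mulrA div_powers_shift.
have gH k : lower_ratio k * shift_idx H k b = (b k)%:R *: H b.
  rewrite -div_powers_shift mulrA lower_ratio_div_power' -scalerAl; congr (_ *: _).
  by rewrite /H [RHS](bigD1 k).
have sW k : shift_idx whittaker k b = P * shift_idx H k b.
  by rewrite /shift_idx; case: ifP => //; rewrite mulr0.
rewrite /whittaker -/P -/(H b) cell_derM DP DH.
have -> : (\sum_k t k) *: P * H b + P * (\sum_k cell_der W (lower_ratio k) * shift_idx H k b)
   - (\sum_k c k *: shift_idx whittaker k b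
      + (\sum_k t k - \sum_k (b k)%:R * a k) *: (P * H b)) =
   \sum_k (P * shift_idx H k b) *
     (cell_der W (lower_ratio k) - (c k *: 1 - a k *: lower_ratio k)).
  have -> : (\sum_k t k - \sum_k (b k)%:R * a k) *: (P * H b) =
      (\sum_k t k) *: P * H b - \sum_k a k *: (P * (lower_ratio k * shift_idx H k b)).
    rewrite scalerBl -scalerAl; congr (_ - _); rewrite scaler_suml; apply: eq_bigr => k _.
    by rewrite gH -scalerAr scalerA mulrC.
  rewrite opprD opprB [X in _ + X]addrC addrA [X in X + _]addrC -!addrA.
  rewrite [X in _ = X](eq_bigr (fun k => P * (cell_der W (lower_ratio k) * shift_idx H k b)
     - c k *: shift_idx whittaker k b + a k *: (P * (lower_ratio k * shift_idx H k b)))).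
    rewrite !big_split /= -mulr_sumr sumrN; ring.
  move=> k _; rewrite sW -!mul_mpolyC; ring.
by apply: cell_ideal_sum => k; apply: cell_idealM.
Qed.

End WhittakerFunctions.

Section WhittakerTranslations.
Variables (F : numFieldType) (n K : nat).
Hypothesis ltKn : (K <= n)%N.
Local Notation N := n.+1.
Local Notation d := #|{: cell_var n K}|.
Local Notation R := {mpoly F[d]}.
Implicit Types (A B : 'M[F]_N) (k : 'I_K) (b : 'X_{1..K}).
Local Notation inI := (@cell_ideal F n K).

(** The two minors in a ratio have the same weight for upper triangular matrices, so the ratios are
    invariant and only the product of minors is scaled. *)
Lemma derR_whittaker A b : (forall p q : 'I_N, (q < p)%N -> A p q = 0) ->
  inI (cell_der (right_field K A) (whittaker F n b)
       - (\sum_(k < K) trk k A) *: whittaker F n b).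
Proof.
move=> upA.
have := @der_whittaker F n K (right_field K A) b (fun k => trk k A) (fun=> 0) (fun=> 0).
rewrite [X in (_ - X) *: _]big1 ?subr0 => [|k _]; last by rewrite mulr0.
rewrite [X in (X + _ *: _)]big1 ?add0r => [|k _]; last by rewrite scale0r.
apply=> k; first exact: derR_Delta.
rewrite !scale0r !subr0 /lower_ratio cell_derM cell_der_Y -cell_derDelta.
rewrite derR_Delta // derR_Delta' //.
set t := trk k A.
have -> : - (cellY F n k ^+ 2 * (t *: Delta F n k)) * Delta' F n k
    + cellY F n k * (t *: Delta' F n k) =
   - (t%:MP * cellY F n k * Delta' F n k) * cell_rel F n k.
  by rewrite /cell_rel -!mul_mpolyC; ring.
exact/cell_idealM/cell_ideal_rel.
Qed.

(** The quotient rule turns [derL_Delta] and [derL_Delta'] into the affine action psk - alk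
    lower_ratio on each ratio. *)
Lemma derL_whittaker A b : (forall p q : 'I_N, (p < q)%N -> A p q = 0) ->
  inI (cell_der (left_field K A) (whittaker F n b)
       - (\sum_(k < K) psk k A *: shift_idx (@whittaker F n K) k b
          + (\sum_(k < K) trk k A - \sum_k (b k)%:R * alk k A) *: whittaker F n b)).
Proof.
move=> loA.
apply: der_whittaker => k; first exact: derL_Delta.
rewrite /lower_ratio cell_derM cell_der_Y -cell_derDelta.
rewrite derL_Delta // derL_Delta' //.
set t := trk k A; set a := alk k A; set c := psk k A.
have -> : - (cellY F n k ^+ 2 * (t *: Delta F n k)) * Delta' F n k
    + cellY F n k * ((t - a) *: Delta' F n k + c *: Delta F n k)
    - (c *: 1 - a *: (cellY F n k * Delta' F n k)) =
   (c%:MP - t%:MP * cellY F n k * Delta' F n k) * cell_rel F n k.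
  by rewrite /cell_rel -!mul_mpolyC mpolyCB; ring.
exact/cell_idealM/cell_ideal_rel.
Qed.

Lemma whittaker_pt b : meval (@cell_pt F n K) (whittaker F n b) = (b == 0%MM)%:R.
Proof.
rewrite /whittaker mevalM rmorph_prod big1 ?mul1r => [|k _]; last exact: cell_ptDelta.
rewrite rmorph_prod /=; case: eqP => [->|/eqP b0].
  by rewrite big1 // => k _; rewrite mnm0E /div_power expr0 fact0 invr1 scale1r meval1.
have [k bk] : exists k, b k != 0%N.
  apply/existsP; rewrite -negb_forall; apply: contra b0 => /forallP h.
  by apply/eqP/mnmP => k; rewrite mnm0E; apply/eqP.
rewrite (bigD1 k) //= [X in X * _](_ : _ = 0) ?mul0r //.
rewrite /div_power mevalZ -(prednK (n := b k)) ?lt0n // exprS mevalM /lower_ratio mevalM.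
by rewrite cell_ptDelta' // mulr0 mul0r mulr0.
Qed.

End WhittakerTranslations.

(* [c] folds the Dynkin diagram of gl_(n+1) onto that of the Lie algebra: [apr_e i]
   is the sum of the E_(j, j+1) with [c j = i]. *)
Record adapted (F : numFieldType) (L : lieType F) (T : tridec L) (n K : nat)
    (c : nat -> 'I_K) (tau : F) := Adapted {
  apr : {linear L -> 'M[F]_n.+1};
  apr_bracket : forall x y, apr (bracket x y) = commx (apr x) (apr y);
  apr_inj : injective apr;
  apr_cartan : forall x, x \in cartan T ->
    forall p q : 'I_n.+1, p != q -> apr x p q = 0;
  apr_nplus : forall x, x \in nplus T ->
    forall p q : 'I_n.+1, (q <= p)%N -> apr x p q = 0;
  apr_nminus : forall x, x \in nminus T ->
    forall p q : 'I_n.+1, (p <= q)%N -> apr x p q = 0;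
  apr_rho : forall H : subvs_of (cartan T),
    (rho T H : F) = \sum_(k < K) trk k (apr (vsval H));
  apr_rank : (K <= n)%N;
  apr_fold_id : forall k : 'I_K, c k = k;
  apr_fold : forall x j, (j < n)%N ->
    apr x (inord j.+1) (inord j) = psk (c j) (apr x);
  apr_foldh : forall x j, x \in cartan T -> (j < n)%N ->
    apr x (inord j) (inord j) - apr x (inord j.+1) (inord j.+1) = alk (c j) (apr x);
  apr_e : 'I_K -> L;
  apr_eE : forall i,
    apr (apr_e i) = \sum_(j < n | c j == i) delta_mx (inord j) (inord j.+1);
  apr_h : 'I_K -> L;
  apr_hE : forall i, apr (apr_h i) = \sum_(j < n | c j == i)
    (delta_mx (inord j) (inord j) - delta_mx (inord j.+1) (inord j.+1));
  apr_len : 'I_K -> F;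
  apr_lenE : forall i, apr_len i * #|[pred j : 'I_n | c j == i]|%:R = tau;
  apr_tau : 0 < tau;
  apr_regular : forall p q : 'I_n.+1, p != q ->
    exists2 H, H \in cartan T & apr H p p != apr H q q;
  apr_h_max : forall (p q : nat), (p <= q)%N -> (q < n)%N ->
    apr (apr_h (c q)) (inord p) (inord p) <= apr (apr_h (c q)) (inord q) (inord q);
  apr_proj : {linear 'M[F]_n.+1 -> L};
  apr_projE : forall x Y, apr_proj (commx (apr x) Y) = bracket x (apr_proj Y);
  apr_proj_scale : F;
  apr_proj_scale0 : apr_proj_scale != 0;
  apr_projK : forall x, apr_proj (apr x) = apr_proj_scale *: x;
  apr_proj_cartan : forall p, apr_proj (delta_mx p p) \in cartan T;
  apr_proj_nplus : forall p q : 'I_n.+1, (q < p)%N -> apr_proj (delta_mx q p) \in nplus T;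
  apr_proj_nminus : forall p q : 'I_n.+1, (p < q)%N -> apr_proj (delta_mx q p) \in nminus T
}.

Section LieInduction.
Variables (F : fieldType) (L : lieType F) (A : algType F).
Variable iota : {linear L -> A}.
Hypothesis iota_span : forall u : A, exists s : seq (F * seq L),
  u = \sum_(t <- s) t.1 *: lie_word iota t.2.

Lemma lie_ind (P : A -> Prop) :
  (forall c u v, P u -> P v -> P (c *: u + v)) -> P 1 ->
  (forall x u, P u -> P (iota x * u)) -> forall u, P u.
Proof.
move=> Plin P1 Pm u.
have P0 : P 0 by have := Plin (-1) 1 1 P1 P1; rewrite scaleN1r addNr.
have [s ->] := iota_span u; elim: s => [|t s IH]; first by rewrite big_nil.
rewrite big_cons; apply: Plin => //.
elim: t.2 => [|x w IHw]; first by rewrite /lie_word big_nil.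
by rewrite lie_word_cons; apply: Pm.
Qed.

End LieInduction.

(** * Functionals obtained from Whittaker functions *)

Section WhittakerFunctional.
Variables (F : numFieldType) (L : lieType F) (T : tridec L) (n K : nat).
Variables (c : nat -> 'I_K) (tau : F) (ad : adapted T n c tau).
Local Notation pi := (apr ad).
Local Notation d := #|{: cell_var n K}|.
Local Notation R := {mpoly F[d]}.
Local Notation ev1 := (meval (@cell_pt F n K)).

Definition cell_act (x : L) : R -> R := cell_der (right_field K (pi x)).

Lemma cell_act_linear p : linear (cell_act^~ p).
Proof.
move=> a x y.
have XE : right_field K (pi (a *: x + y)) =
    a%:MP *: right_field K (pi x) + right_field K (pi y).
  by rewrite /right_field linearP /= map_mxD map_mxZ mulmxDr scalemxAr.
have d0 q : cell_der0 (right_field K (pi (a *: x + y))) q =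
    a *: cell_der0 (right_field K (pi x)) q + cell_der0 (right_field K (pi y)) q.
  rewrite XE /cell_der0 /vfield scaler_sumr -big_split; apply: eq_bigr => v _ /=.
  rewrite /cell_field; case: (enum_val v) => [ij|k]; last by rewrite !mul0r scaler0 addr0.
  by rewrite mxE [X in (X + _) * _]mxE mulrDl -mulrA mul_mpolyC.
rewrite /cell_act /cell_der /vfield scaler_sumr -big_split; apply: eq_bigr => v _ /=.
rewrite /cell_field; case: (enum_val v) => [ij|k].
  by rewrite XE mxE [X in (X + _) * _]mxE mulrDl -mulrA mul_mpolyC.
by rewrite d0 mulrDr opprD mulrDl -scalerAr -scalerN -scalerAl.
Qed.

Lemma cell_act_endo_subproof x : cell_act x \in @linear_pred F R.
Proof. by apply/asboolP => a p q; rewrite /cell_act linearP. Qed.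

Definition cell_endo (x : L) : endo R := Endo (cell_act_endo_subproof x).

Lemma cell_endo_linear : linear cell_endo.
Proof. by move=> a x y; apply: endo_ext => p; apply: cell_act_linear. Qed.

Lemma cell_endo_bracket x y :
  cell_endo (bracket x y) = cell_endo x * cell_endo y - cell_endo y * cell_endo x.
Proof.
apply: endo_ext => p; rewrite endoB !endoM /= /cell_act apr_bracket.
exact/esym/right_field_comm.
Qed.

Variables (A : algType F) (iota : {linear L -> A}) (phi : {lrmorphism A -> endo R}).
Hypothesis iota_span : forall u : A, exists s : seq (F * seq L),
  u = \sum_(t <- s) t.1 *: lie_word iota t.2.
Hypothesis iota_bracket :
  forall x y, iota (bracket x y) = iota x * iota y - iota y * iota x.
Hypothesis phi_iota : forall x, phi (iota x) = cell_endo x.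

Lemma phi_linear a u v p :
  endo_fun (phi (a *: u + v)) p = a *: endo_fun (phi u) p + endo_fun (phi v) p.
Proof. by rewrite linearP. Qed.

Lemma phiM x u p : endo_fun (phi (iota x * u)) p = cell_act x (endo_fun (phi u) p).
Proof. by rewrite rmorphM /= phi_iota. Qed.

Definition whit b (u : A) : F := ev1 (endo_fun (phi u) (whittaker F n b)).

Lemma whit_linear b a u v : whit b (a *: u + v) = a * whit b u + whit b v.
Proof. by rewrite /whit phi_linear mevalD mevalZ. Qed.

Lemma phi_ideal u p : cell_ideal p -> cell_ideal (endo_fun (phi u) p).
Proof.
move=> hp; move: u; apply: (lie_ind iota_span) => [a u v hu hv||x u hu].
- rewrite phi_linear; apply: cell_idealD => //.
  by rewrite -mul_mpolyC; apply: cell_idealM.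
- by rewrite rmorph1.
- by rewrite phiM; apply: cell_ideal_der.
Qed.

Lemma cell_der_lin W a p q :
  cell_der W (a *: p + q) = a *: cell_der W p + cell_der W q :> R.
Proof. exact: vfield_linear. Qed.

Lemma phi_left B u p : cell_der (left_field K B) (endo_fun (phi u) p) =
  endo_fun (phi u) (cell_der (left_field K B) p).
Proof.
move: u; apply: (lie_ind iota_span) => [a u v hu hv||x u hu].
- by rewrite !phi_linear cell_der_lin hu hv.
- by rewrite rmorph1.
- by rewrite !phiM -hu /cell_act left_right_comm.
Qed.

Lemma phi_lin u a p q :
  endo_fun (phi u) (a *: p + q) = a *: endo_fun (phi u) p + endo_fun (phi u) q.
Proof. exact: endoP. Qed.

Lemma phi_congr u p q : cell_ideal (p - q) ->
  ev1 (endo_fun (phi u) p) = ev1 (endo_fun (phi u) q).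
Proof.
move=> h; apply/eqP; rewrite -subr_eq0 -mevalB.
have -> : endo_fun (phi u) p - endo_fun (phi u) q = endo_fun (phi u) (p - q).
  by rewrite addrC -scaleN1r -phi_lin scaleN1r addrC.
by apply/eqP/cell_ideal_pt/phi_ideal; first exact: apr_rank ad.
Qed.

Lemma whit1 b : whit b 1 = (b == 0%MM)%:R.
Proof. by rewrite /whit rmorph1 /= whittaker_pt // (apr_rank ad). Qed.

Definition rhoF (x : L) : F := \sum_(k < K) trk k (pi x).

(** The rightmost factor is applied first and meets [whittaker b], which is an eigenvector modulo
    the ideal. *)
Lemma whit_upper b u x : (forall p q : 'I_n.+1, (q < p)%N -> pi x p q = 0) ->
  whit b (u * iota x) = rhoF x * whit b u.
Proof.
move=> hx; rewrite /whit.
have -> : endo_fun (phi (u * iota x)) (whittaker F n b) =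
    endo_fun (phi u) (cell_act x (whittaker F n b)) by rewrite rmorphM /= phi_iota.
rewrite (phi_congr u (derR_whittaker (apr_rank ad) b hx)).
rewrite -[_ *: _]addr0 phi_lin.
have -> : endo_fun (phi u) 0 = 0.
  by have := phi_lin u (-1) 0 0; rewrite !scaleN1r oppr0 addr0 addNr.
by rewrite addr0 mevalZ.
Qed.

Lemma phi_sum u (I : Type) (r : seq I) (a : I -> F) (p : I -> R) :
  endo_fun (phi u) (\sum_(i <- r) a i *: p i) = \sum_(i <- r) a i *: endo_fun (phi u) (p i).
Proof.
elim: r => [|i r IH]; last by rewrite !big_cons phi_lin IH.
by rewrite !big_nil; have := phi_lin u (-1) 0 0; rewrite !scaleN1r oppr0 addr0 addNr.
Qed.

(** The leftmost factor is applied last and then evaluated at the identity, where it may be replaced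
    by the left translation. That one commutes past [u] and acts on [whittaker b]. *)
Lemma whit_lower b u x : (forall p q : 'I_n.+1, (p < q)%N -> pi x p q = 0) ->
  whit b (iota x * u) = \sum_k psk k (pi x) * shift_idx (whit^~ u) k b
    + (rhoF x - \sum_k (b k)%:R * alk k (pi x)) * whit b u.
Proof.
move=> hx; rewrite {1}/whit phiM /cell_act -left_right_pt phi_left.
rewrite (phi_congr u (derL_whittaker (apr_rank ad) b hx)).
rewrite addrC phi_lin phi_sum mevalD mevalZ addrC; congr (_ + _).
rewrite raddf_sum; apply: eq_bigr => k _ /=; rewrite mevalZ; congr (_ * _).
rewrite /shift_idx; case: ifP => // _.
by have := phi_lin u (-1) 0 0; rewrite !scaleN1r oppr0 addr0 addNr => ->; rewrite meval0.
Qed.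

End WhittakerFunctional.

(** * Identities from the trace form *)

Section AdaptedAlgebra.
Variables (F : numFieldType) (L : lieType F) (T : tridec L) (n K : nat).
Variables (c : nat -> 'I_K) (tau : F) (ad : adapted T n c tau).
Local Notation pi := (apr ad).
Local Notation y := (apr_len ad).
Local Notation e := (apr_e ad).
Local Notation h := (apr_h ad).
Implicit Types (k i : 'I_K) (b : 'X_{1..K}) (x : L).

Lemma inordE (j : nat) : (j <= n)%N -> (inord j : 'I_n.+1) = j :> nat.
Proof. by move=> jn; rewrite inordK. Qed.

Lemma apr_upper x : x \in nplus T -> forall p q : 'I_n.+1, (q < p)%N -> pi x p q = 0.
Proof. by move=> hx p q /ltnW; apply: apr_nplus. Qed.

Lemma apr_lower x : x \in nminus T -> forall p q : 'I_n.+1, (p < q)%N -> pi x p q = 0.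
Proof. by move=> hx p q /ltnW; apply: apr_nminus. Qed.

Lemma apr_diag x : x \in cartan T -> forall p q : 'I_n.+1, (p < q)%N -> pi x p q = 0.
Proof. by move=> hx p q pq; apply: (apr_cartan ad hx); rewrite -val_eqE /= ltn_eqF. Qed.

Lemma apr_diag' x : x \in cartan T -> forall p q : 'I_n.+1, (q < p)%N -> pi x p q = 0.
Proof. by move=> hx p q pq; apply: (apr_cartan ad hx); rewrite -val_eqE /= gtn_eqF. Qed.

(* Faithfulness of the realization turns the triangular shapes into criteria. *)
Lemma nplusP x : (forall p q : 'I_n.+1, (q <= p)%N -> pi x p q = 0) -> x \in nplus T.
Proof.
move=> hx; have [u [v [w [hu hv hw ex]]]] := tridec_split T x.
suff uv0 : u + v = 0 by rewrite ex uv0 add0r.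
apply: (@apr_inj _ _ _ _ _ _ _ ad); rewrite raddf0 raddfD; apply/matrixP => p q.
rewrite !mxE; case: (ltngtP p q) => pq.
- by rewrite (apr_lower hu) // (apr_diag hv) // addr0.
- have := hx p q (ltnW pq); rewrite ex !raddfD [X in X = _]mxE [X in X + _]mxE.
  by rewrite (apr_upper hw) // addr0.
have := hx p q; rewrite pq => /(_ (leqnn _)); rewrite ex !raddfD [X in X = _]mxE [X in X + _]mxE.
by rewrite (apr_nplus ad hw) ?pq // addr0.
Qed.

Lemma cartanP x : (forall p q : 'I_n.+1, p != q -> pi x p q = 0) -> x \in cartan T.
Proof.
move=> hx; have [u [v [w [hu hv hw ex]]]] := tridec_split T x.
suff uw0 : u + w = 0 by rewrite ex addrAC uw0 add0r.
apply: (@apr_inj _ _ _ _ _ _ _ ad); rewrite raddf0 raddfD; apply/matrixP => p q.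
rewrite !mxE; case: (eqVneq p q) => [<-|pq].
  by rewrite (apr_nplus ad hw) // (apr_nminus ad hu) // addr0.
have := hx p q pq; rewrite ex addrAC !raddfD [X in X = _]mxE [X in X + _]mxE.
by rewrite (apr_cartan ad hv) // addr0.
Qed.

Lemma apr_e_nplus i : e i \in nplus T.
Proof.
apply: nplusP => p q qp; rewrite apr_eE summxE big1 // => j _; rewrite mxE.
have hj := ltn_ord j; case: eqP => [pj|//]; case: eqP => [qj|] //=.
by move: qp; rewrite pj qj !inordE ?ltnn // ltnW.
Qed.

Lemma apr_h_cartan i : h i \in cartan T.
Proof.
apply: cartanP => p q pq; rewrite apr_hE summxE big1 // => j _.
have z (w : 'I_n.+1) : (p == w) && (q == w) = false.
  by apply/negbTE; apply: contra pq => /andP[/eqP -> /eqP ->].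
by rewrite !mxE !z subrr.
Qed.

Definition cnt i : F := #|[pred j : 'I_n | c j == i]|%:R.

Lemma cntE i : cnt i = \sum_(j < n | c j == i) 1.
Proof. by rewrite /cnt sumr_const. Qed.

Lemma len_cnt i : y i * cnt i = tau. Proof. exact: apr_lenE. Qed.

Lemma tau_neq0 : tau != 0. Proof. by rewrite gt_eqF // (apr_tau ad). Qed.

Lemma len_gt0 i : 0 < y i.
Proof.
have cg : 0 <= cnt i by exact: ler0n.
have c0 : cnt i != 0.
  by apply: contraTneq (apr_tau ad) => c0; rewrite -(len_cnt i) c0 mulr0 ltxx.
have cp : 0 < cnt i by rewrite lt_def c0.
by rewrite -(pmulr_lgt0 _ cp) len_cnt (apr_tau ad).
Qed.

(** Pairing with e_i in the trace form reads a subdiagonal entry for each index folded onto i, and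
    these entries are all equal. *)
Lemma trace_e i x : \tr (pi x *m pi (e i)) = cnt i * psk i (pi x).
Proof.
rewrite apr_eE mulmx_sumr raddf_sum cntE mulr_suml; apply: eq_bigr => j /eqP cj.
rewrite mul1r -[LHS]/(\tr (pi x *m delta_mx (inord j) (inord j.+1))) /mxtrace.
rewrite (bigD1 (inord j.+1)) //= mxE (bigD1 (inord j)) //= mxE !eqxx mulr1.
rewrite big1 ?addr0 => [|q /negPf qj]; last by rewrite mxE qj mulr0.
rewrite big1 ?addr0 => [|p /negPf pj]; last first.
  by rewrite mxE big1 // => q _; rewrite mxE pj andbF mulr0.
by rewrite apr_fold // cj.
Qed.

Lemma mxtrace_commx (G : fieldType) m (a b d : 'M[G]_m) :
  \tr (commx a b *m d) = \tr (b *m (d *m a - a *m d)).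
Proof.
rewrite /commx mulmxBl mulmxBr [LHS]raddfB [RHS]raddfB; congr (_ - _).
  by rewrite -mulmxA [LHS]mxtrace_mulC mulmxA.
by rewrite mulmxA.
Qed.

(** By invariance of the trace form, tau times the left side is y_i y_k tr(x [e_k, e_i]),
    antisymmetric in i and k. The normalization of the lengths by tau serves to make the factor
    symmetric. *)
Lemma psk_e_antisym i k x :
  y i * psk k (pi (bracket (e i) x)) = - (y k * psk i (pi (bracket (e k) x))).
Proof.
apply: (mulfI tau_neq0).
have E i' k' : tau * (y i' * psk k' (pi (bracket (e i') x))) =
    y i' * y k' * \tr (pi x *m (pi (e k') *m pi (e i') - pi (e i') *m pi (e k'))).
  rewrite -[X in X * _ = _](len_cnt k').
  transitivity (y i' * y k' * \tr (pi (bracket (e i') x) *m pi (e k'))).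
    by rewrite trace_e; ring.
  by rewrite apr_bracket mxtrace_commx.
rewrite mulrN !E [y k * y i]mulrC -[X in - (_ * \tr (_ *m X))]opprB mulmxN.
by rewrite [\tr (- _)]raddfN mulrN opprK.
Qed.

(** Only the subdiagonal entries of x reach the diagonal of [e_i, x], and those involved all equal
    [psk i]. *)
Lemma diag_bracket_e i x p :
  pi (bracket (e i) x) p p = psk i (pi x) * pi (h i) p p.
Proof.
rewrite apr_bracket /commx apr_eE apr_hE mulmx_suml mulmx_sumr -sumrB !summxE mulr_sumr.
apply: eq_bigr => j /eqP cj; rewrite -cj -(apr_fold ad) // !mxE.
rewrite (bigD1 (inord j.+1)) //= mxE eqxx andbT big1 ?addr0 => [|q /negPf qj]; last first.
  by rewrite mxE qj andbF mul0r.
rewrite [X in _ - X](bigD1 (inord j)) //= mxE eqxx big1 ?addr0 => [|q /negPf qj]; last first.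
  by rewrite mxE qj mulr0.
case: (p =P inord j) => [->|_]; case: (_ =P inord j.+1) => [->|_] //=; rewrite ?andbb /=; ring.
Qed.

Lemma rhoF_diag x x' a : (forall p, pi x p p = a * pi x' p p) -> rhoF ad x = a * rhoF ad x'.
Proof.
move=> hx; rewrite /rhoF mulr_sumr; apply: eq_bigr => k _.
by rewrite /trk mulr_sumr; apply: eq_bigr => p _.
Qed.

Lemma alk_diag x x' a k : (forall p, pi x p p = a * pi x' p p) ->
  alk k (pi x) = a * alk k (pi x').
Proof. by move=> hx; rewrite /alk !hx mulrBr. Qed.

(** h_i is the i-th simple coroot: [trk k] of E_jj - E_(j+1)(j+1) is 1 for j = k and 0 otherwise,
    and i is the only index below K that folds onto i. *)
Lemma rhoF_h i : rhoF ad (h i) = 1.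
Proof.
rewrite /rhoF /trk (eq_bigr (fun k => \sum_(j < n | c j == i) (j == k :> nat)%:R)); last first.
  move=> k _; rewrite apr_hE.
  under eq_bigr do rewrite summxE.
  rewrite exchange_big /=; apply: eq_bigr => j _.
  have hj := ltn_ord j; have hk := ltn_ord k.
  under eq_bigr do rewrite !mxE !andbb.
  rewrite sumrB.
  have S (j' : nat) : (j' <= n)%N -> \sum_(p < n.+1 | (p <= k)%N) (p == inord j')%:R = (j' <= k)%N%:R :> F.
    move=> j'n; rewrite big_mkcond (bigD1 (inord j')) //= eqxx inordE // big1 ?addr0 => [|p /negPf ->].
      by case: ifP.
    by case: ifP.
  rewrite !S //; last exact: ltnW.
  case: ltngtP => jk; rewrite ?subr0 ?subrr // /leq; lia.
rewrite exchange_big /= (bigD1 (Ordinal (leq_trans (ltn_ord i) (apr_rank ad)))) /=; last first.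
  by rewrite (apr_fold_id ad).
rewrite (bigD1 i) //= eqxx big1 ?addr0 => [|k /negPf ki]; last by rewrite eq_sym val_eqE ki.
rewrite big1 ?addr0 // => j /andP[/eqP cj ji]; rewrite big1 // => k _.
case: eqP => // jk; case/negP: ji; rewrite -val_eqE /= -cj jk.
by rewrite (apr_fold_id ad).
Qed.

(** The Gram matrix of the simple roots, with the lengths symmetrizing the Cartan matrix. *)
Definition gramF i k : F := y i * alk k (pi (h i)).

Lemma gramF_sym i k : gramF i k = gramF k i.
Proof.
apply: (mulfI tau_neq0).
suff E i' k' : tau * gramF i' k' = y i' * y k' * \sum_p pi (h i') p p * pi (h k') p p.
  rewrite !E [y k * _]mulrC; congr (_ * _).
  by apply: eq_bigr => p _; rewrite mulrC.
rewrite -[X in X * _ = _](len_cnt k') /gramF.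
transitivity (y i' * y k' * (cnt k' * alk k' (pi (h i')))); first by ring.
congr (_ * _).
rewrite cntE mulr_suml (eq_bigr (fun p => \sum_(j < n | c j == k')
    pi (h i') p p * ((p == inord j)%:R - (p == inord j.+1)%:R))); last first.
  move=> p _; rewrite [in LHS](apr_hE ad k') summxE mulr_sumr; apply: eq_bigr => j _.
  by rewrite !mxE !andbb.
rewrite exchange_big /=; apply: eq_bigr => j /eqP cj.
rewrite mul1r -cj -(apr_foldh ad) ?apr_h_cartan //.
under eq_bigr do rewrite mulrBr.
rewrite sumrB (bigD1 (inord j)) //= eqxx mulr1 big1 ?addr0 => [|p /negPf ->]; last by rewrite mulr0.
by rewrite (bigD1 (inord j.+1)) //= eqxx mulr1 big1 ?addr0 => [|p /negPf ->] //; rewrite mulr0.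
Qed.

(** For [hb = 0], the eigenvalue of the Euler field sum y_k z_k d/dz_k on z^b. In both realizations
    y_k is half of [gramF k k]; for [hb = 1] this is then half the difference of the Casimir
    eigenvalues at the highest weights rho and rho - sum b_k alpha_k. *)
Definition kap (hb : F) b : F := \sum_k (b k)%:R * y k +
  hb * (\sum_k (b k)%:R * (2^-1 * gramF k k)
        - 2^-1 * \sum_i \sum_k (b i)%:R * (b k)%:R * gramF i k).

Lemma kap0 hb : kap hb 0%MM = 0.
Proof.
rewrite /kap !big1 ?mulr0 ?subrr ?mulr0 ?addr0 // => k _; rewrite ?mnm0E ?mul0r //.
by rewrite big1 // => i _; rewrite !mul0r.
Qed.

Lemma kapD hb b k : kap hb (b + U_(k))%MM =
  kap hb b + y k - hb * \sum_i (b i)%:R * gramF k i.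
Proof.
have E (f : 'I_K -> F) : \sum_i ((b + U_(k))%MM i)%:R * f i = \sum_i (b i)%:R * f i + f k.
  under eq_bigr do rewrite mnmDE natrD mulrDl.
  rewrite big_split /=; congr (_ + _); rewrite (bigD1 k) //= mnm1E eqxx mul1r big1 ?addr0 //.
  by move=> i /negPf ik; rewrite mnm1E eq_sym ik mul0r.
rewrite /kap !E.
have -> : \sum_i \sum_i0 ((b + U_(k))%MM i)%:R * ((b + U_(k))%MM i0)%:R * gramF i i0 =
   \sum_i \sum_i0 (b i)%:R * (b i0)%:R * gramF i i0
   + (\sum_i (b i)%:R * gramF k i) *+ 2 + gramF k k.
  under eq_bigr => i _ do under eq_bigr => l _ do rewrite -mulrA.
  under eq_bigr => i _ do rewrite -mulr_sumr E.
  rewrite E mulr2n !addrA; congr (_ + _ + _).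
  under eq_bigr do rewrite mulrDr.
  rewrite big_split /=; congr (_ + _).
    by apply: eq_bigr => i _; rewrite mulr_sumr; apply: eq_bigr => l _; rewrite mulrA.
  by apply: eq_bigr => i _; rewrite gramF_sym.
rewrite mulr2n; set S := \sum_i (b i)%:R * gramF k i.
by field.
Qed.

End AdaptedAlgebra.

(** * The recurrence between the functionals *)

Section WhittakerRecurrence.
Variables (F : numFieldType) (L : lieType F) (T : tridec L) (n K : nat).
Variables (c : nat -> 'I_K) (tau : F) (ad : adapted T n c tau).
Local Notation pi := (apr ad).
Local Notation y := (apr_len ad).
Local Notation e := (apr_e ad).
Local Notation h := (apr_h ad).
Local Notation d := #|{: cell_var n K}|.
Local Notation R := {mpoly F[d]}.
Variables (A : algType F) (iota : {linear L -> A}) (phi : {lrmorphism A -> endo R}).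
Hypothesis iota_span : forall u : A, exists s : seq (F * seq L),
  u = \sum_(t <- s) t.1 *: lie_word iota t.2.
Hypothesis iota_bracket :
  forall x y, iota (bracket x y) = iota x * iota y - iota y * iota x.
Hypothesis phi_iota : forall x, phi (iota x) = cell_endo ad x.
Local Notation om := (whit phi).
Implicit Types (k i : 'I_K) (b : 'X_{1..K}) (x : L).

Lemma whitD b u v : om b (u + v) = om b u + om b v.
Proof. by have := whit_linear phi b 1 u v; rewrite scale1r mul1r. Qed.

Lemma whit0 b : om b 0 = 0.
Proof. by apply: (addrI (om b 0)); rewrite -whitD !addr0. Qed.

Lemma whitB b u v : om b (u - v) = om b u - om b v.
Proof. by have := whit_linear phi b (-1) v u; rewrite scaleN1r mulN1r addrC => ->; rewrite addrC. Qed.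

Lemma whit_sum b (I : Type) (r : seq I) (P : pred I) (f : I -> A) :
  om b (\sum_(i <- r | P i) f i) = \sum_(i <- r | P i) om b (f i).
Proof. by apply: (big_morph (om b)); [exact: whitD | exact: whit0]. Qed.

Lemma whit_nplus b u x : x \in nplus T -> om b (u * iota x) = 0.
Proof.
move=> hx; rewrite (whit_upper iota_span phi_iota); last exact: apr_upper.
rewrite [rhoF _ _](_ : _ = 0) ?mul0r // /rhoF big1 // => k _.
by rewrite /trk big1 // => p _; rewrite (apr_nplus ad hx).
Qed.

(** A letter of n_- or h costs one letter and lowers |b| by at most one, while a letter of n_+ is
    moved to the right end and dies there. A short word runs out before b does. *)
Lemma whit_word b w : (size w < mdeg b)%N -> om b (lie_word iota w) = 0.
Proof.
elim: {w}(size w) {-2}w (erefl (size w)) b => [|l IH] [|x w] //= hw b hb.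
  by rewrite /lie_word big_nil (whit1 ad) -mdeg_eq0 gtn_eqF.
case: hw => hw; rewrite lie_word_cons.
have [u [v [z [hu hv hz ->]]]] := tridec_split T x.
have low t : (forall p q : 'I_n.+1, (p < q)%N -> pi t p q = 0) ->
    om b (iota t * lie_word iota w) = 0.
  move=> ht; rewrite (whit_lower iota_span phi_iota) // (IH w hw b) ?mulr0 ?addr0; last exact: ltnW.
  rewrite big1 // => k _; rewrite /shift_idx; case: ltnP => bk; last by rewrite mulr0.
  rewrite (IH w hw) ?mulr0 //.
  have bE : b = (b - U_(k) + U_(k))%MM.
    by rewrite submK //; apply/mnm_lepP => i; rewrite mnm1E; case: eqP => // <-.
  by move: hb; rewrite {1}bE mdegD mdeg1 addn1 ltnS.
rewrite !raddfD !mulrDl !whitD low; last exact: apr_lower.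
rewrite low; last exact: apr_diag.
have [s [hs ->]] := lie_word_move iota_bracket z w.
rewrite whitD whit_nplus // !add0r whit_sum big_seq big1 // => t /(allP hs) /eqP ht.
by apply: (IH t); rewrite ?ht // ltnW.
Qed.

Lemma shift_idxC (f : 'X_{1..K} -> F) i k b :
  shift_idx (shift_idx f k) i b = shift_idx (shift_idx f i) k b.
Proof.
rewrite /shift_idx !mnmBE !mnm1E [k == i]eq_sym; case: eqVneq => [->|_] //=.
rewrite !subn0; case: ifP; case: ifP => // _ _.
by congr f; apply/mnmP => l; rewrite !mnmBE subnAC.
Qed.

(** Both sides vanish on A n_+ and are scaled by rho under right multiplication by h, so the content
    lies in left multiplication by x in n_-. There the diagonal part psk_i(x) h_i of [e_i, x] yields
    the increment [kapD] of [kap], and its strictly lower part cancels by [psk_e_antisym]. *)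
Lemma whit_kap b u :
  \sum_i y i * shift_idx (fun b => om b (iota (e i) * u)) i b = kap ad 1 b * om b u.
Proof.
move: u b; apply: (lie_tri_ind iota_bracket iota_span (T := T)).
- move=> a u v hu hv b; rewrite whit_linear mulrDr -hv mulrCA -hu mulr_sumr -big_split.
  apply: eq_bigr => i _ /=; rewrite mulrCA -mulrDr; congr (_ * _).
  rewrite /shift_idx; case: ifP => _; last by rewrite mulr0 addr0.
  by rewrite mulrDr -scalerAr whit_linear.
- move=> b; rewrite big1 => [|i _]; last first.
    rewrite /shift_idx; case: ifP => _; last by rewrite mulr0.
    by rewrite mulr1 -[iota _]mul1r whit_nplus ?mulr0 ?apr_e_nplus.
  by rewrite (whit1 ad); case: eqP => [->|_]; rewrite ?kap0 ?mul0r ?mulr0.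
- move=> H u hH hu b; rewrite (whit_upper iota_span phi_iota); last exact: apr_diag'.
  rewrite mulrCA -hu mulr_sumr; apply: eq_bigr => i _; rewrite mulrCA; congr (_ * _).
  rewrite /shift_idx; case: ifP => _; last by rewrite mulr0.
  by rewrite mulrA (whit_upper iota_span phi_iota) //; exact: apr_diag'.
- move=> x u hx b; rewrite whit_nplus // mulr0 big1 // => i _.
  rewrite /shift_idx; case: ifP => _; last by rewrite mulr0.
  by rewrite mulrA whit_nplus ?mulr0.
move=> x u hx hu b.
have lowx := apr_lower ad hx.
have rx : rhoF ad x = 0.
  rewrite /rhoF big1 // => k _; rewrite /trk big1 // => p _.
  by rewrite (apr_nminus ad hx).
have ax k : alk k (pi x) = 0 by rewrite /alk !(apr_nminus ad hx) // subrr.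
rewrite (whit_lower iota_span phi_iota) // rx.
rewrite [X in (_ - X) * _]big1 ?subr0 ?mul0r ?addr0 => [|k _]; last by rewrite ax mulr0.
(* The factor e_i x is written as x e_i + [e_i, x]. *)
transitivity (\sum_i y i * shift_idx (fun b => om b (iota x * (iota (e i) * u))) i b
  + \sum_i y i * shift_idx (fun b => om b (iota (bracket (e i) x) * u)) i b).
  rewrite -big_split; apply: eq_bigr => i _ /=; rewrite -mulrDr; congr (_ * _).
  rewrite /shift_idx; case: ifP => _; last by rewrite addr0.
  by rewrite -whitD iota_bracket mulrBl !mulrA addrC subrK.
(* On the right side [kap] at b is split into its value one step lower, which matches the induction
   hypothesis, and the increment. *)
transitivity (\sum_k psk k (pi x) * shift_idx (fun b => kap ad 1 b * om b u) k b
  + \sum_k psk k (pi x) * shift_idx (fun b => (y k - \sum_i (b i)%:R * gramF ad k i) * om b u) k b);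
  last first.
  rewrite -big_split mulr_sumr; apply: eq_bigr => k _ /=.
  rewrite -mulrDr mulrCA; congr (_ * _); rewrite /shift_idx; case: ltnP => bk; last by rewrite mulr0 addr0.
  have bE : b = (b - U_(k) + U_(k))%MM.
    by rewrite submK //; apply/mnm_lepP => i; rewrite mnm1E; case: eqP => // <-.
  have -> : kap ad 1 b = kap ad 1 (b - U_(k) + U_(k))%MM by rewrite -bE.
  by rewrite -mulrDl kapD mul1r addrA.
congr (_ + _).
  transitivity (\sum_i \sum_k y i * (psk k (pi x) *
      shift_idx (shift_idx (fun b => om b (iota (e i) * u)) k) i b)).
    apply: eq_bigr => i _; rewrite -mulr_sumr; congr (_ * _).
    rewrite {1}/shift_idx; case: ifP => bi; last first.
      by rewrite big1 // => k _; rewrite [X in _ * X]/shift_idx bi mulr0.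
    rewrite (whit_lower iota_span phi_iota) // rx.
    rewrite [X in (_ - X) * _]big1 ?subr0 ?mul0r ?addr0 => [|k _]; last by rewrite ax mulr0.
    by apply: eq_bigr => k _; rewrite [shift_idx _ i b]/shift_idx bi.
  rewrite exchange_big; apply: eq_bigr => k _ /=.
  under eq_bigr do rewrite mulrCA.
  rewrite -mulr_sumr; congr (_ * _).
  under eq_bigr do rewrite shift_idxC.
  rewrite [in RHS]/shift_idx; case: ifP => bk; last first.
    by rewrite big1 // => i _; rewrite [X in _ * X]/shift_idx bk mulr0.
  rewrite -hu; apply: eq_bigr => i _.
  by rewrite [X in _ * X = _]/shift_idx bk.
(* e_i lies one step above the diagonal and x strictly below it, so their bracket is lower
   triangular and [whit_lower] applies. *)
have lowz i : forall p q : 'I_n.+1, (p < q)%N -> pi (bracket (e i) x) p q = 0.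
  move=> p q pq; rewrite apr_bracket apr_eE /commx mulmx_suml mulmx_sumr -sumrB summxE.
  rewrite big1 // => j _; have hj := ltn_ord j; rewrite !mxE.
  rewrite big1 => [|l _]; last first.
    rewrite mxE; case: eqP => [pj|_]; last by rewrite mul0r.
    case: eqP => [lj|_]; last by rewrite mul0r.
    rewrite (apr_nminus ad hx) ?mulr0 // lj inordE //.
    by move: pq; rewrite pj inordE ?(ltnW hj).
  rewrite big1 ?subr0 // => l _; rewrite mxE.
  case: eqP => [lj|_]; last by rewrite mulr0.
  case: eqP => [qj|_]; last by rewrite mulr0.
  rewrite (apr_nminus ad hx) ?mul0r // lj inordE ?(ltnW hj) //.
  by move: pq; rewrite qj inordE.
transitivity (\sum_i \sum_k y i * psk k (pi (bracket (e i) x)) *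
    shift_idx (shift_idx (om^~ u) k) i b
  + \sum_k psk k (pi x) *
     shift_idx (fun b => (y k - \sum_i (b i)%:R * gramF ad k i) * om b u) k b).
  rewrite -big_split; apply: eq_bigr => i _ /=.
  rewrite /shift_idx; case: ifP => bi; last first.
    by rewrite !mulr0 addr0 big1 // => k _; rewrite mulr0.
  rewrite (whit_lower iota_span phi_iota _ _ (lowz i)).
  rewrite mulrDr mulr_sumr; congr (_ + _).
    by apply: eq_bigr => k _; rewrite mulrA.
  rewrite (rhoF_diag (diag_bracket_e ad i x)) rhoF_h mulr1 !mulrA; congr (_ * _).
  rewrite mulrBr mulrBr [y i * _]mulrC; congr (_ - _).
  rewrite !mulr_sumr; apply: eq_bigr => k _.
  by rewrite (alk_diag _ (diag_bracket_e ad i x)) /gramF; ring.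
rewrite -[RHS]add0r; congr (_ + _).
(* The two shifts commute, so exchanging i and k changes the sign of the double sum. *)
set S := \sum_i _; have SN : S = - S.
  rewrite {1}/S exchange_big -sumrN; apply: eq_bigr => i _ /=.
  rewrite -sumrN; apply: eq_bigr => k _.
  by rewrite psk_e_antisym shift_idxC mulNr.
have : S *+ 2 = 0 by rewrite mulr2n {1}SN addNr.
by move/eqP; rewrite mulrn_eq0 /= => /eqP.
Qed.

End WhittakerRecurrence.

(** * Evaluating the Chevalley and Harish-Chandra projections *)

Section CartanAlgebra.
Variables (F : numFieldType) (L : lieType F) (T : tridec L) (A : algType F).
Variable iota : {linear L -> A}.
Local Notation h := (cartan T).
Local Notation hdim := (\dim {: subvs_of h}).
Local Notation hbasis i := (tnth (vbasis {: subvs_of h}) i).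

Definition cartan_in (q : Sh T) : A := sym_ext (fun H : subvs_of h => iota (vsval H)) q.

Lemma cartan_in_linear a p q :
  cartan_in (a *: p + q) = a *: cartan_in p + cartan_in q.
Proof.
rewrite /cartan_in /sym_ext mmapD mmapZ.
by rewrite -[in_alg A a * _]/(a *: 1 * _) mulr_algl.
Qed.

Lemma cartan_in0 : cartan_in 0 = 0. Proof. exact: mmap0. Qed.
Lemma cartan_inD p q : cartan_in (p + q) = cartan_in p + cartan_in q.
Proof. by rewrite -{1}[p]scale1r cartan_in_linear scale1r. Qed.
Lemma cartan_inZ a p : cartan_in (a *: p) = a *: cartan_in p.
Proof. by rewrite -{1}[a *: p]addr0 cartan_in_linear cartan_in0 addr0. Qed.
Lemma cartan_in1 : cartan_in 1 = 1.
Proof. by rewrite /cartan_in /sym_ext -mpolyC1 mmapC; exact: scale1r. Qed.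

Lemma cartan_inX m :
  cartan_in 'X_[m] = \prod_(i < hdim) iota (vsval (hbasis i)) ^+ m i.
Proof. by rewrite /cartan_in /sym_ext mmapX. Qed.

(** A functional that turns right multiplication by h into the weight [lam] evaluates a monomial
    factor by factor from the right. *)
Lemma ev_cartan_in (lam : weight h) (chi : A -> F) :
  (forall a u v, chi (a *: u + v) = a * chi u + chi v) -> chi 1 = 1 ->
  (forall (H : subvs_of h) u, chi (u * iota (vsval H)) = (lam H : F) * chi u) ->
  forall q, chi (cartan_in q) = ev lam q.
Proof.
move=> chil chi1 chiM q.
have chi0 : chi 0 = 0.
  by have := chil (-1) 0 0; rewrite scaleN1r oppr0 addr0 mulN1r addNr.
rewrite /ev; elim/mpolyind: q => [|a m q _ _ IH]; first by rewrite cartan_in0 meval0.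
rewrite cartan_in_linear chil IH mevalD mevalZ. congr (_ * _ + _).
rewrite cartan_inX mevalX /=.
have gen (s : seq 'I_hdim) u : chi (u * \prod_(i <- s) iota (vsval (hbasis i)) ^+ m i) =
    chi u * \prod_(i <- s) (lam (hbasis i) : F) ^+ m i.
  elim: s u => [|i s IHs] u; first by rewrite !big_nil !mulr1.
  rewrite !big_cons mulrA IHs mulrA; congr (_ * _).
  elim: (m i) => [|k IHk]; first by rewrite !expr0 !mulr1.
  by rewrite !exprSr !mulrA chiM IHk mulrC.
by rewrite -[\prod_i _]mul1r gen chi1 mul1r.
Qed.

Hypothesis iota_comm : forall H H' : subvs_of h,
  iota (vsval H) * iota (vsval H') = iota (vsval H') * iota (vsval H).

(** The image of a monomial is an ordered product; commutativity of the images of h lets a new last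
    factor move to its place. *)
Lemma cartan_in_mulr q (H : subvs_of h) :
  cartan_in (q * sym_in H) = cartan_in q * iota (vsval H).
Proof.
have mulX i : cartan_in (q * 'X_i) = cartan_in q * iota (vsval (hbasis i)).
  elim/mpolyind: q => [|a m q _ _ IH]; first by rewrite mul0r cartan_in0 mul0r.
  rewrite mulrDl -scalerAl !cartan_in_linear mulrDl IH -scalerAl; congr (_ *: _ + _).
  rewrite -mpolyXD !cartan_inX; set f := fun j => iota (vsval (hbasis j)).
  have fc j k l : GRing.comm (f j) (f k ^+ l) by apply/commrX/iota_comm.
  have gen (s : seq 'I_hdim) : uniq s ->
      \prod_(j <- s) f j ^+ (m + U_(i))%MM j =
      (\prod_(j <- s) f j ^+ m j) * (if i \in s then f i else 1).
    elim: s => [|j s IHs] /=; first by rewrite !big_nil mulr1.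
    case/andP=> js us; rewrite !big_cons IHs // in_cons mnmDE mnm1E.
    case: (eqVneq i j) js => [<-|ij] js /=; last by rewrite addn0 mulrA.
    rewrite (negPf js) mulr1 addn1 exprSr -!mulrA; congr (_ * _).
    elim: s {IHs js us} => [|k s IHs]; first by rewrite big_nil mul1r mulr1.
    by rewrite big_cons mulrA fc -!mulrA IHs.
  by rewrite gen ?index_enum_uniq // mem_index_enum.
rewrite /sym_in mulr_sumr.
have csum (r : seq 'I_hdim) (g : 'I_hdim -> Sh T) :
    cartan_in (\sum_(i <- r) g i) = \sum_(i <- r) cartan_in (g i).
  elim: r => [|i r IHr]; first by rewrite !big_nil cartan_in0.
  by rewrite !big_cons cartan_inD IHr.
rewrite csum [in RHS](coord_vbasis (memvf H)) !raddf_sum mulr_sumr.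
apply: eq_bigr => i _ /=; rewrite -scalerAr cartan_inZ mulX (tnth_nth 0).
by rewrite [X in _ = _ * X]linearZ -[RHS]scalerAr.
Qed.

End CartanAlgebra.

Section HarishChandraExistence.
Variables (F : numFieldType) (L : lieType F) (T : tridec L) (A : algType F).
Variable iota : {linear L -> A}.
Hypothesis iota_span : forall u : A, exists s : seq (F * seq L),
  u = \sum_(t <- s) t.1 *: lie_word iota t.2.
Hypothesis iota_bracket :
  forall x y, iota (bracket x y) = iota x * iota y - iota y * iota x.
Hypothesis nplus_cartan : forall x H, x \in nplus T -> H \in cartan T ->
  bracket x H \in nplus T.

Lemma cartan_abelian H H' : H \in cartan T -> H' \in cartan T -> bracket H H' = 0.
Proof.
move=> hH; rewrite -{1}(cartan_centralizer T) => /rootspaceP/(_ (Subvs hH)) /=.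
by rewrite zero_lfunE scale0r.
Qed.

Lemma ideal_rD N (a b : A) : ideal_r iota N a -> ideal_r iota N b -> ideal_r iota N (a + b).
Proof.
move=> [s [hs ->]] [t [ht ->]]; exists (s ++ t); rewrite all_cat hs ht; split => //.
by rewrite big_cat.
Qed.

Lemma ideal_lD N (a b : A) : ideal_l iota N a -> ideal_l iota N b -> ideal_l iota N (a + b).
Proof.
move=> [s [hs ->]] [t [ht ->]]; exists (s ++ t); rewrite all_cat hs ht; split => //.
by rewrite big_cat.
Qed.

Lemma ideal_r1 (N : {vspace L}) x (a : A) : x \in N -> ideal_r iota N (iota x * a).
Proof. by move=> hx; exists [:: (x, a)]; rewrite /= hx big_seq1. Qed.

Lemma ideal_l1 (N : {vspace L}) x (a : A) : x \in N -> ideal_l iota N (a * iota x).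
Proof. by move=> hx; exists [:: (x, a)]; rewrite /= hx big_seq1. Qed.

Lemma ideal_r0 N : ideal_r iota N (0 : A). Proof. by exists [::]; rewrite big_nil. Qed.
Lemma ideal_l0 N : ideal_l iota N (0 : A). Proof. by exists [::]; rewrite big_nil. Qed.

Lemma ideal_rM N (a u : A) : ideal_r iota N a -> ideal_r iota N (a * u).
Proof.
move=> [s [hs ->]]; exists [seq (t.1, t.2 * u) | t <- s]; rewrite all_map; split => //.
by rewrite big_map mulr_suml; apply: eq_bigr => t _; rewrite mulrA.
Qed.

Lemma ideal_rZ N c (a : A) : ideal_r iota N a -> ideal_r iota N (c *: a).
Proof.
move=> [s [hs ->]]; exists [seq (t.1, c *: t.2) | t <- s]; rewrite all_map; split => //.
by rewrite big_map scaler_sumr; apply: eq_bigr => t _; rewrite scalerAr.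
Qed.

Lemma ideal_lZ N c (a : A) : ideal_l iota N a -> ideal_l iota N (c *: a).
Proof.
move=> [s [hs ->]]; exists [seq (t.1, c *: t.2) | t <- s]; rewrite all_map; split => //.
by rewrite big_map scaler_sumr; apply: eq_bigr => t _; rewrite scalerAl.
Qed.

(** Triangular induction produces the three kinds of terms. Right multiplication by h preserves A
    n_+ because [n_+, h] lies in n_+. *)
Lemma hc_exists u : exists (q : Sh T) a b, [/\ ideal_r iota (nminus T) a,
  ideal_l iota (nplus T) b & u - cartan_in iota q = a + b].
Proof.
have comm (H H' : subvs_of (cartan T)) :
    iota (vsval H) * iota (vsval H') = iota (vsval H') * iota (vsval H).
  apply/eqP; rewrite -subr_eq0 -iota_bracket cartan_abelian ?subvsP //.
  by rewrite raddf0.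
move: u; apply: (lie_tri_ind iota_bracket iota_span (T := T)).
- move=> c u v [q [a [b [ha hb e]]]] [q' [a' [b' [ha' hb' e']]]].
  exists (c *: q + q'), (c *: a + a'), (c *: b + b'); split.
  + by apply: ideal_rD => //; apply: ideal_rZ.
  + by apply: ideal_lD => //; apply: ideal_lZ.
  rewrite cartan_in_linear opprD addrACA -scalerBr e e' scalerDr.
  by rewrite addrACA.
- exists 1, 0, 0; split; [exact: ideal_r0 | exact: ideal_l0 |].
  by rewrite cartan_in1 subrr addr0.
- move=> H u hH [q [a [b [ha hb e]]]].
  exists (q * sym_in (Subvs hH)), (a * iota H), (b * iota H); split.
  + exact: ideal_rM.
  + case: hb => s [hs ->]; rewrite mulr_suml big_seq.
    apply: (big_ind (ideal_l iota (nplus T))); [exact: ideal_l0 | exact: ideal_lD |].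
    move=> t /(allP hs) ht; rewrite -mulrA -[_ * iota H](subrK (iota H * iota t.1)).
    rewrite -iota_bracket mulrDr mulrA; apply: ideal_lD; apply: ideal_l1 => //.
    exact: nplus_cartan.
  by rewrite (cartan_in_mulr comm) /= -mulrBl e mulrDl.
- move=> x u hx; exists 0, 0, (u * iota x); split; [exact: ideal_r0 | exact: ideal_l1 |].
  by rewrite cartan_in0 subr0 add0r.
move=> x u hx _; exists 0, (iota x * u), 0; split; [exact: ideal_r1 | exact: ideal_l0 |].
by rewrite cartan_in0 subr0 addr0.
Qed.

End HarishChandraExistence.

(* [hb] is 0 for the symmetric algebra and 1 for the enveloping algebra. *)
Record whit_model (F : numFieldType) (L : lieType F) (T : tridec L) (n K : nat)
    (c : nat -> 'I_K) (tau : F) (ad : adapted T n c tau) (A : algType F)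
    (iota : L -> A) (act : L -> A -> A) (filt : nat -> A -> Prop)
    (om : 'X_{1..K} -> A -> F) (hb : F) : Prop := WhitModel {
  wm_act_lin : forall x, linear (act x);
  wm_actM : forall x u v, act x (u * v) = act x u * v + u * act x v;
  wm_act_iota : forall x y, act x (iota y) = iota (bracket x y);
  wm_iota_lin : linear iota;
  wm_lin : forall b a u v, om b (a *: u + v) = a * om b u + om b v;
  wm_om1 : om 0%MM 1 = 1;
  wm_act_h : forall H u, H \in cartan T -> om 0%MM (act H u) = 0;
  wm_filt : forall b m u, filt m u -> (m < mdeg b)%N -> om b u = 0;
  wm_kap : forall b u,
    \sum_i apr_len ad i * shift_idx (fun b => om b (act (apr_e ad i) u)) i b =
    kap ad hb b * om b u;
  wm_om_h : forall H u, H \in cartan T ->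
    om 0%MM (iota H * u) = rhoF ad H * om 0%MM u;
  wm_om_m : forall x u, x \in nminus T -> om 0%MM (iota x * u) = 0;
  wm_om_p : forall x u, x \in nplus T ->
    om 0%MM (iota x * u) = hb * om 0%MM (act x u);
  wm_filt_lin : forall m a u v, filt m u -> filt m v -> filt m (a *: u + v);
  wm_filt1 : filt 0%N 1;
  wm_filtS : forall m u, filt m u -> filt m.+1 u;
  wm_filtM : forall m x u, filt m u -> filt m.+1 (iota x * u)
}.

(** * The functionals on the symmetric algebra *)

Section SymmetricModel.
Variables (F : numFieldType) (L : lieType F) (T : tridec L) (n K : nat).
Variables (c : nat -> 'I_K) (tau : F) (ad : adapted T n c tau).
Local Notation pi := (apr ad).
Local Notation y := (apr_len ad).
Local Notation e := (apr_e ad).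
Local Notation dimL := (\dim {: L}).
Local Notation basisL := (tnth (vbasis {: L})).
Local Notation Z := {mpoly F[K]}.

Lemma sym_in_linear : linear (@sym_in F L).
Proof.
move=> a x z; rewrite /sym_in scaler_sumr -big_split; apply: eq_bigr => i _ /=.
by rewrite linearP scalerDl scalerA.
Qed.
HB.instance Definition _ := GRing.isLinear.Build F L (Sym L) _ (@sym_in F L) sym_in_linear.

Lemma sym_in_basis i : sym_in (basisL i) = 'X_i :> Sym L.
Proof.
have fr : free (vbasis {: L}) by apply: basis_free; exact: vbasisP.
rewrite /sym_in (bigD1 i) //= big1 ?addr0 => [|j /negPf ji].
  by rewrite (tnth_nth 0) (coord_free _ _ fr) eqxx scale1r.
by rewrite (tnth_nth 0) (coord_free _ _ fr) eq_sym [_ == _]ji scale0r.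
Qed.

Lemma sym_span (p : Sym L) : exists s : seq (F * seq L),
  p = \sum_(t <- s) t.1 *: lie_word (@sym_in F L) t.2.
Proof.
elim/mpolyind: p => [|a m p _ _ [s ->]]; first by exists [::]; rewrite big_nil.
exists ((a, flatten [seq nseq (m i) (basisL i) | i <- index_enum 'I_dimL]) :: s).
rewrite big_cons /=; congr (_ *: _ + _).
rewrite mpolyXE_id; elim: (index_enum _) => [|i r IH]; first by rewrite /lie_word !big_nil.
rewrite big_cons IH /= /lie_word big_cat; congr (_ * _).
elim: (m i) => [|k IHk]; first by rewrite big_nil expr0.
by rewrite exprS IHk big_cons /= sym_in_basis.
Qed.

Lemma sym_adE x : @sym_ad F L x = vfield (fun i => sym_in (bracket x (basisL i))).
Proof. by []. Qed.

Lemma sym_ad_in x z : sym_ad x (sym_in z) = sym_in (bracket x z) :> Sym L.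
Proof.
pose f (z : L) := bracket x z.
have lf : linear f by exact: linear_bracketr.
pose g : {linear L -> L} := HB.pack f (GRing.isLinear.Build _ _ _ _ _ lf).
have -> : bracket x z = \sum_i coord (vbasis {: L}) i z *: bracket x (basisL i).
  rewrite -[LHS]/(g z) {1}(coord_vbasis (memvf z)) raddf_sum; apply: eq_bigr => i _.
  by rewrite [LHS]linearZ (tnth_nth 0).
rewrite sym_adE {1}/sym_in raddf_sum [RHS]raddf_sum; apply: eq_bigr => i _.
by rewrite [LHS]linearZ [RHS]linearZ; congr (_ *: _); apply: vfieldX.
Qed.

(* The restriction to the point [rho + sum_k z_k e_k] of the dual of L. *)
Definition slice_lin (x : L) : Z := (rhoF ad x)%:MP + \sum_k psk k (pi x) *: 'X_k.

Lemma rhoF_linear a x z : rhoF ad (a *: x + z) = a * rhoF ad x + rhoF ad z.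
Proof.
rewrite /rhoF mulr_sumr -big_split; apply: eq_bigr => k _ /=.
rewrite /trk mulr_sumr -big_split; apply: eq_bigr => p _ /=.
by rewrite linearP !mxE.
Qed.

Lemma slice_lin_linear : linear slice_lin.
Proof.
move=> a x z; rewrite /slice_lin rhoF_linear mpolyCD mpolyCM mul_mpolyC scalerDr addrACA.
congr (_ + _); rewrite scaler_sumr -big_split; apply: eq_bigr => k _ /=.
by rewrite /psk linearP !mxE scalerDl scalerA.
Qed.
HB.instance Definition _ := GRing.isLinear.Build F L Z _ slice_lin slice_lin_linear.

Definition slice (p : Sym L) : Z := p \mPo [tuple slice_lin (basisL i) | i < dimL].

Lemma slice_linear : linear slice. Proof. by move=> a p q; rewrite /slice linearP. Qed.
Lemma sliceM p q : slice (p * q) = slice p * slice q. Proof. exact: rmorphM. Qed.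
Lemma slice1 : slice 1 = 1. Proof. exact: rmorph1. Qed.
HB.instance Definition _ := GRing.isLinear.Build F (Sym L) Z _ slice slice_linear.

Lemma sliceX i : slice 'X_i = slice_lin (basisL i).
Proof. by rewrite /slice comp_mpolyXU -tnth_nth tnth_mktuple. Qed.

Lemma slice_in x : slice (sym_in x) = slice_lin x.
Proof.
rewrite [in RHS](coord_vbasis (memvf x)) raddf_sum /sym_in raddf_sum.
apply: eq_bigr => i _; rewrite [LHS]linearZ [RHS]linearZ; congr (_ *: _).
by rewrite -[LHS]/(slice 'X_i) sliceX (tnth_nth 0).
Qed.

Definition slice_coef b p : F := (slice p)@_b.

Lemma slice_coef_lin b a u v :
  slice_coef b (a *: u + v) = a * slice_coef b u + slice_coef b v.
Proof. by rewrite /slice_coef slice_linear mcoeffD mcoeffZ. Qed.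

Lemma slice_coef0M u v : slice_coef 0%MM (u * v) = slice_coef 0%MM u * slice_coef 0%MM v.
Proof. by rewrite /slice_coef sliceM rmorphM. Qed.

Lemma slice_coef0_in x : slice_coef 0%MM (sym_in x) = rhoF ad x.
Proof.
rewrite /slice_coef slice_in /slice_lin mcoeffD mcoeffC eqxx mulr1 raddf_sum big1 ?addr0 //.
move=> k _ /=; rewrite mcoeffZ mcoeffX.
by rewrite -mdeg_eq0 mdeg1 mulr0.
Qed.

Definition deg_le (k : nat) (p : Z) := forall b : 'X_{1..K}, (k < mdeg b)%N -> p@_b = 0.

Lemma deg_leM k l p q : deg_le k p -> deg_le l q -> deg_le (k + l) (p * q).
Proof.
move=> hp hq b hb; rewrite mcoeffM big1 // => -[b1 b2] /= /eqP hbb.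
have : (k < mdeg b1)%N || (l < mdeg b2)%N.
  have := congr1 (@mdeg K) hbb; rewrite mdegD; move: hb; lia.
by case/orP => [/hp ->|/hq ->]; rewrite ?mul0r ?mulr0.
Qed.

Lemma deg_le1 : deg_le 0 1.
Proof. by move=> b; rewrite mcoeff1 lt0n mdeg_eq0 => /negPf ->. Qed.

Lemma deg_le_slice_lin x : deg_le 1 (slice_lin x).
Proof.
move=> b hb; rewrite mcoeffD mcoeffC; case: eqP => [b0|_].
  by move: hb; rewrite b0 mdeg0.
rewrite mulr0 add0r raddf_sum big1 // => k _ /=; rewrite mcoeffZ mcoeffX.
by case: eqP => [bk|_]; [move: hb; rewrite -bk mdeg1 | rewrite mulr0].
Qed.

Lemma slice_filt m p : @sym_filt F L m p -> deg_le m (slice p).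
Proof.
rewrite /sym_filt /= => hp b hb.
rewrite /slice comp_mpolyE raddf_sum big_seq big1 // => k kp /=; rewrite mcoeffZ.
have hk : (mdeg k <= m)%N by rewrite -ltnS (leq_trans (msize_mdeg_lt kp)).
suff h : deg_le (mdeg k) (\prod_(i < dimL) tnth [tuple slice_lin (basisL i) | i < dimL] i ^+ k i).
  by rewrite h ?mulr0 // (leq_ltn_trans hk).
rewrite mdegE; apply: (big_rec2 deg_le) => [|i l q _ hq]; first exact: deg_le1.
apply: deg_leM => //; rewrite tnth_mktuple; elim: (k i) => [|j IH]; first exact: deg_le1.
by rewrite exprS -add1n; apply: deg_leM => //; apply: deg_le_slice_lin.
Qed.

Lemma mcoeff_shift (p : Z) i b : ('X_i * p)@_b = shift_idx (fun b => p@_b) i b.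
Proof.
rewrite mulrC /shift_idx; case: ltnP => bi.
  have {1}-> : b = (U_(i) + (b - U_(i)))%MM.
    by rewrite addmC submK //; apply/mnm_lepP => k; rewrite mnm1E; case: eqP => // <-.
  exact: mcoeffMX.
rewrite mcoeffM big1 // => -[b1 b2] /= /eqP hb; rewrite mcoeffX.
case: eqP => [h|_]; last by rewrite mulr0.
have := congr1 (fun m : 'X_{1..K} => m i) hb; rewrite /= mnmDE -h mnm1E eqxx.
by move: bi; lia.
Qed.

Lemma mcoeff_euler (p : Z) i b : ('X_i * p^`M(i))@_b = (b i)%:R * p@_b.
Proof.
rewrite mcoeff_shift /shift_idx; case: ltnP => bi; last first.
  by move: bi; rewrite leqn0 => /eqP ->; rewrite mul0r.
rewrite mcoeff_mderiv mnmBE mnm1E eqxx subn1 prednK // submK ?mulr_natl //.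
by apply/mnm_lepP => k; rewrite mnm1E; case: eqP => // <-.
Qed.

(** Both sides are derivations along [slice], so elements x of L suffice. The slice of [e_i, x] has
    constant term psk_i(x) rho(h_i) = psk_i(x), which is the z_i-derivative of the slice of x; its
    linear part gives a quadratic form with antisymmetric coefficients, hence 0. *)
Lemma slice_kap p :
  \sum_i y i *: ('X_i * slice (sym_ad (e i) p)) = \sum_i y i *: ('X_i * (slice p)^`M(i)).
Proof.
move: p; apply: (@derivation_ext _ _ _ slice).
- exact: slice1.
- move=> a p q; rewrite scaler_sumr -big_split; apply: eq_bigr => i _ /=.
  by rewrite sym_adE vfield_linear slice_linear mulrDr scalerDr -!scalerAr !scalerA mulrC.
- move=> a p q; rewrite scaler_sumr -big_split; apply: eq_bigr => i _ /=.
  by rewrite slice_linear linearP /= mulrDr scalerDr -!scalerAr !scalerA mulrC.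
- move=> p q; rewrite mulr_suml mulr_sumr -big_split; apply: eq_bigr => i _ /=.
  rewrite sym_adE vfieldM raddfD /= !sliceM mulrDr scalerDr -!scalerAl -!scalerAr.
  by congr (_ *: _ + _ *: _); ring.
- move=> p q; rewrite mulr_suml mulr_sumr -big_split; apply: eq_bigr => i _ /=.
  rewrite sliceM mderivM mulrDr scalerDr -!scalerAl -!scalerAr.
  by congr (_ *: _ + _ *: _); ring.
move=> j; rewrite -sym_in_basis; set x := basisL j.
have E1 i : slice (sym_ad (e i) (sym_in x)) =
    (psk i (pi x))%:MP + \sum_k psk k (pi (bracket (e i) x)) *: 'X_k.
  by rewrite sym_ad_in slice_in /slice_lin (rhoF_diag (diag_bracket_e ad i x)) rhoF_h mulr1.
have E2 i : (slice (sym_in x))^`M(i) = (psk i (pi x))%:MP.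
  rewrite slice_in linearD /= mderivC add0r raddf_sum (bigD1 i) //= mderivZ mderivX mnm1E eqxx.
  rewrite (_ : (U_(i) - U_(i))%MM = 0%MM) ?mpolyX0; last by apply/mnmP => k; rewrite mnmBE mnm0E subnn.
  rewrite scale1r big1 ?addr0 => [|k /negPf ki]; last first.
    by rewrite mderivZ mderivX mnm1E ki scale0r scaler0.
  by rewrite -mul_mpolyC mulr1.
under eq_bigr => i _ do rewrite E1 mulrDr scalerDr.
under [in RHS]eq_bigr => i _ do rewrite E2.
rewrite big_split /= -[RHS]addr0; congr (_ + _).
pose G i k : Z := (y i * psk k (pi (bracket (e i) x))) *: ('X_i * 'X_k).
have -> : \sum_i y i *: ('X_i * \sum_k psk k (pi (bracket (e i) x)) *: 'X_k) =
    \sum_i \sum_k G i k.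
  apply: eq_bigr => i _; rewrite mulr_sumr scaler_sumr; apply: eq_bigr => k _.
  by rewrite -scalerAr scalerA.
set S := \sum_i _; have SN : S = - S.
  rewrite {1}/S exchange_big -sumrN; apply: eq_bigr => i _ /=.
  rewrite -sumrN; apply: eq_bigr => k _.
  by rewrite /G psk_e_antisym scaleNr ['X_k * _]mulrC.
have : S *+ 2 = 0 by rewrite mulr2n {1}SN addNr.
by move/eqP; rewrite -scaler_nat scaler_eq0 pnatr_eq0 /= => /eqP.
Qed.

(** A derivation along evaluation at rho which vanishes on L, since [H, x] has zero diagonal. *)
Lemma slice_coef0_act x H : H \in cartan T -> slice_coef 0%MM (sym_ad H x) = 0.
Proof.
move=> hH; pose f p := slice_coef 0%MM (sym_ad H p) : F^o.
rewrite -[LHS]/(f x); move: x; apply: (@derivation_ext _ _ _ (slice_coef 0%MM : _ -> F^o)).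
- by rewrite /slice_coef slice1 mcoeff1 eqxx.
- by move=> a p q; rewrite /f sym_adE vfield_linear slice_coef_lin.
- by move=> a p q; rewrite scaler0 addr0.
- by move=> p q; rewrite /f sym_adE vfieldM -[X in X + _]scale1r slice_coef_lin mul1r !slice_coef0M.
- by move=> p q; rewrite mul0r mulr0 addr0.
move=> i; rewrite /f -sym_in_basis sym_ad_in slice_coef0_in.
rewrite (@rhoF_diag _ _ _ _ _ _ _ ad _ 0 0) ?mul0r // => p; rewrite mul0r apr_bracket /commx.
set X := pi (basisL i).
have e1 : (pi H *m X) p p = pi H p p * X p p.
  rewrite mxE (bigD1 p) //= big1 ?addr0 // => q qp.
  by rewrite (apr_cartan ad hH) ?mul0r // eq_sym.
have e2 : (X *m pi H) p p = X p p * pi H p p.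
  rewrite mxE (bigD1 p) //= big1 ?addr0 // => q qp.
  by rewrite (apr_cartan ad hH) ?mulr0.
by rewrite [LHS]mxE [Y in _ + Y]mxE e1 e2 mulrC subrr.
Qed.

Lemma rhoF_nplus x : x \in nplus T -> rhoF ad x = 0.
Proof.
move=> hx; rewrite /rhoF big1 // => k _; rewrite /trk big1 // => p _.
by rewrite (apr_nplus ad hx).
Qed.

Lemma rhoF_nminus x : x \in nminus T -> rhoF ad x = 0.
Proof.
move=> hx; rewrite /rhoF big1 // => k _; rewrite /trk big1 // => p _.
by rewrite (apr_nminus ad hx).
Qed.

Lemma sym_model : whit_model ad (@sym_in F L) (@sym_ad F L) (@sym_filt F L) slice_coef 0.
Proof.
split.
- by move=> x; rewrite sym_adE; apply: vfield_linear.
- by move=> x u v; rewrite sym_adE vfieldM.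
- exact: sym_ad_in.
- exact: sym_in_linear.
- exact: slice_coef_lin.
- by rewrite /slice_coef slice1 mcoeff1 eqxx.
- by move=> H u; apply: slice_coef0_act.
- by move=> b m u hu hb; apply: slice_filt hb.
- move=> b u; have /(congr1 (mcoeff b)) := slice_kap u; rewrite !raddf_sum /= => E.
  transitivity (\sum_i y i * ((b i)%:R * slice_coef b u)).
    transitivity (\sum_i (y i *: ('X_i * slice (sym_ad (e i) u)))@_b).
      by apply: eq_bigr => i _; rewrite mcoeffZ mcoeff_shift.
    by rewrite E; apply: eq_bigr => i _; rewrite mcoeffZ mcoeff_euler.
  rewrite /kap mul0r addr0 mulr_suml; apply: eq_bigr => i _.
  by rewrite mulrA [y i * _]mulrC.
- by move=> H u hH; rewrite slice_coef0M slice_coef0_in.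
- by move=> x u hx; rewrite slice_coef0M slice_coef0_in rhoF_nminus ?mul0r.
- by move=> x u hx; rewrite slice_coef0M slice_coef0_in rhoF_nplus ?mul0r.
- move=> m a u v hu hv; rewrite /sym_filt /=.
  apply: leq_trans (msizeD_le _ _) _; rewrite geq_max.
  by rewrite (leq_trans (msizeZ_le _ _)) //=.
- by rewrite /sym_filt /= msize1.
- by move=> m u; rewrite /sym_filt /= => /leqW.
move=> m x u; rewrite /sym_filt /= => hu.
have hx : (msize (sym_in x : Sym L) <= 2)%N.
  rewrite /sym_in; apply: (big_ind (fun p : Sym L => (msize p <= 2)%N)) => [|p q hp hq|i _].
  - by rewrite msize0.
  - by apply: leq_trans (msizeD_le _ _) _; rewrite geq_max hp hq.
  by apply: leq_trans (msizeZ_le _ _) _; rewrite msizeX mdeg1.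
have [->|x0] := eqVneq (sym_in x : Sym L) 0; first by rewrite mul0r msize0.
have [->|u0] := eqVneq u 0; first by rewrite mulr0 msize0.
rewrite msizeM //; move: hu hx; set s := msize u; set t := msize _; lia.
Qed.

Lemma Ch_exists (p : Sym L) : exists q : Sh T,
  ideal_r (@sym_in F L) (nminus T + nplus T)%VS (p - Sh_to_S q).
Proof.
have comm (H H' : subvs_of (cartan T)) :
    sym_in (vsval H) * sym_in (vsval H') = sym_in (vsval H') * sym_in (vsval H) :> Sym L.
  exact: mulrC.
have SE q : Sh_to_S q = cartan_in (@sym_in F L) q by [].
move: p; apply: (lie_ind sym_span).
- move=> a u v [q hq] [q' hq']; exists (a *: q + q').
  rewrite !SE cartan_in_linear opprD addrACA -scalerBr.
  exact: ideal_rD (ideal_rZ _ hq) hq'.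
- by exists 1; rewrite SE cartan_in1 subrr; apply: ideal_r0.
move=> x u [q hq]; have [a [h [b [ha hh hb ->]]]] := tridec_split T x.
exists (q * sym_in (Subvs hh)).
rewrite SE (cartan_in_mulr comm) /= -SE [a + h]addrC -addrA raddfD /= mulrDl.
have -> : sym_in h * u + sym_in (a + b) * u - Sh_to_S q * sym_in h =
    (u - Sh_to_S q) * sym_in h + sym_in (a + b) * u by ring.
apply: ideal_rD; first exact: ideal_rM.
by apply: ideal_r1; apply: memv_add.
Qed.

(** The constant coefficient kills the ideal generated by n_- and n_+ and is rho on h, so it gives
    the value at rho of whichever component [xget] selects; [Ch_exists] excludes the default 0. *)
Lemma ev_Ch p : ev (rho T) (Ch T p) = slice_coef 0%MM p.
Proof.
have [q hq] := Ch_exists p; rewrite /Ch; case: xgetP => [q' _ hq'|/(_ q)] //.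
have h1 : slice_coef 0%MM (p - Sh_to_S q') = 0.
  have cD u v : slice_coef 0%MM (u + v) = slice_coef 0%MM u + slice_coef 0%MM v.
    by rewrite -{1}[u]scale1r slice_coef_lin mul1r.
  have c0 : slice_coef 0%MM 0 = 0 by rewrite /slice_coef raddf0 mcoeff0.
  case: hq' => s [hs ->]; rewrite (big_morph _ cD c0) big_seq big1 //.
  move=> t /(allP hs) /memv_addP[a ha [b hb e]] /=.
  rewrite -[LHS]/(slice_coef 0%MM (sym_in t.1 * t.2)) slice_coef0M slice_coef0_in e.
  by rewrite -[a]scale1r rhoF_linear rhoF_nminus // rhoF_nplus // mulr0 addr0 mul0r.
have -> : slice_coef 0%MM p = slice_coef 0%MM (Sh_to_S q').
  apply/eqP; rewrite -subr_eq0 -mulN1r addrC -slice_coef_lin scaleN1r addrC.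
  exact/eqP.
rewrite -[Sh_to_S q']/(cartan_in (@sym_in F L) q'); apply/esym/ev_cartan_in.
- exact: slice_coef_lin.
- by rewrite /slice_coef slice1 mcoeff1 eqxx.
by move=> H u; rewrite slice_coef0M slice_coef0_in mulrC (apr_rho ad).
Qed.

End SymmetricModel.

(** * The functionals for a noncommutative image of L *)

Section LieModel.
Variables (F : numFieldType) (L : lieType F) (T : tridec L) (n K : nat).
Variables (c : nat -> 'I_K) (tau : F) (ad : adapted T n c tau).
Local Notation pi := (apr ad).
Local Notation d := #|{: cell_var n K}|.
Local Notation R := {mpoly F[d]}.
Variables (A : algType F) (iota : {linear L -> A}) (phi : {lrmorphism A -> endo R}).
Hypothesis iota_span : forall u : A, exists s : seq (F * seq L),
  u = \sum_(t <- s) t.1 *: lie_word iota t.2.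
Hypothesis iota_bracket :
  forall x y, iota (bracket x y) = iota x * iota y - iota y * iota x.
Hypothesis phi_iota : forall x, phi (iota x) = cell_endo ad x.
Local Notation om := (whit phi).

Definition comm_act (x : L) (u : A) : A := iota x * u - u * iota x.
Definition word_filt (m : nat) (u : A) : Prop := exists s : seq (F * seq L),
  all (fun t => size t.2 <= m)%N s /\ u = \sum_(t <- s) t.1 *: lie_word iota t.2.

Lemma whitZ b a u : om b (a *: u) = a * om b u.
Proof. by have := whit_linear phi b a u 0; rewrite !(whit0, addr0). Qed.

Lemma lie_model : whit_model ad iota comm_act word_filt om 1.
Proof.
split.
- move=> x a u v; rewrite /comm_act mulrDr mulrDl -scalerAr -scalerAl.
  by rewrite opprD addrACA -scalerBr.
- move=> x u v; rewrite /comm_act mulrBl mulrBr !mulrA addrA.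
  by rewrite subrK.
- by move=> x z; rewrite iota_bracket.
- exact: linearP.
- exact: whit_linear.
- by rewrite (whit1 ad) eqxx.
- move=> H u hH; rewrite whitB (whit_upper iota_span phi_iota); last exact: apr_diag'.
  rewrite (whit_lower iota_span phi_iota); last exact: apr_diag.
  rewrite big1 ?add0r => [|k _]; last by rewrite /shift_idx mnm0E mulr0.
  by rewrite big1 ?subr0 ?subrr // => k _; rewrite mnm0E mul0r.
- move=> b m u [s [hs ->]] hb; rewrite whit_sum big_seq big1 // => t /(allP hs) ht.
  by rewrite whitZ (whit_word iota_span iota_bracket phi_iota) ?mulr0 // (leq_ltn_trans ht).
- move=> b u; rewrite -(whit_kap iota_span iota_bracket phi_iota).
  apply: eq_bigr => i _; congr (_ * _); rewrite /shift_idx; case: ifP => // _.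
  by rewrite whitB (whit_nplus iota_span phi_iota) ?subr0 // apr_e_nplus.
- move=> H u hH; rewrite (whit_lower iota_span phi_iota); last exact: apr_diag.
  rewrite big1 ?add0r => [|k _]; last by rewrite /shift_idx mnm0E mulr0.
  by rewrite big1 ?subr0 // => k _; rewrite mnm0E mul0r.
- move=> x u hx; rewrite (whit_lower iota_span phi_iota); last exact: apr_lower.
  rewrite big1 ?add0r => [|k _]; last by rewrite /shift_idx mnm0E mulr0.
  rewrite big1 ?subr0 => [|k _]; last by rewrite mnm0E mul0r.
  by rewrite rhoF_nminus // mul0r.
- by move=> x u hx; rewrite mul1r whitB (whit_nplus iota_span phi_iota) ?subr0.
- move=> m a u v [s [hs ->]] [t [ht ->]].
  exists ([seq (a * w.1, w.2) | w <- s] ++ t); rewrite all_cat ht andbT all_map; split => //.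
  rewrite big_cat big_map scaler_sumr; congr (_ + _).
  by apply: eq_bigr => w _; rewrite scalerA.
- by exists [:: (1, [::])]; rewrite big_seq1 scale1r /lie_word big_nil.
- move=> m u [s [hs ->]]; exists s; split => //.
  by apply: sub_all hs => t /leqW.
move=> m x u [s [hs ->]]; exists [seq (t.1, x :: t.2) | t <- s]; rewrite all_map; split => //.
rewrite big_map mulr_sumr; apply: eq_bigr => t _.
by rewrite lie_word_cons scalerAr.
Qed.

(** om_0 kills n_- A and A n_+ and is rho on h, hence determines the value at rho of any component
    [q]. *)
Lemma ev_hc_gen u (q : Sh T) a b : ideal_r iota (nminus T) a -> ideal_l iota (nplus T) b ->
  u - cartan_in iota q = a + b -> ev (rho T) q = om 0%MM u.
Proof.
move=> [s [hs ea]] [t [ht eb]] e.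
have h0 : om 0%MM (a + b) = 0.
  rewrite whitD ea eb !whit_sum !big_seq !big1 ?addr0 //.
    move=> v /(allP ht) hv; exact: (whit_nplus iota_span phi_iota).
  by move=> v /(allP hs) hv; rewrite (wm_om_m lie_model).
have -> : u = cartan_in iota q + (a + b) by rewrite -e addrC subrK.
rewrite whitD h0 addr0; apply/esym/ev_cartan_in.
- exact: whit_linear.
- by rewrite (whit1 ad) eqxx.
move=> H v; rewrite (whit_upper iota_span phi_iota) ?(apr_rho ad) //.
by apply: apr_diag'; apply: subvsP.
Qed.

End LieModel.

(** * The functionals on the enveloping algebra *)

Section EnvelopingModel.
Variables (F : numFieldType) (L : lieType F) (T : tridec L) (n K : nat).
Variables (c : nat -> 'I_K) (tau : F) (ad : adapted T n c tau).

Lemma nplus_cartan x H : x \in nplus T -> H \in cartan T -> bracket x H \in nplus T.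
Proof.
move=> hx hH; apply: (nplusP (ad := ad)) => p q pq; rewrite apr_bracket /commx !mxE.
rewrite big1 ?add0r => [|l _]; last first.
  case: (leqP l p) => lp; first by rewrite (apr_nplus ad hx) // mul0r.
  by rewrite (apr_cartan ad hH) ?mulr0 // -val_eqE /= gtn_eqF // (leq_ltn_trans pq).
rewrite big1 ?oppr0 // => l _.
case: (leqP q l) => ql; first by rewrite [X in _ * X](apr_nplus ad hx) ?mulr0.
by rewrite (apr_cartan ad hH) ?mul0r // -val_eqE /= gtn_eqF // (leq_trans _ pq).
Qed.

(** The universal property extends right translation on the big cell from L to U(L), and [hc_exists]
    excludes the default of [xget] in [hc]. *)
Lemma env_model : exists om : 'X_{1..K} -> Uenv L -> F,
  whit_model ad (@env_in F L) (@env_ad F L) (@env_filt F L) om 1 /\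
  forall u, ev (rho T) (hc T u) = om 0%MM u.
Proof.
have [phi [phi_iota _]] := env_universal (cell_endo_linear ad) (cell_endo_bracket ad).
have br := @env_in_bracket F L; have sp := @env_span F L.
exists (whit phi); split; first exact: (lie_model sp br phi_iota).
move=> u; rewrite /hc; case: xgetP => [q _ [a [b [ha hb e]]]|/= hq].
  exact: (ev_hc_gen sp br phi_iota ha hb).
have [q [a [b hab]]] := hc_exists sp br nplus_cartan u.
by case: (hq q); exists a, b.
Qed.

End EnvelopingModel.

(** * Equivariant matrices *)

Section EquivariantMatrices.
Variables (F : numFieldType) (L : lieType F) (T : tridec L) (n K : nat).
Variables (c : nat -> 'I_K) (tau : F) (ad : adapted T n c tau).
Local Notation pi := (apr ad).
Local Notation y := (apr_len ad).
Local Notation e := (apr_e ad).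
Local Notation h := (apr_h ad).
Local Notation proj := (apr_proj ad).
Variables (A : algType F) (iota : L -> A) (act : L -> A -> A).
Variables (filt : nat -> A -> Prop) (om : 'X_{1..K} -> A -> F) (hb : F).
Hypothesis wm : whit_model ad iota act filt om hb.
Hypothesis hb_ge0 : 0 <= hb.
Local Notation om0 := (om 0%MM).
Implicit Types (X : 'I_n.+1 -> 'I_n.+1 -> A) (x : L).

Lemma omD b u v : om b (u + v) = om b u + om b v.
Proof. by have := wm_lin wm b 1 u v; rewrite scale1r mul1r. Qed.

Lemma om_0 b : om b 0 = 0.
Proof. by apply: (addrI (om b 0)); rewrite -omD !addr0. Qed.

Lemma omZ b a u : om b (a *: u) = a * om b u.
Proof. by have := wm_lin wm b a u 0; rewrite !(om_0, addr0). Qed.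

Lemma omB b u v : om b (u - v) = om b u - om b v.
Proof. by rewrite -scaleN1r omD omZ mulN1r. Qed.

Lemma om_sum b (I : Type) (r : seq I) (P : pred I) (f : I -> A) :
  om b (\sum_(i <- r | P i) f i) = \sum_(i <- r | P i) om b (f i).
Proof. by apply: (big_morph (om b)); [exact: omD | exact: om_0]. Qed.

Lemma filt0 m : filt m 0.
Proof.
have f1 : filt m 1.
  by elim: m => [|m IH]; [exact: (wm_filt1 wm) | exact: (wm_filtS wm)].
by have := wm_filt_lin wm (-1) f1 f1; rewrite scaleN1r addNr.
Qed.

Lemma filtZ m a u : filt m u -> filt m (a *: u).
Proof. by move=> hu; rewrite -[_ *: _]addr0; apply: (wm_filt_lin wm) => //; apply: filt0. Qed.

Lemma filtD m u v : filt m u -> filt m v -> filt m (u + v).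
Proof. by move=> hu hv; rewrite -[u]scale1r; apply: (wm_filt_lin wm). Qed.

Lemma filt_sum m (I : Type) (r : seq I) (P : pred I) (f : I -> A) :
  (forall i, filt m (f i)) -> filt m (\sum_(i <- r | P i) f i).
Proof. by move=> hf; apply: big_ind => //; [exact: filt0 | exact: filtD]. Qed.

Lemma filt_le m m' u : (m <= m')%N -> filt m u -> filt m' u.
Proof. by move/subnKC <-; elim: (m' - m)%N => [|k IH] hu; rewrite ?addn0 // addnS; apply/(wm_filtS wm)/IH. Qed.

(** In matrix notation, act x X = X pi(x) - pi(x) X. *)
Definition equivariant X := forall x p q, act x (X p q) =
  \sum_s pi x s q *: X p s - \sum_s pi x p s *: X s q.

Lemma actM x u v : act x (u * v) = act x u * v + u * act x v.
Proof. exact: (wm_actM wm). Qed.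
Lemma act_lin x a u v : act x (a *: u + v) = a *: act x u + act x v.
Proof. exact: (wm_act_lin wm). Qed.
Lemma act1 x : act x 1 = 0.
Proof. by apply: (addrI (act x 1)); rewrite addr0 -{3}[1]mulr1 actM mulr1 mul1r. Qed.
Lemma act0 x : act x 0 = 0.
Proof. by have := act_lin x (-1) 0 0; rewrite !scaleN1r oppr0 addr0 addNr. Qed.
Lemma actD x u v : act x (u + v) = act x u + act x v.
Proof. by have := act_lin x 1 u v; rewrite !scale1r. Qed.
Lemma actZ x a u : act x (a *: u) = a *: act x u.
Proof. by have := act_lin x a u 0; rewrite act0 !addr0. Qed.
Lemma act_sum x (I : Type) (r : seq I) (P : pred I) (f : I -> A) :
  act x (\sum_(i <- r | P i) f i) = \sum_(i <- r | P i) act x (f i).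
Proof. by apply: (big_morph (act x)); [exact: actD | exact: act0]. Qed.

Lemma equivariant_lin a X X' : equivariant X -> equivariant X' ->
  equivariant (fun p q => a *: X p q + X' p q).
Proof.
move=> hX hX' x p q; rewrite act_lin hX hX' scalerBr addrACA -opprD !scaler_sumr -!big_split.
by congr (_ - _); apply: eq_bigr => s _ /=; rewrite scalerDr !scalerA mulrC.
Qed.

(** The entry (p, q) has weight mu_q - mu_p under h, nonzero by [apr_regular], while om_0 kills the
    action of h. *)
Lemma om0_offdiag X p q : equivariant X -> p != q -> om0 (X p q) = 0.
Proof.
move=> hX pq; have [H hH hpq] := apr_regular ad pq.
have := wm_act_h wm (X p q) hH; rewrite hX omB !om_sum.
have -> : \sum_s om0 (pi H s q *: X p s) = pi H q q * om0 (X p q).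
  rewrite (bigD1 q) //= big1 ?addr0 ?omZ // => s sq.
  by rewrite (apr_cartan ad hH) // scale0r om_0.
have -> : \sum_s om0 (pi H p s *: X s q) = pi H p p * om0 (X p q).
  rewrite (bigD1 p) //= big1 ?addr0 ?omZ // => s sp.
  by rewrite (apr_cartan ad hH) ?scale0r ?om_0 // eq_sym.
rewrite -mulrBl => /eqP; rewrite mulf_eq0 subr_eq0 eq_sym (negPf hpq) /=.
by move/eqP.
Qed.

(** The root mu_p - mu_q written in simple roots: one for each step from p to q, folded by [c]. *)
Definition path_idx p q : 'X_{1..K} := (\sum_(p <= j < q) U_(c j))%MM.

Lemma path_idx_recr p q : (p <= q)%N -> path_idx p q.+1 = (path_idx p q + U_(c q))%MM.
Proof. by move=> pq; rewrite /path_idx big_nat_recr. Qed.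

Lemma path_idx_recl p q : (p < q)%N -> path_idx p q = (U_(c p) + path_idx p.+1 q)%MM.
Proof. by move=> pq; rewrite /path_idx big_ltn. Qed.

Lemma path_idx_nil p : path_idx p p = 0%MM.
Proof. by rewrite /path_idx big_geq. Qed.

Lemma mdeg_path p q : mdeg (path_idx p q) = (q - p)%N.
Proof.
rewrite /path_idx mdeg_sum (eq_bigr (fun=> 1%N)) => [|i _]; last by rewrite mdeg1.
by rewrite sum_nat_const_nat muln1.
Qed.

Lemma path_alk p q x : x \in cartan T -> (p <= q)%N -> (q <= n)%N ->
  \sum_i (path_idx p q i)%:R * alk i (pi x) =
  pi x (inord p) (inord p) - pi x (inord q) (inord q).
Proof.
move=> hx; elim: q => [|q IH].
  rewrite leqn0 => /eqP -> _; rewrite path_idx_nil subrr big1 // => i _.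
  by rewrite mnm0E mul0r.
rewrite leq_eqVlt => /predU1P[->|pq] qn.
  by rewrite path_idx_nil subrr big1 // => i _; rewrite mnm0E mul0r.
rewrite path_idx_recr //.
under eq_bigr do rewrite mnmDE natrD mulrDl.
rewrite big_split /= IH ?(ltnW qn) // (bigD1 (c q)) //= mnm1E eqxx mul1r big1 ?addr0 => [|i ic].
  by rewrite -(apr_foldh ad) // addrA subrK.
by rewrite mnm1E eq_sym (negPf ic) mul0r.
Qed.

(** Appending the step from q adds y (1 - hb (h_pp - h_qq)), where h is the coroot of that step. By
    [apr_h_max] and hb >= 0 this is at least y > 0. *)
Lemma kap_path_gt0 p q : (p < q)%N -> (q <= n)%N -> 0 < kap ad hb (path_idx p q).
Proof.
have step q' : (p <= q')%N -> (q' < n)%N ->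
    kap ad hb (path_idx p q') < kap ad hb (path_idx p q'.+1).
  move=> pq qn; rewrite path_idx_recr // kapD -addrA ltrDl.
  have -> : \sum_i (path_idx p q' i)%:R * gramF ad (c q') i =
     y (c q') * \sum_i (path_idx p q' i)%:R * alk i (pi (h (c q'))).
    by rewrite mulr_sumr; apply: eq_bigr => i _; rewrite /gramF mulrCA.
  rewrite path_alk ?apr_h_cartan // ?(ltnW qn) //.
  have := apr_h_max ad pq qn; rewrite -subr_le0 => hle.
  apply: (lt_le_trans (len_gt0 ad (c q'))); rewrite lerDl oppr_ge0.
  apply: mulr_ge0_le0 => //; apply: mulr_ge0_le0 => //.
  exact: ltW (len_gt0 ad _).
elim: q => // q IH; rewrite ltnS leq_eqVlt => /predU1P[epq|pq] qn.
  by subst q; have := step p (leqnn p) qn; rewrite path_idx_nil kap0.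
by apply: lt_trans (step q (ltnW pq) qn); apply: IH => //; apply: ltnW.
Qed.

Section Window.
Variables (X : 'I_n.+1 -> 'I_n.+1 -> A) (m : nat).
Hypothesis eqX : equivariant X.
Hypothesis filtX : forall p q, filt m (X p q).

Definition path_coef p q : F := om (path_idx p q) (X (inord p) (inord q)).

Lemma act_e i (p q : nat) : (p < q)%N -> (q <= n)%N ->
  act (e i) (X (inord p) (inord q)) =
  (c q.-1 == i)%:R *: X (inord p) (inord q.-1) - (c p == i)%:R *: X (inord p.+1) (inord q).
Proof.
case: q => // q; rewrite ltnS /= => pq qn; rewrite eqX; congr (_ - _).
  rewrite (bigD1 (inord q)) //= big1 ?addr0 => [|s sq].
    congr (_ *: _); rewrite apr_eE summxE big_mkcond (bigD1 (Ordinal qn)) //= big1 ?addr0.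
      by case: ifP => cq; rewrite ?cq // mxE !eqxx.
    move=> j jq; case: ifP => // _; rewrite mxE [inord q == _](_ : _ = false) //.
    apply: contra_neqF jq => /eqP /(congr1 val) /=; rewrite !inordE ?(ltnW (ltn_ord _)) ?(ltnW qn) //.
    by move=> jq; apply: val_inj.
  rewrite apr_eE summxE big1 ?scale0r // => j _; rewrite mxE.
  case: eqP => // sj; case: eqP => // /(congr1 val) /=; rewrite !inordE // => -[jq].
  by case/eqP: sq; rewrite sj jq.
have pn : (p < n)%N by apply: leq_ltn_trans qn.
rewrite (bigD1 (inord p.+1)) //= big1 ?addr0 => [|s sq].
  congr (_ *: _); rewrite apr_eE summxE big_mkcond (bigD1 (Ordinal pn)) //= big1 ?addr0.
    by case: ifP => cq; rewrite ?cq // mxE !eqxx.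
  move=> j jq; case: ifP => // _; rewrite mxE [inord p == _](_ : _ = false) //.
  apply: contra_neqF jq => /eqP /(congr1 val) /=; rewrite !inordE ?(ltnW (ltn_ord _)) ?(ltnW pn) //.
  by move=> jq; apply: val_inj.
rewrite apr_eE summxE big1 ?scale0r // => j _; rewrite mxE.
case: eqP => // /(congr1 val) /=; rewrite !inordE ?(ltnW (ltn_ord _)) ?(ltnW pn) // => pj.
by case: eqP => // sj; case/eqP: sq; rewrite sj pj.
Qed.

(** The e_i send the entry (p, q) to (p, q-1) and (p+1, q), whose paths lack the last and the first
    step; [wm_kap] combines the two. *)
Lemma path_coef_rec p q : (p < q)%N -> (q <= n)%N ->
  kap ad hb (path_idx p q) * path_coef p q =
  y (c q.-1) * path_coef p q.-1 - y (c p) * path_coef p.+1 q.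
Proof.
move=> pq qn; rewrite /path_coef -(wm_kap wm).
transitivity (\sum_i (y i * ((c q.-1 == i)%:R *
    shift_idx (fun b => om b (X (inord p) (inord q.-1))) i (path_idx p q))
  - y i * ((c p == i)%:R * shift_idx (fun b => om b (X (inord p.+1) (inord q))) i (path_idx p q)))).
  apply: eq_bigr => i _; rewrite -mulrBr; congr (_ * _).
  rewrite /shift_idx; case: ifP => _; last by rewrite !mulr0 subrr.
  by rewrite act_e // omB !omZ.
rewrite sumrB; congr (_ - _).
  rewrite (bigD1 (c q.-1)) //= eqxx mul1r big1 ?addr0 => [|i /negPf ic]; last first.
    by rewrite eq_sym ic mul0r mulr0.
  congr (_ * _); case: q pq {qn} => // q; rewrite ltnS /= => pq.
  rewrite /shift_idx path_idx_recr // mnmDE mnm1E eqxx addn1 /=; congr (om _ _).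
  by rewrite addmK.
rewrite (bigD1 (c p)) //= eqxx mul1r big1 ?addr0 => [|i /negPf ic]; last first.
  by rewrite eq_sym ic mul0r mulr0.
congr (_ * _); rewrite /shift_idx path_idx_recl // mnmDE mnm1E eqxx /=; congr (om _ _).
by rewrite addmC addmK.
Qed.

Lemma path_coef_deg p q : (m < q - p)%N -> path_coef p q = 0.
Proof. by move=> hm; apply: (wm_filt wm) (filtX _ _) _; rewrite mdeg_path. Qed.

Lemma path_coef_diag p : path_coef p p = om0 (X (inord p) (inord p)).
Proof. by rewrite /path_coef path_idx_nil. Qed.

(** By induction on q - p: since [kap] is nonzero, an entry is determined by its two neighbours
    nearer to the diagonal. *)
Lemma window_zero lo hi : (hi <= n)%N ->
  (forall j, (lo <= j <= hi)%N -> path_coef j j = 0) ->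
  forall p q, (lo <= p)%N -> (p <= q)%N -> (q <= hi)%N -> path_coef p q = 0.
Proof.
move=> hin h0 p q lop pq qhi; elim: {q}(q - p)%N {-2}q {-2}p (erefl (q - p)%N) pq lop qhi => [|l IH] q p' e pq lop qhi.
  have -> : q = p' by lia.
  by apply: h0; lia.
have pq' : (p' < q)%N by lia.
have k0 := gt_eqF (kap_path_gt0 pq' (leq_trans qhi hin)).
apply/eqP; rewrite -(mulrI_eq0 _ (mulfI (negbT k0))) path_coef_rec ?(leq_trans qhi hin) //.
rewrite (IH q.-1 p') ?(IH q p'.+1); try lia.
by rewrite !mulr0 subrr.
Qed.

(** The entry (lo, lo+m+1) vanishes by degree. The recurrence, solved for (p, q-1), then moves along
    row lo to the diagonal, since the entries of row lo+1 that it meets lie in the window. *)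
Lemma window_left lo hi : (hi <= n)%N -> (lo.+1 + m <= hi)%N ->
  (forall j, (lo < j <= hi)%N -> path_coef j j = 0) -> path_coef lo lo = 0.
Proof.
move=> hin hm h0; have W := window_zero hin h0.
have gen k : (k <= m.+1)%N -> path_coef lo (lo + m.+1 - k) = 0.
  elim: k => [|k IH] hk; first by rewrite path_coef_deg //; lia.
  have lt : (lo < lo + m.+1 - k)%N by lia.
  have := path_coef_rec lt; rewrite IH ?(ltnW hk) // mulr0 (W lo.+1) //; try lia.
  rewrite mulr0 subr0 => /(_ _)/esym/eqP; rewrite mulf_eq0 gt_eqF ?len_gt0 //=.
  rewrite (_ : (lo + m.+1 - k).-1 = lo + m.+1 - k.+1)%N; last by lia.
  by move=> hh; apply/eqP/hh; lia.
by have := gen m.+1 (leqnn _); rewrite addnK.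
Qed.

(** The mirror argument down column hi+1, starting m+1 places above the diagonal. *)
Lemma window_right lo hi : (hi < n)%N -> (lo + m <= hi)%N ->
  (forall j, (lo <= j <= hi)%N -> path_coef j j = 0) -> path_coef hi.+1 hi.+1 = 0.
Proof.
move=> hin hm h0; have W := window_zero (ltnW hin) h0.
have gen k : (k <= m.+1)%N -> path_coef (hi.+1 - m.+1 + k) hi.+1 = 0.
  elim: k => [|k IH] hk; first by rewrite path_coef_deg //; lia.
  have lt : (hi.+1 - m.+1 + k < hi.+1)%N by lia.
  have := path_coef_rec lt hin; rewrite IH ?(ltnW hk) // mulr0 (W _ hi) //; try lia.
  rewrite mulr0 sub0r => /esym/eqP; rewrite oppr_eq0 mulf_eq0 gt_eqF ?len_gt0 //=.
  by rewrite addnS => /eqP.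
by have := gen m.+1 (leqnn _); rewrite subnK // ; lia.
Qed.

(** A block of m+1 zeros on the diagonal grows by one place at a time, to the left and then to the
    right. *)
Lemma window_all lo hi : (hi <= n)%N -> (lo + m <= hi)%N ->
  (forall j, (lo <= j <= hi)%N -> path_coef j j = 0) ->
  forall j, (j <= n)%N -> path_coef j j = 0.
Proof.
move=> hin hm h0.
have L' k : (k <= lo)%N -> forall j, (lo - k <= j <= hi)%N -> path_coef j j = 0.
  elim: k => [|k IH] hk j hj; first by apply: h0; lia.
  have [->|ne] := eqVneq j (lo - k.+1)%N; last by apply: IH; lia.
  by apply: (window_left hin) => [|i hi']; [lia | apply: IH; lia].
have R' k : (hi + k <= n)%N -> forall j, (j <= hi + k)%N -> path_coef j j = 0.
  elim: k => [|k IH] hk j hj; first by apply: (L' lo); lia.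
  have [->|ne] := eqVneq j (hi + k).+1; last by apply: IH; lia.
  by apply: (@window_right lo) => [||i hi']; [lia | lia | apply: IH; lia].
by move=> j jn; apply: (R' (n - hi)%N); lia.
Qed.

End Window.

Definition realized m (v : 'I_n.+1 -> F) := exists X, [/\ equivariant X,
  forall p q, filt m (X p q) & forall p, om0 (X p p) = v p].

Lemma realized_ext m v w : v =1 w -> realized m v -> realized m w.
Proof. by move=> vw [X [h1 h2 h3]]; exists X; split => // p; rewrite h3. Qed.

Lemma realized_lin m a v w : realized m v -> realized m w ->
  realized m (fun p => a * v p + w p).
Proof.
move=> [X [h1 h2 h3]] [X' [h1' h2' h3']]; exists (fun p q => a *: X p q + X' p q).
split=> [|p q|p]; [exact: equivariant_lin | exact: (wm_filt_lin wm) |].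
by rewrite (wm_lin wm) h3 h3'.
Qed.

Lemma realized_le m m' v : (m <= m')%N -> realized m v -> realized m' v.
Proof. by move=> hm [X [h1 h2 h3]]; exists X; split => // p q; apply: filt_le (h2 p q). Qed.

Lemma realized_const m a : realized m (fun=> a).
Proof.
have eq1 : equivariant (fun p q => (a * (p == q)%:R) *: 1).
  move=> x p q; rewrite actZ act1 scaler0.
  rewrite (bigD1 p) //= big1 ?addr0 => [|s /negPf sp]; last first.
    by rewrite eq_sym sp mulr0 scale0r scaler0.
  rewrite (bigD1 q) //= big1 ?addr0 => [|s /negPf sp]; last first.
    by rewrite sp mulr0 scale0r scaler0.
  by rewrite !eqxx subrr.
exists (fun p q => (a * (p == q)%:R) *: 1); split => // [p q|p].
  by apply/filtZ/(filt_le (leq0n m))/(wm_filt1 wm).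
by rewrite omZ eqxx (wm_om1 wm) !mulr1.
Qed.

(** Effect on om_0 of the diagonal when the matrix of generators is multiplied on the left: its
    diagonal entries give rho, those in n_- die, and those in n_+ give hb times their action, hence
    the differences [v q - v p]. *)
Definition step_op (v : 'I_n.+1 -> F) (p : 'I_n.+1) : F :=
  rhoF ad (proj (delta_mx p p)) * v p +
  hb * \sum_(q < n.+1 | (q < p)%N) pi (proj (delta_mx q p)) q p * (v q - v p).

Lemma proj_bracket_delta x p q : bracket x (proj (delta_mx p q)) =
  \sum_s pi x s p *: proj (delta_mx s q) - \sum_s pi x q s *: proj (delta_mx p s).
Proof.
rewrite -(apr_projE ad) /commx linearB /=; congr (_ - _).
  transitivity (proj (\sum_s pi x s p *: delta_mx s q)); last first.
    by rewrite linear_sum; apply: eq_bigr => s _ /=; rewrite linearZ.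
  congr (proj _); apply/matrixP => i j; rewrite !mxE summxE.
  rewrite (bigD1 p) //= big1 ?addr0 => [|s /negPf sp]; last by rewrite mxE sp mulr0.
  rewrite (bigD1 i) //= big1 ?addr0 => [|s /negPf sp]; last first.
    by rewrite !mxE eq_sym sp mulr0.
  by rewrite !mxE !eqxx.
transitivity (proj (\sum_s pi x q s *: delta_mx p s)); last first.
  by rewrite linear_sum; apply: eq_bigr => s _ /=; rewrite linearZ.
congr (proj _); apply/matrixP => i j; rewrite !mxE summxE.
rewrite (bigD1 q) //= big1 ?addr0 => [|s /negPf sp]; last by rewrite mxE sp andbF mul0r.
rewrite (bigD1 j) //= big1 ?addr0 => [|s /negPf sp]; last first.
  by rewrite !mxE [j == s]eq_sym sp andbF mulr0.
by rewrite !mxE !eqxx andbT mulrC.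
Qed.

Lemma iota_sum (I : Type) (r : seq I) (f : I -> F) (z : I -> L) :
  iota (\sum_(i <- r) f i *: z i) = \sum_(i <- r) f i *: iota (z i).
Proof.
have i0 : iota 0 = 0.
  by have := wm_iota_lin wm (-1) 0 0; rewrite !scaleN1r oppr0 addr0 addNr.
elim: r => [|i r IH]; first by rewrite !big_nil.
by rewrite !big_cons (wm_iota_lin wm) IH.
Qed.

Lemma iotaB x z : iota (x - z) = iota x - iota z.
Proof. by have := wm_iota_lin wm (-1) z x; rewrite !scaleN1r ![- _ + _]addrC => ->. Qed.

(* The matrix with entries iota (proj (E_qp)) is the generic element of the Lie
   algebra; multiplying by it on the left preserves equivariance. *)
Lemma realized_step m v : realized m v -> realized m.+1 (step_op v).
Proof.
move=> [X [h1 h2 h3]].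
pose E p q := iota (proj (delta_mx q p)).
have eqE : equivariant E.
  move=> x p q; rewrite (wm_act_iota wm) proj_bracket_delta iotaB !iota_sum.
  by [].
exists (fun p q => \sum_s E p s * X s q); split=> [x p q|p q|p].
- rewrite act_sum.
  transitivity ((\sum_s \sum_t pi x t s *: (E p t * X s q)
      - \sum_s \sum_t pi x p t *: (E t s * X s q))
    + (\sum_s \sum_t pi x t q *: (E p s * X s t)
      - \sum_s \sum_t pi x s t *: (E p s * X t q))).
    rewrite -!sumrB -big_split; apply: eq_bigr => s _ /=.
    rewrite actM eqE h1 mulrBl mulrBr !mulr_suml !mulr_sumr; congr (_ - _ + (_ - _));
      by apply: eq_bigr => t _; rewrite -?scalerAl -?scalerAr.
  rewrite [X in X - _ + _]exchange_big /= addrC addrA subrK.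
  congr (_ - _); rewrite exchange_big; apply: eq_bigr => s _ /=.
    by rewrite scaler_sumr.
  by rewrite scaler_sumr.
- by apply: filt_sum => s; apply: (wm_filtM wm).
rewrite om_sum (bigD1 p) //= (wm_om_h wm) ?apr_proj_cartan // h3; congr (_ + _).
rewrite mulr_sumr big_mkcond [RHS]big_mkcond; apply: eq_bigr => q _ /=.
case: (ltngtP q p) => qp /=.
- rewrite -val_eqE /= ltn_eqF //= (wm_om_p wm) ?apr_proj_nplus //; congr (_ * _).
  rewrite h1 omB !om_sum mulrBr; congr (_ - _).
    rewrite (bigD1 q) //= big1 ?addr0 ?omZ ?h3 // => s sq.
    by rewrite omZ om0_offdiag ?mulr0 // eq_sym.
  rewrite (bigD1 p) //= big1 ?addr0 ?omZ ?h3 // => s sq.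
  by rewrite omZ om0_offdiag ?mulr0.
- by rewrite -val_eqE /= gtn_eqF //= (wm_om_m wm) ?apr_proj_nminus.
by rewrite (val_inj qp) eqxx.
Qed.

(** The common shape of [filtS] and [filtU], once om_0 is known to be the projection followed by
    evaluation at rho. *)
Definition whit_image m : set L :=
  (fun t => tens_val (tens_map om0 t)) @` (tens_inv act `&` tens_filt (filt m)).

Local Notation basisL := (tnth (vbasis {: L})).
Local Notation coordL := (coord (vbasis {: L})).

Lemma coord_basisL (x : L) : x = \sum_j coordL j x *: basisL j.
Proof.
rewrite {1}(coord_vbasis (memvf x)); apply: eq_bigr => j _.
by rewrite (tnth_nth 0).
Qed.

(** The representation applied to the second tensor factor; it turns invariants into equivariant
    matrices. *)
Definition tens_mx (t : tens L A) p q : A := \sum_j pi (basisL j) p q *: t j.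

Lemma apr_scaleE a z p q : pi (a *: z) p q = a * pi z p q.
Proof. by rewrite linearZ mxE. Qed.

Lemma tens_mx_equivariant t : tens_inv act t -> equivariant (tens_mx t).
Proof.
move=> ht x p q; rewrite act_sum.
have hx j : act x (t j) = - \sum_i coordL j (bracket x (basisL i)) *: t i.
  by apply/eqP; rewrite -addr_eq0; apply/eqP; apply: ht.
transitivity (- \sum_i pi (bracket x (basisL i)) p q *: t i).
  under eq_bigr do rewrite actZ hx scalerN.
  rewrite sumrN; congr (- _).
  under eq_bigr do rewrite scaler_sumr.
  rewrite exchange_big; apply: eq_bigr => i _ /=.
  rewrite [in RHS](coord_basisL (bracket x (basisL i))) raddf_sum summxE scaler_suml.
  by apply: eq_bigr => j _; rewrite -[pi (_ *: _) p q]/(pi _ p q) apr_scaleE scalerA mulrC.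
rewrite -sumrN -sumrB.
transitivity (\sum_s \sum_j ((pi x s q * pi (basisL j) p s) *: t j
     - (pi x p s * pi (basisL j) s q) *: t j)); last first.
  apply: eq_bigr => s _; rewrite sumrB !scaler_sumr; congr (_ - _);
    by apply: eq_bigr => j _; rewrite scalerA.
rewrite exchange_big; apply: eq_bigr => j _ /=.
rewrite -scaleNr apr_bracket /commx.
under eq_bigr do rewrite -scalerBl.
rewrite -scaler_suml; congr (_ *: _); rewrite sumrB !mxE opprB; congr (_ - _).
by apply: eq_bigr => s _; rewrite mulrC.
Qed.

Lemma whit_image_mx m f : whit_image m f -> exists t : tens L A,
  [/\ equivariant (tens_mx t), forall p q, filt m (tens_mx t p q) &
      forall p q, pi f p q = om0 (tens_mx t p q)].
Proof.
move=> [t [ht hf] <-]; exists t; split; first exact: tens_mx_equivariant.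
  by move=> p q; apply: filt_sum => j; apply: filtZ; apply: hf.
move=> p q; rewrite /tens_val raddf_sum summxE om_sum; apply: eq_bigr => j _.
by rewrite apr_scaleE omZ mulrC.
Qed.

Lemma coord_sum j (I : Type) (r : seq I) (g : I -> F) (z : I -> L) :
  coordL j (\sum_(i <- r) g i *: z i) = \sum_(i <- r) g i * coordL j (z i).
Proof. by rewrite linear_sum; apply: eq_bigr => i _; rewrite linearZ. Qed.

Lemma bracket0r x : bracket x 0 = 0.
Proof. by have := linear_bracketr x (-1) 0 0; rewrite !scaleN1r oppr0 addr0 addNr. Qed.

Lemma bracketZr x a z : bracket x (a *: z) = a *: bracket x z.
Proof. by have := linear_bracketr x a z 0; rewrite bracket0r !addr0. Qed.

Lemma bracket_sumr x (I : Type) (r : seq I) (g : I -> F) (z : I -> L) :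
  bracket x (\sum_(i <- r) g i *: z i) = \sum_(i <- r) g i *: bracket x (z i).
Proof.
elim: r => [|i r IH]; first by rewrite !big_nil bracket0r.
by rewrite !big_cons linear_bracketr IH.
Qed.

(** [proj] divided by its scale is an equivariant retraction of the representation, so it turns an
    equivariant matrix back into an invariant. Under om_0 only the diagonal survives. *)
Lemma whit_image_realized m f (v : 'I_n.+1 -> F) :
  realized m v -> (forall p q, pi f p q = (p == q)%:R * v p) -> whit_image m f.
Proof.
move=> [X [h1 h2 h3]] hf.
pose P p q := (apr_proj_scale ad)^-1 *: proj (delta_mx p q).
pose t : tens L A := fun j => \sum_p \sum_q coordL j (P p q) *: X p q.
have PE x p q : bracket x (P p q) =
    \sum_s pi x s p *: P s q - \sum_s pi x q s *: P p s.
  rewrite /P bracketZr proj_bracket_delta scalerBr !scaler_sumr.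
  by congr (_ - _); apply: eq_bigr => s _; rewrite !scalerA mulrC.
exists t.
  split; last by move=> j; do 2![apply: filt_sum => ?]; apply: filtZ.
  move=> x j; rewrite /tens_act.
  pose a p q := coordL j (P p q).
  have -> : act x (t j) = \sum_p \sum_q \sum_s (a p q * pi x s q) *: X p s
      - \sum_p \sum_q \sum_s (a p q * pi x p s) *: X s q.
    rewrite act_sum -sumrB; apply: eq_bigr => p _.
    rewrite act_sum -sumrB; apply: eq_bigr => q _.
    rewrite actZ h1 scalerBr !scaler_sumr; congr (_ - _);
      by apply: eq_bigr => s _; rewrite scalerA.
  have -> : \sum_i coordL j (bracket x (basisL i)) *: t i =
      \sum_p \sum_q \sum_s (a s q * pi x s p) *: X p q
      - \sum_p \sum_q \sum_s (a p s * pi x q s) *: X p q.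
    transitivity (\sum_p \sum_q coordL j (bracket x (P p q)) *: X p q).
      under eq_bigr do rewrite scaler_sumr.
      rewrite exchange_big; apply: eq_bigr => p _ /=.
      under eq_bigr do rewrite scaler_sumr.
      rewrite exchange_big; apply: eq_bigr => q _ /=.
      rewrite [in RHS](coord_basisL (P p q)) bracket_sumr coord_sum scaler_suml.
      by apply: eq_bigr => i _; rewrite scalerA mulrC.
    rewrite -sumrB; apply: eq_bigr => p _; rewrite -sumrB; apply: eq_bigr => q _.
    rewrite PE linearB /= !coord_sum scalerBl !scaler_suml; congr (_ - _);
      by apply: eq_bigr => s _; rewrite mulrC.
  have -> : \sum_p \sum_q \sum_s (a p q * pi x s q) *: X p s =
      \sum_p \sum_q \sum_s (a p s * pi x q s) *: X p q.
    by apply: eq_bigr => p _; rewrite exchange_big.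
  have -> : \sum_p \sum_q \sum_s (a p q * pi x p s) *: X s q =
      \sum_p \sum_q \sum_s (a s q * pi x s p) *: X p q.
    under eq_bigr do rewrite exchange_big.
    by rewrite exchange_big; apply: eq_bigr => p _; rewrite exchange_big.
  by rewrite addrC addrA subrK subrr.
have om_t j : om0 (t j) = \sum_p v p * coordL j (P p p).
  rewrite om_sum; apply: eq_bigr => p _; rewrite om_sum (bigD1 p) //= omZ h3 mulrC.
  rewrite big1 ?addr0 // => q qp; rewrite omZ om0_offdiag ?mulr0 // eq_sym.
  by [].
rewrite /tens_val /tens_map.
under eq_bigr do rewrite om_t scaler_suml.
rewrite exchange_big /=.
transitivity (\sum_p v p *: P p p).
  apply: eq_bigr => p _; rewrite [in RHS](coord_basisL (P p p)) scaler_sumr.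
  by apply: eq_bigr => j _; rewrite scalerA.
transitivity ((apr_proj_scale ad)^-1 *: proj (pi f)); last first.
  by rewrite apr_projK scalerA mulVf ?apr_proj_scale0 ?scale1r.
have -> : pi f = \sum_p v p *: delta_mx p p.
  apply/matrixP => p q; rewrite hf summxE (bigD1 p) //= big1 ?addr0 => [|s /negPf sp].
    by rewrite !mxE eqxx /= eq_sym mulrC.
  by rewrite !mxE eq_sym sp mulr0.
rewrite linear_sum scaler_sumr; apply: eq_bigr => p _ /=.
have -> : proj (v p *: delta_mx p p) = v p *: proj (delta_mx p p) by rewrite linearZ.
by rewrite /P !scalerA mulrC.
Qed.

End EquivariantMatrices.

(** * Type A *)

Section NewtonInterpolation.
Variable F : fieldType.

(** As in Newton interpolation: the basis function d vanishes before d, so each new point fixes one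
    new coefficient and disturbs no earlier value. *)
Lemma triangular_interpolation (b : nat -> nat -> F) (v : nat -> F) m :
  (forall d p, (p < d)%N -> b d p = 0) -> (forall d, b d d = 1) ->
  exists a : nat -> F, forall p, (p < m)%N -> v p = \sum_(d < m) a d * b d p.
Proof.
move=> b0 b1; elim: m => [|m [a ha]]; first by exists (fun=> 0).
exists (fun d => if d == m then v m - \sum_(d < m) a d * b d m else a d) => p.
rewrite ltnS leq_eqVlt big_ord_recr /= eqxx => hp.
rewrite (eq_bigr (fun d : 'I_m => a d * b d p)) => [|d _]; last by rewrite (ltn_eqF (ltn_ord d)).
case/predU1P: hp => [->|pm]; first by rewrite b1 mulr1 addrC subrK.
by rewrite (b0 m p pm) mulr0 addr0 -ha.
Qed.

End NewtonInterpolation.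

Lemma sum_bin (R : pzSemiRingType) p d : \sum_(q < p) 'C(q, d)%:R = 'C(p, d.+1)%:R :> R.
Proof.
elim: p => [|p IH]; first by rewrite big_ord0.
by rewrite big_ord_recr /= IH binS natrD.
Qed.

Lemma sum_ord_lt (V : nmodType) n (p : 'I_n.+1) (f : nat -> V) :
  \sum_(q < n.+1 | (q < p)%N) f q = \sum_(q < p) f q.
Proof. by rewrite -(big_ord_widen n.+1 f) // ltnW. Qed.

Lemma mul_bin_nat p d : (p * 'C(p, d) = d.+1 * 'C(p, d.+1) + d * 'C(p, d))%N.
Proof.
case: (leqP d p) => dp.
  by rewrite mul_bin_left -mulnDl subnK.
by rewrite (bin_small dp) (bin_small (leqW dp)) !muln0.
Qed.

Section TypeA.
Variables (F : numFieldType) (L : lieType F) (T : tridec L) (n K : nat).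
Variables (c : nat -> 'I_K) (tau : F) (ad : adapted T n c tau).
Local Notation pi := (apr ad).
Variable kA : F.
Hypothesis rho_projA : forall p : 'I_n.+1,
  rhoF ad (apr_proj ad (delta_mx p p)) = kA - p%:R.
Hypothesis proj_entryA : forall p q : 'I_n.+1, (q < p)%N ->
  pi (apr_proj ad (delta_mx q p)) q p = 1.
Variables (A : algType F) (iota : L -> A) (act : L -> A -> A).
Variables (filt : nat -> A -> Prop) (om : 'X_{1..K} -> A -> F) (hb : F).
Hypothesis wm : whit_model ad iota act filt om hb.
Hypothesis hb_ge0 : 0 <= hb.

(** Polynomials of degree at most m in p, in the binomial basis. *)
Definition polyA (m : nat) : set L := fun f => exists a : nat -> F,
  forall p q : 'I_n.+1, pi f p q = (p == q)%:R * \sum_(d < m.+1) a d * 'C(p, d)%:R.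

(** Summing over q < p raises the lower index by one, and multiplication by p is absorbed by
    [mul_bin_nat]. What matters is that the new coefficient -(d + 1 + hb d) is nonzero for hb >=
    0. *)
Lemma step_op_bin d (p : 'I_n.+1) :
  step_op ad hb (fun p : 'I_n.+1 => 'C(p, d)%:R) p =
  - (d.+1%:R + hb * d%:R) * 'C(p, d.+1)%:R + (kA - (1 + hb) * d%:R) * 'C(p, d)%:R.
Proof.
rewrite /step_op rho_projA.
have -> : \sum_(q < n.+1 | (q < p)%N) pi (apr_proj ad (delta_mx q p)) q p *
     ('C(q, d)%:R - 'C(p, d)%:R) = 'C(p, d.+1)%:R - p%:R * 'C(p, d)%:R.
  under eq_bigr => q qp do rewrite proj_entryA // mul1r.
  rewrite sumrB (sum_ord_lt p (fun q => 'C(q, d)%:R)) sum_bin; congr (_ - _).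
  by rewrite (sum_ord_lt p (fun q => 'C(p, d)%:R)) sumr_const card_ord mulr_natl.
have := congr1 (fun k : nat => k%:R : F) (mul_bin_nat p d).
rewrite natrD !natrM => hC; rewrite mulrBl mulrBr hC -natr1; ring.
Qed.

Lemma realized_bin d m : (d <= m)%N ->
  realized ad act filt om m (fun p : 'I_n.+1 => 'C(p, d)%:R).
Proof.
move=> dm; apply: (realized_le wm dm) => {m dm}.
elim: d => [|d IH].
  by apply: realized_ext (realized_const wm 0 1) => p; rewrite bin0.
have cn0 : - (d.+1%:R + hb * d%:R) != 0 :> F.
  rewrite oppr_eq0 gt_eqF //; apply: ltr_wpDr; last by rewrite ltr0n.
  by rewrite mulr_ge0 // ler0n.
have := realized_lin wm (- (kA - (1 + hb) * d%:R)) (realized_le wm (leqnSn d) IH)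
  (realized_step wm IH).
move/(realized_lin wm (- (d.+1%:R + hb * d%:R))^-1)/(_ (realized_const wm d.+1 0)).
apply: realized_ext => p; rewrite step_op_bin addr0.
set w := - _ in cn0 *; set u := kA - _.
have -> : w^-1 * (- u * 'C(p, d)%:R + (w * 'C(p, d.+1)%:R + u * 'C(p, d)%:R)) =
    w^-1 * w * 'C(p, d.+1)%:R by ring.
by rewrite mulVf // mul1r.
Qed.

Lemma realized_binsum m m' (a : nat -> F) : (m' <= m.+1)%N ->
  realized ad act filt om m (fun p : 'I_n.+1 => \sum_(d < m') a d * 'C(p, d)%:R).
Proof.
elim: m' => [|m' IH] hm.
  by apply: realized_ext (realized_const wm m 0) => p; rewrite big_ord0.
have hm' : (m' <= m)%N by rewrite -ltnS.
have := realized_lin wm (a m') (realized_bin hm') (IH (ltnW hm)).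
by apply: realized_ext => p; rewrite big_ord_recr addrC.
Qed.

Lemma whit_imageA m : whit_image act filt om m = polyA m.
Proof.
apply/seteqP; split=> f /=; last first.
  case=> a ha; exact: (whit_image_realized wm (realized_binsum a (leqnn m.+1)) ha).
move=> hf; have [t [h1 h2 h3]] := whit_image_mx wm hf.
set X := tens_mx ad t in h1 h2 h3.
pose v p := om 0%MM (X (inord p) (inord p)).
(* The polynomial is fitted at the places 0, ..., m. *)
have [a ha] := @triangular_interpolation _ (fun d p => 'C(p, d)%:R) v m.+1
  (fun d p pd => congr1 (fun k : nat => k%:R) (bin_small pd))
  (fun d => congr1 (fun k : nat => k%:R) (binn d)).
exists a => p q; rewrite h3; case: (eqVneq p q) => [<-|pq]; last first.
  by rewrite mul0r (om0_offdiag wm h1).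
rewrite mul1r.
suff hv j : (j <= n)%N -> v j = \sum_(d < m.+1) a d * 'C(j, d)%:R.
  by have := hv p; rewrite /v inord_val -ltnS ltn_ord => ->.
move=> jn; case: (leqP j m) => jm; first exact: ha.
have mn : (m <= n)%N by lia.
have [Y [y1 y2 y3]] := realized_binsum a (leqnn m.+1).
(* The difference with a realization of the fitted polynomial vanishes at m+1 consecutive places,
   hence on the whole diagonal. *)
pose W p q := (-1) *: Y p q + X p q.
have w1 : equivariant ad act W by exact: (equivariant_lin wm).
have w2 p' q' : filt m (W p' q') by exact: (wm_filt_lin wm).
have w3 i : (i <= n)%N -> path_coef c om W i i = v i - \sum_(d < m.+1) a d * 'C(i, d)%:R.
  by move=> hi; rewrite path_coef_diag (wm_lin wm) y3 mulN1r addrC inordK.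
have := @window_all _ _ _ _ _ _ _ ad _ _ _ _ _ _ wm hb_ge0 W m w1 w2 0 m mn.
rewrite add0n leqnn => /(_ isT) hw.
have : path_coef c om W j j = 0.
  apply: hw => // i /andP[_ im]; rewrite w3 ?(leq_trans im) //.
  by rewrite ha ?ltnS // subrr.
by rewrite w3 // => /eqP; rewrite subr_eq0 => /eqP.
Qed.

End TypeA.

(** * Type C *)

Section TypeC.
Variables (F : numFieldType) (L : lieType F) (T : tridec L) (n K r : nat).
Variables (c : nat -> 'I_K) (tau : F) (ad : adapted T n c tau).
Local Notation pi := (apr ad).
Hypothesis n_r : n.+1 = (r + r)%N.
Hypothesis c_rev : forall j, (j < n)%N -> c (n.-1 - j)%N = c j.

(** Along the diagonal the signed levels are r, ..., 1, -1, ..., -r; this is the absolute value and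
    [cosign] the sign. *)
Definition colevel (p : nat) : nat := if (p < r)%N then (r - p)%N else (p.+1 - r)%N.
Definition cosign (p : nat) : F := if (p < r)%N then 1 else -1.

Hypothesis rho_projC : forall p : 'I_n.+1,
  rhoF ad (apr_proj ad (delta_mx p p)) = cosign p * (colevel p)%:R.
Hypothesis proj_entryC : forall p q : 'I_n.+1, (q < p)%N ->
  pi (apr_proj ad (delta_mx q p)) q p = 1 + (q == rev_ord p)%:R.
Hypothesis apr_skew : forall x p q,
  pi x p q = - ((-1) ^+ (p + q) * pi x (rev_ord q) (rev_ord p)).
Variables (A : algType F) (iota : L -> A) (act : L -> A -> A).
Variables (filt : nat -> A -> Prop) (om : 'X_{1..K} -> A -> F) (hb : F).
Hypothesis wm : whit_model ad iota act filt om hb.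
Hypothesis hb_ge0 : 0 <= hb.
Local Notation om0 := (om 0%MM).
Local Notation realized := (realized ad act filt om).
Implicit Types X : 'I_n.+1 -> 'I_n.+1 -> A.

Lemma rev_ordE (p : 'I_n.+1) : rev_ord p = (n - p)%N :> nat.
Proof. by rewrite /= subSS. Qed.

Lemma colevel_rev (p : 'I_n.+1) : colevel (rev_ord p) = colevel p.
Proof.
have hp := ltn_ord p; rewrite /colevel rev_ordE.
case: ltnP => h1; case: ltnP => h2; move: n_r hp h1 h2; lia.
Qed.

Lemma cosign_rev (p : 'I_n.+1) : cosign (rev_ord p) = - cosign p.
Proof.
have hp := ltn_ord p; rewrite /cosign rev_ordE.
case: ltnP => h1; case: ltnP => h2; rewrite ?opprK //; exfalso; move: n_r hp h1 h2; lia.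
Qed.

(** The adjoint for the symplectic form. By [apr_skew] it is -1 on the image of L, so it preserves
    equivariance; on the diagonal it reverses the order. *)
Definition dagger X (p q : 'I_n.+1) : A := (-1) ^+ (p + q) *: X (rev_ord q) (rev_ord p).

Lemma sign_cancel (a b d : nat) : (-1) ^+ (a + b) * (-1) ^+ (d + a) = (-1) ^+ (d + b) :> F.
Proof.
rewrite !exprD; transitivity ((-1) ^+ d * (-1) ^+ b * ((-1) ^+ a * (-1) ^+ a) : F); first by ring.
by rewrite -expr2 sqrr_sign mulr1.
Qed.

Lemma dagger_equivariant X : equivariant ad act X -> equivariant ad act (dagger X).
Proof.
move=> hX x p q.
have -> : \sum_s pi x s q *: dagger X p s =
    - ((-1) ^+ (p + q) *: \sum_s pi x (rev_ord q) s *: X s (rev_ord p)).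
  rewrite (reindex_inj rev_ord_inj) scaler_sumr -sumrN; apply: eq_bigr => s _ /=.
  rewrite (apr_skew x (rev_ord s)) /dagger !rev_ordK !scalerA -scaleNr; congr (_ *: _).
  by rewrite mulNr mulrAC sign_cancel.
have -> : \sum_s pi x p s *: dagger X s q =
    - ((-1) ^+ (p + q) *: \sum_s pi x s (rev_ord p) *: X (rev_ord q) s).
  rewrite (reindex_inj rev_ord_inj) scaler_sumr -sumrN; apply: eq_bigr => s _ /=.
  rewrite (apr_skew x p) /dagger !rev_ordK !scalerA -scaleNr; congr (_ *: _).
  by rewrite mulNr mulrAC [X in - (X * _) = _]mulrC sign_cancel.
by rewrite opprK /dagger (actZ wm) hX scalerBr addrC.
Qed.

Lemma dagger_diag X p : dagger X p p = X (rev_ord p) (rev_ord p).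
Proof. by rewrite /dagger addnn -muln2 exprM sqrr_sign scale1r. Qed.

Lemma realized_rev m v : realized m v -> realized m (fun p => v (rev_ord p)).
Proof.
move=> [X [h1 h2 h3]]; exists (dagger X); split; first exact: dagger_equivariant.
  by move=> p q; apply: (filtZ wm).
by move=> p; rewrite dagger_diag h3.
Qed.

Definition evenf (w : nat -> F) (p : 'I_n.+1) : F := w (colevel p).
Definition oddf (w : nat -> F) (p : 'I_n.+1) : F := cosign p * w (colevel p).

Definition csum (w : nat -> F) (k : nat) : F := \sum_(j < k) w j.+1.

Lemma csumS w k : csum w k.+1 = csum w k + w k.+1.
Proof. by rewrite /csum big_ord_recr. Qed.

(* [eps] is the parity of the function [w] on the levels r, ..., 1, -1, ..., -r. *)
Lemma sum_levels (eps : F) w p : (p <= r + r)%N ->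
  \sum_(q < p) (if (q < r)%N then w (r - q)%N else eps * w (q.+1 - r)%N) =
  if (p <= r)%N then csum w r - csum w (r - p) else csum w r + eps * csum w (p - r).
Proof.
elim: p => [|p IH] hp; first by rewrite big_ord0 subn0 subrr.
rewrite big_ord_recr /= IH ?(ltnW hp) //.
case: (ltngtP p r) => pr.
- have e : (r - p = (r - p.+1).+1)%N by lia.
  by rewrite e csumS; ring.
- have e : (p.+1 - r = (p - r).+1)%N by lia.
  by rewrite e csumS; ring.
by rewrite pr subnn /csum big_ord0 subr0 subSnn big_ord_recr big_ord0 /= add0r.
Qed.

(** The last term comes from the antidiagonal places q = n - p, where [proj_entryC] gives 2 instead
    of 1; such a q lies below p exactly when p >= r. *)
Lemma step_opC (v : nat -> F) (p : 'I_n.+1) :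
  step_op ad hb (fun q : 'I_n.+1 => v q) p = cosign p * (colevel p)%:R * v p +
  hb * (\sum_(q < p) v q - p%:R * v p + (r <= p)%N%:R * (v (n - p)%N - v p)).
Proof.
rewrite /step_op rho_projC; congr (_ + hb * _).
transitivity (\sum_(q < n.+1 | (q < p)%N) (v q - v p) +
   \sum_(q < n.+1 | (q < p)%N) (q == rev_ord p)%:R * (v q - v p)).
  by rewrite -big_split; apply: eq_bigr => q qp /=; rewrite proj_entryC // mulrDl mul1r.
congr (_ + _).
  rewrite sumrB (sum_ord_lt p v); congr (_ - _).
  by rewrite (sum_ord_lt p (fun=> v p)) sumr_const card_ord mulr_natl.
rewrite big_mkcond (bigD1 (rev_ord p)) //= eqxx mul1r big1 ?addr0 => [|q /negPf ->]; last first.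
  by rewrite mul0r; case: ifP.
have hp := ltn_ord p; rewrite ?rev_ordE ?subSS.
have -> : (r <= p)%N = (n - p < p)%N by move: n_r hp; lia.
by case: ifP; rewrite ?mul1r ?mul0r.
Qed.

(** The even part of a step applied to an odd function; [odd_step] is the odd part of a step applied
    to an even one. The parts are extracted by averaging with [realized_rev]. *)
Definition even_step (w : nat -> F) (x : nat) : F :=
  x%:R * w x + hb * (x%:R * w x + csum w r - csum w x.-1).
Definition odd_step (w : nat -> F) (x : nat) : F :=
  x%:R * w x + hb * (x%:R * w x - csum w x.-1 - w x).

Lemma half_sum m v u : realized m v ->
  (forall p, 2^-1 * v p + 2^-1 * v (rev_ord p) = u p) -> realized m u.
Proof.
move=> hv hu; apply: realized_ext hu _.
have h2 := realized_lin wm 2^-1 (realized_rev hv) (realized_const wm m 0).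
apply: realized_ext (realized_lin wm 2^-1 hv h2) => p.
by rewrite addr0.
Qed.

Lemma half_diff m v u : realized m v ->
  (forall p, 2^-1 * v p - 2^-1 * v (rev_ord p) = u p) -> realized m u.
Proof.
move=> hv hu; apply: realized_ext hu _.
have h2 := realized_lin wm (- 2^-1) (realized_rev hv) (realized_const wm m 0).
apply: realized_ext (realized_lin wm 2^-1 hv h2) => p.
by rewrite addr0 mulNr.
Qed.

Definition signedf (eps : F) (w : nat -> F) (q : nat) : F :=
  if (q < r)%N then w (r - q)%N else eps * w (q.+1 - r)%N.

Lemma step_signed_low (eps : F) w (p : 'I_n.+1) : (p < r)%N ->
  step_op ad hb (fun q : 'I_n.+1 => signedf eps w q) p =
  (r - p)%:R * w (r - p)%N + hb * (csum w r - csum w (r - p) - p%:R * w (r - p)%N).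
Proof.
move=> pr; rewrite step_opC sum_levels; last by rewrite -n_r ltnW.
by rewrite (ltnW pr) [(r <= p)%N]leqNgt pr mul0r addr0 /signedf /cosign /colevel pr mul1r.
Qed.

Lemma step_signed_high (eps : F) w (p : 'I_n.+1) : (r <= p)%N ->
  step_op ad hb (fun q : 'I_n.+1 => signedf eps w q) p =
  - (p.+1 - r)%:R * (eps * w (p.+1 - r)%N)
  + hb * (csum w r + eps * csum w (p - r) - p%:R * (eps * w (p.+1 - r)%N)
     + (w (p.+1 - r)%N - eps * w (p.+1 - r)%N)).
Proof.
move=> pr; have hp := ltn_ord p; rewrite step_opC sum_levels; last by rewrite -n_r ltnW.
have e1 : (n - p < r)%N by move: n_r hp; lia.
have e2 : (r - (n - p) = p.+1 - r)%N by move: n_r hp; lia.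
rewrite pr mul1r /signedf /cosign /colevel e1 e2 ltnNge pr /= mulN1r; congr (_ + hb * (_ - _ + _)).
case: (ltngtP p r) pr => // -> _.
by rewrite subnn /csum !big_ord0 subr0 mulr0 addr0.
Qed.

Lemma evenfE w : evenf w =1 fun q => signedf 1 w q.
Proof. by move=> q; rewrite /evenf /signedf /colevel; case: ifP; rewrite ?mul1r. Qed.

Lemma oddfE w : oddf w =1 fun q => signedf (-1) w q.
Proof.
by move=> q; rewrite /oddf /signedf /cosign /colevel; case: ifP; rewrite ?mul1r.
Qed.

Lemma realized_even_step m w : realized m (oddf w) -> realized m.+1 (evenf (even_step w)).
Proof.
move=> /(realized_ext (oddfE w)) /(realized_step wm) hw; apply: half_sum hw _ => p.
wlog pr : p / (p < r)%N.
  move=> W; case: (ltnP p r) => pr; first exact: W.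
  have hp := ltn_ord p.
  have pr' : (rev_ord p < r)%N by rewrite rev_ordE; move: n_r hp; lia.
  by have := W _ pr'; rewrite rev_ordK addrC /evenf colevel_rev.
have hp := ltn_ord p.
have rp : (r <= rev_ord p)%N by rewrite rev_ordE; move: n_r hp; lia.
rewrite step_signed_low // step_signed_high // /evenf /colevel pr /even_step.
have -> : ((rev_ord p).+1 - r = r - p)%N by rewrite rev_ordE; move: n_r hp; lia.
have -> : (rev_ord p - r = (r - p).-1)%N by rewrite rev_ordE; move: n_r hp; lia.
have -> : ((rev_ord p)%:R = (r - p)%:R + r%:R - 1 :> F).
  apply/eqP; rewrite eq_sym subr_eq natr1 -natrD; apply/eqP; congr (_%:R).
  by rewrite rev_ordE; move: n_r hp; lia.
have -> : (p%:R = r%:R - (r - p)%:R :> F) by rewrite natrB ?(ltnW pr) // opprB addrC subrK.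
have [x ex] : exists x, (r - p)%N = x.+1 by exists (r - p).-1; rewrite prednK ?subn_gt0.
by rewrite ex csumS /=; field.
Qed.

Lemma realized_odd_step m w : realized m (evenf w) -> realized m.+1 (oddf (odd_step w)).
Proof.
move=> /(realized_ext (evenfE w)) /(realized_step wm) hw; apply: half_diff hw _ => p.
wlog pr : p / (p < r)%N.
  move=> W; case: (ltnP p r) => pr; first exact: W.
  have hp := ltn_ord p.
  have pr' : (rev_ord p < r)%N by rewrite rev_ordE; move: n_r hp; lia.
  have := W _ pr'; rewrite rev_ordK /oddf colevel_rev cosign_rev mulNr => /(congr1 -%R).
  by rewrite opprB opprK.
have hp := ltn_ord p.
have rp : (r <= rev_ord p)%N by rewrite rev_ordE; move: n_r hp; lia.
rewrite step_signed_low // step_signed_high // /oddf /cosign /colevel pr /odd_step.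
have -> : ((rev_ord p).+1 - r = r - p)%N by rewrite rev_ordE; move: n_r hp; lia.
have -> : (rev_ord p - r = (r - p).-1)%N by rewrite rev_ordE; move: n_r hp; lia.
have -> : ((rev_ord p)%:R = (r - p)%:R + r%:R - 1 :> F).
  apply/eqP; rewrite eq_sym subr_eq natr1 -natrD; apply/eqP; congr (_%:R).
  by rewrite rev_ordE; move: n_r hp; lia.
have -> : (p%:R = r%:R - (r - p)%:R :> F) by rewrite natrB ?(ltnW pr) // opprB addrC subrK.
have [x ex] : exists x, (r - p)%N = x.+1 by exists (r - p).-1; rewrite prednK ?subn_gt0.
by rewrite ex csumS /=; field.
Qed.

(** The polynomial (x+k)(x+k-1)...(x-k)/(2k+1)!, odd of degree 2k+1. It vanishes at 1, ..., k and is
    1 at k+1, so these form a triangular basis of the odd polynomials. *)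
Definition binC (k x : nat) : F := 'C(x + k, k.*2.+1)%:R.

Lemma binC_small d p : (p < d)%N -> binC d p.+1 = 0.
Proof. by move=> pd; rewrite /binC bin_small // -addnn; lia. Qed.

Lemma binC_diag d : binC d d.+1 = 1.
Proof. by rewrite /binC addSn addnn binn. Qed.

Lemma colevel_gt0 (p : 'I_n.+1) : (0 < colevel p)%N.
Proof. by rewrite /colevel; case: (ltnP p r) => h; lia. Qed.

Lemma csum_bin k d j : (k < d)%N ->
  csum (fun x => 'C(x + k, d)%:R) j = 'C(j.+1 + k, d.+1)%:R.
Proof.
move=> kd; elim: j => [|j IH]; first by rewrite /csum big_ord0 bin_small // add1n.
by rewrite csumS IH [in RHS]addSn binS natrD.
Qed.

Lemma csum_lin a u v j : csum (fun x => a * u x + v x) j = a * csum u j + csum v j.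
Proof. by rewrite /csum mulr_sumr -big_split. Qed.

Lemma csum_ext u v j : (forall x, u x.+1 = v x.+1) -> csum u j = csum v j.
Proof. by move=> uv; apply: eq_bigr => i _; rewrite uv. Qed.

Lemma csum_const a j : csum (fun=> a) j = j%:R * a.
Proof. by rewrite /csum sumr_const card_ord mulr_natl. Qed.

Lemma mul_binF (N d : nat) :
  N%:R * 'C(N, d)%:R = d.+1%:R * 'C(N, d.+1)%:R + d%:R * 'C(N, d)%:R :> F.
Proof. by rewrite -!natrM -natrD mul_bin_nat. Qed.

Let coefP k : F := (1 + hb) * (k.*2.+2)%:R - hb.
Let coefR k : F := (1 + hb) * k.+1%:R.

Lemma even_step_binC k x : even_step (binC k) x.+1 =
  coefP k * 'C(x.+1 + k, k.*2.+2)%:R + (coefR k * binC k x.+1 + hb * csum (binC k) r).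
Proof.
rewrite /even_step [csum _ x.+1.-1]csum_bin; last by rewrite -addnn; lia.
rewrite /binC /= /coefP /coefR.
have := mul_binF (x.+1 + k) k.*2.+1.
have -> : (x.+1 + k)%:R = x.+1%:R + k%:R :> F by rewrite natrD.
have -> : k.*2.+2%:R = 2 * (k%:R + 1) :> F by rewrite -muln2 -addn2 natrD natrM; ring.
have -> : k.*2.+1%:R = 2 * k%:R + 1 :> F by rewrite -muln2 -addn1 natrD natrM; ring.
have -> : k.+1%:R = k%:R + 1 :> F by rewrite -addn1 natrD.
rewrite mulrDl => /(canRL (addrK _)) ->; ring.
Qed.

(** Two steps raise k by one. The remainder lies in the span of [binC k] and of x = [binC 0]; the
    latter comes from the constant that [even_step] creates. *)
Lemma odd_even_step_binC k x : odd_step (even_step (binC k)) x.+1 =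
  coefP k * (2 * coefR k + 1) * binC k.+1 x.+1
  + coefR k * (coefR k - hb) * binC k x.+1 + hb * csum (binC k) r * x.+1%:R.
Proof.
set ka := hb * csum (binC k) r.
have cs : csum (even_step (binC k)) x = coefP k * 'C(x.+1 + k, k.*2.+3)%:R
    + (coefR k * 'C(x.+1 + k, k.*2.+2)%:R + x%:R * ka).
  rewrite (csum_ext (v := fun x => coefP k * 'C(x + k, k.*2.+2)%:R + (coefR k * binC k x + ka))) => [|j]; last first.
    by rewrite even_step_binC.
  by rewrite !csum_lin csum_const !csum_bin // -addnn; lia.
rewrite /odd_step /= cs even_step_binC -/ka.
have -> : binC k.+1 x.+1 = 'C(x.+1 + k, k.*2.+3)%:R + 'C(x.+1 + k, k.*2.+2)%:R.
  by rewrite /binC addnS doubleS binS natrD.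
rewrite /binC /coefP /coefR.
have := mul_binF (x.+1 + k) k.*2.+1; have := mul_binF (x.+1 + k) k.*2.+2.
have -> : (x.+1 + k)%:R = x%:R + 1 + k%:R :> F by rewrite natrD natr1.
have -> : k.*2.+3%:R = 2 * k%:R + 3 :> F by rewrite -muln2 -addn3 natrD natrM; ring.
have -> : k.*2.+2%:R = 2 * (k%:R + 1) :> F by rewrite -muln2 -addn2 natrD natrM; ring.
have -> : k.*2.+1%:R = 2 * k%:R + 1 :> F by rewrite -muln2 -addn1 natrD natrM; ring.
have -> : k.+1%:R = k%:R + 1 :> F by rewrite -addn1 natrD.
have -> : x.+1%:R = x%:R + 1 :> F by rewrite -addn1 natrD.
set X := x%:R; set k' := k%:R; set D := 'C(_, k.*2.+3)%:R; set C := 'C(_, k.*2.+2)%:R.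
set B := 'C(_, k.*2.+1)%:R => e1 e2.
(* The absorption identities are solved for the products with x; after regrouping, the goal involves
   x only through such products and terms that match on both sides. *)
have e1' : X * C = (2 * k' + 3) * D + 2 * (k' + 1) * C - C - k' * C by rewrite -e1; ring.
have e2' : X * B = 2 * (k' + 1) * C + (2 * k' + 1) * B - B - k' * B by rewrite -e2; ring.
transitivity ((1 + hb) * (((1 + hb) * (2 * (k' + 1)) - hb) * (X * C) + (1 + hb) * (k' + 1) * (X * B))
  + ((1 + hb) * (((1 + hb) * (2 * (k' + 1)) - hb) * C + (1 + hb) * (k' + 1) * B + ka)
   + (1 + hb) * X * ka
   - hb * (((1 + hb) * (2 * (k' + 1)) - hb) * D + ((1 + hb) * (k' + 1) * C + X * ka))
   - hb * (((1 + hb) * (2 * (k' + 1)) - hb) * C + ((1 + hb) * (k' + 1) * B + ka)))).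
  by ring.
by rewrite e1' e2'; ring.
Qed.

(** The start is [odd_step] of the constant 1, which is x whatever hb is. At each further step the
    leading coefficient is positive, so it can be inverted after the lower terms are removed. *)
Lemma realized_binC k m : (k.*2 < m)%N -> realized m (oddf (binC k)).
Proof.
move=> km; apply: (realized_le wm km) => {m km}.
elim: k => [|k IH].
  have h1 : realized 0 (evenf (fun=> 1)) by exact: (realized_const wm).
  apply: realized_ext (realized_odd_step h1) => p; rewrite /oddf; congr (_ * _).
  case: (colevel p) (colevel_gt0 p) => // x _.
  rewrite /odd_step csum_const /binC addn0 bin1 /= -natr1; ring.
have cP : 0 < coefP k.
  have -> : coefP k = k.*2.+2%:R + hb * k.*2.+1%:R.
    by rewrite /coefP -[k.*2.+2%:R]natr1; ring.
  by apply: ltr_wpDr; rewrite ?ltr0n // mulr_ge0 // ler0n.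
have cR : 0 <= coefR k by rewrite mulr_ge0 ?ler0n // addr_ge0.
have l0 : coefP k * (2 * coefR k + 1) != 0.
  rewrite mulf_neq0 ?gt_eqF //; apply: ltr_wpDl => //.
  by rewrite mulr_ge0.
have h0 : realized k.*2.+3 (oddf (binC 0)).
  have h1 : realized 0 (evenf (fun=> 1)) by exact: (realized_const wm).
  have h2 : realized k.*2.+3 (oddf (odd_step (fun=> 1))).
    by apply: (realized_le wm _ (realized_odd_step h1)).
  apply: realized_ext h2 => p; rewrite /oddf; congr (_ * _).
  case: (colevel p) (colevel_gt0 p) => // x _.
  rewrite /odd_step csum_const /binC addn0 bin1 /= -natr1; ring.
have IH' : realized k.*2.+3 (oddf (binC k)) by apply: (realized_le wm _ IH); lia.
have hs := realized_odd_step (realized_even_step IH).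
have h1 := realized_lin wm (- (hb * csum (binC k) r)) h0 hs.
have h2 := realized_lin wm (- (coefR k * (coefR k - hb))) IH' h1.
have h3 := realized_lin wm (coefP k * (2 * coefR k + 1))^-1 h2 (realized_const wm k.*2.+3 0).
rewrite doubleS; apply: realized_ext h3 => p; rewrite addr0 /oddf.
case: (colevel p) (colevel_gt0 p) => // x _; rewrite odd_even_step_binC.
have -> : binC 0 x.+1 = x.+1%:R by rewrite /binC addn0 bin1.
set l := coefP k * _ in l0 *; set mu := coefR k * _; set ka := hb * _.
transitivity (l^-1 * l * (cosign p * binC k.+1 x.+1)); first by ring.
by rewrite mulVf // mul1r.
Qed.

Lemma realized_binCsum m D (a : nat -> F) : (D <= uphalf m)%N ->
  realized m (oddf (fun x => \sum_(k < D) a k * binC k x)).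
Proof.
elim: D => [|D IH] hD.
  apply: realized_ext (realized_const wm m 0) => p.
  by rewrite /oddf big_ord0 mulr0.
have hD' : (D.*2 < m)%N by lia.
have := realized_lin wm (a D) (realized_binC hD') (IH (ltnW hD)).
by apply: realized_ext => p; rewrite /oddf big_ord_recr /=; ring.
Qed.

Lemma path_idx_rev p q : (p <= q)%N -> (q <= n)%N ->
  path_idx c (n - q) (n - p) = path_idx c p q.
Proof.
elim: q => [|q IH]; first by rewrite leqn0 => /eqP -> _; rewrite !path_idx_nil.
rewrite leq_eqVlt => /predU1P[->|pq] qn; first by rewrite !path_idx_nil.
rewrite path_idx_recl; last by lia.
rewrite path_idx_recr // addmC; congr (_ + _)%MM.
  by rewrite -IH //; [congr path_idx; lia | lia].
have -> : (n - q.+1)%N = (n.-1 - q)%N by lia.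
by rewrite c_rev.
Qed.

(** Odd polynomials of degree at most m in the signed level: [uphalf m] counts the odd integers up
    to m. *)
Definition polyC (m : nat) : set L := fun f => exists a : nat -> F,
  forall p q : 'I_n.+1, pi f p q =
    (p == q)%:R * (cosign p * \sum_(k < uphalf m) a k * binC k (colevel p)).

(** The levels up to D fill the 2D central places. For odd m these are m+1 places and [window_all]
    applies; for even m there are only m of them, and skew symmetry has to supply the place lo next
    to them. *)
Lemma skew_window X m : equivariant ad act X -> (forall p q, filt m (X p q)) ->
  (forall p q : 'I_n.+1, X p q = - ((-1) ^+ (p + q) *: X (rev_ord q) (rev_ord p))) ->
  (forall p : 'I_n.+1, (colevel p <= uphalf m)%N -> om0 (X p p) = 0) ->
  forall p, om0 (X p p) = 0.
Proof.
move=> hX fX sX h0; set D := uphalf m in h0.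
pose W := path_coef c om X.
have WE (p : 'I_n.+1) : om0 (X p p) = W p p by rewrite /W path_coef_diag inord_val.
suff hW : forall j, (j <= n)%N -> W j j = 0 by move=> p; rewrite WE hW // -ltnS.
have W0 j : (j <= n)%N -> (colevel j <= D)%N -> W j j = 0.
  by move=> jn hj; rewrite /W path_coef_diag h0 // inordK.
have [rD|Dr] := leqP r D.
  move=> j jn; apply: W0 => //; apply: leq_trans rD.
  by rewrite /colevel; case: ltnP => h; move: n_r jn h; lia.
have wa lo hi := @window_all _ _ _ _ _ _ _ ad _ _ _ _ _ _ wm hb_ge0 X m hX fX lo hi.
have win k : (r - D <= k <= r + D - 1)%N -> W k k = 0.
  move=> hk; apply: W0; first by move: n_r hk; lia.
  by rewrite /colevel; case: ltnP; move: n_r hk; lia.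
have mD : m = (D.*2 - odd m)%N.
  by rewrite /D; move: (odd_double_half m); rewrite uphalf_half; case: (odd m); lia.
case om' : (odd m) mD => mD.
  apply: (wa (r - D)%N (r + D - 1)%N); [move: n_r; lia | move: n_r Dr mD; lia |].
  exact: win.
rewrite subn0 in mD; pose lo := (r - D - 1)%N; pose hi := (r + D - 1)%N.
have hin : (hi < n)%N by rewrite /hi; move: n_r Dr; lia.
have rec p q (pq : (p < q)%N) (qn : (q <= n)%N) := path_coef_rec wm hX pq qn.
have wz p q : (lo.+1 <= p)%N -> (p <= q)%N -> (q <= hi)%N -> W p q = 0.
  apply: (@window_zero _ _ _ _ _ _ _ ad _ _ _ _ _ _ wm hb_ge0 X hX lo.+1 hi (ltnW hin)).
  by move=> j hj; apply: win; move: hj; rewrite /lo /hi; lia.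
(* The entry (lo, hi+1) has path length m+1 and vanishes, so the recurrence equates y times its
   neighbours (lo, hi) and (lo+1, hi+1). Both lengths y agree, and skew symmetry makes the
   neighbours opposite, so both are 0. *)
have lh0 : W lo hi = 0.
  have lt1 : (lo < hi.+1)%N by rewrite /lo /hi; lia.
  have := rec lo hi.+1 lt1 hin.
  rewrite [path_coef _ _ X lo hi.+1](path_coef_deg wm fX) ?mulr0; last first.
    rewrite /lo /hi; lia.
  have cc : c hi = c lo.
    by rewrite -(c_rev hin) /lo /hi; congr c; move: n_r; lia.
  have -> : path_coef c om X lo.+1 hi.+1 = - W lo hi.
    have -> : path_coef c om X lo.+1 hi.+1 = om (path_idx c lo hi) (X (inord lo.+1) (inord hi.+1)).
      have lohi : (lo <= hi)%N by rewrite /lo /hi; clear -Dr; lia.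
      rewrite /path_coef -(path_idx_rev lohi (ltnW hin)).
      by congr (om (path_idx _ _ _) _); rewrite /lo /hi; move: n_r Dr; lia.
    have ri j : (j <= n)%N -> rev_ord (inord j : 'I_n.+1) = inord (n - j).
      by move=> jn; apply: val_inj; rewrite /= !inordK ?subSS // ltnS leq_subr.
    have lon : (lo.+1 <= n)%N by rewrite /lo; move: n_r Dr; lia.
    rewrite sX !ri // (_ : (n - hi.+1)%N = lo); last by rewrite /lo /hi; move: n_r Dr; lia.
    rewrite (_ : (n - lo.+1)%N = hi); last by rewrite /lo /hi; move: n_r Dr; lia.
    rewrite !inordK // (_ : (lo.+1 + hi.+1)%N = r.*2); last by rewrite /lo /hi; lia.
    by rewrite -muln2 mulnC exprM sqrrN expr1n expr1n scale1r -scaleN1r (omZ wm) mulN1r.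
  rewrite /= cc mulrN opprK => /esym/eqP; rewrite -mulr2n mulrn_eq0 /=.
  by rewrite mulf_eq0 (gt_eqF (len_gt0 ad _)) /= => /eqP.
(* As in [window_left], the zero moves along row lo to the diagonal. *)
have gen k : (lo + k <= hi)%N -> W lo (hi - k)%N = 0.
  elim: k => [|k IH] hk; first by rewrite subn0.
  have lt : (lo < hi - k)%N by lia.
  have hn : (hi - k <= n)%N by lia.
  have := rec lo _ lt hn; rewrite -[path_coef c om X]/W IH; last by lia.
  rewrite (wz lo.+1) //; last by lia.
  rewrite !mulr0 subr0 => /esym/eqP; rewrite mulf_eq0 (gt_eqF (len_gt0 ad _)) /=.
  by rewrite (_ : (hi - k).-1 = (hi - k.+1)%N) => [/eqP //|]; lia.
apply: (wa lo hi); [exact: ltnW | by rewrite /lo /hi; lia |].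
move=> k hk; have [->|kl] := eqVneq k lo; last by apply: win; move: hk kl; rewrite /lo /hi; lia.
have := gen (hi - lo)%N; rewrite subKn ?subnKC; try by rewrite /lo /hi; lia.
by apply.
Qed.

Lemma whit_imageC m : whit_image act filt om m = polyC m.
Proof.
apply/seteqP; split=> f /=; last first.
  by case=> a ha; apply: (whit_image_realized wm (realized_binCsum a (leqnn _))) => p q; rewrite ha.
move=> hf; have [t [h1 h2 h3]] := whit_image_mx wm hf.
set X := tens_mx ad t in h1 h2 h3.
have sX (p q : 'I_n.+1) : X p q = - ((-1) ^+ (p + q) *: X (rev_ord q) (rev_ord p)).
  rewrite /X /tens_mx scaler_sumr -sumrN; apply: eq_bigr => j _.
  by rewrite apr_skew scaleNr scalerA.
(* Level x is read at the place r - x, in the half where the sign is 1. *)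
pose v x := om0 (X (inord (r - x)) (inord (r - x))).
have [a ha] := @triangular_interpolation _ (fun d p => binC d p.+1) (fun x => v x.+1) (uphalf m)
  binC_small binC_diag.
set D := uphalf m in ha; pose w x := \sum_(k < D) a k * binC k x.
have [Y [y1 y2 y3]] := realized_binCsum a (leqnn D).
(* [X] minus the skew part (Y - dagger Y)/2 of a realization of the fitted polynomial. This keeps
   [Z] skew, and the diagonal of [Y] is already odd, so passing to the skew part does not change
   it. *)
pose Z p q := 2^-1 *: dagger Y p q + ((- 2^-1) *: Y p q + X p q).
have z1 : equivariant ad act Z.
  apply: (equivariant_lin wm); first exact: dagger_equivariant.
  exact: (equivariant_lin wm).
have z2 p q : filt m (Z p q).
  by apply: (wm_filt_lin wm); [apply: (filtZ wm) | apply: (wm_filt_lin wm)].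
have sZ (p q : 'I_n.+1) : Z p q = - ((-1) ^+ (p + q) *: Z (rev_ord q) (rev_ord p)).
  have e : (-1) ^+ (p + q) *: dagger Y (rev_ord q) (rev_ord p) = Y p q.
    rewrite /dagger !rev_ordK scalerA -exprD.
    rewrite (_ : (p + q + (rev_ord q + rev_ord p))%N = n.*2).
      by rewrite -muln2 mulnC exprM sqrrN !expr1n scale1r.
    by rewrite !rev_ordE; have := ltn_ord p; have := ltn_ord q; lia.
  have sc (b b' : F) (u : A) : b *: (b' *: u) = b' *: (b *: u) by rewrite !scalerA mulrC.
  rewrite /Z !scalerDr !(sc _ 2^-1) !(sc _ (- 2^-1)) e -/(dagger Y p q).
  by rewrite [in LHS]sX !opprD !scaleNr opprK addrCA.
have z3 p : om0 (Z p p) = om0 (X p p) - cosign p * w (colevel p).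
  rewrite /Z dagger_diag !(omD wm) !(omZ wm) !y3 /oddf colevel_rev cosign_rev -/(w _).
  by field.
have hZ : forall p, om0 (Z p p) = 0.
  apply: (skew_window z1 z2 sZ) => p pD; rewrite z3.
  wlog pr : p pD / (p < r)%N.
    move=> H; case: (ltnP p r) => pr; first exact: H.
    have pr' : (rev_ord p < r)%N by rewrite rev_ordE; move: n_r pr (ltn_ord p); lia.
    have := H (rev_ord p); rewrite colevel_rev cosign_rev => /(_ pD pr') h.
    rewrite sX addnn -muln2 mulnC exprM sqrrN !expr1n scale1r -scaleN1r (omZ wm).
    by rewrite -[RHS]oppr0 -h; ring.
  rewrite /cosign pr mul1r.
  case e : (colevel p) (colevel_gt0 p) pD => [//|x] _ xD.
  rewrite /w -(ha _ xD) /v -e {e}/colevel pr subKn ?(ltnW pr) // inord_val.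
  by rewrite subrr.
exists a => p q; rewrite h3; have [<-|pq] := eqVneq p q; last by rewrite mul0r (om0_offdiag wm h1).
by rewrite mul1r; have := hZ p; rewrite z3 => /eqP; rewrite subr_eq0 => /eqP.
Qed.

End TypeC.

Lemma big_space_ind (F : fieldType) (V : vectType F) (I : eqType) (s : seq I)
    (U : I -> {vspace V}) (P : V -> Prop) : P 0 -> (forall x y, P x -> P y -> P (x + y)) ->
  (forall i x, i \in s -> x \in U i -> P x) -> forall x, x \in (\sum_(i <- s) U i)%VS -> P x.
Proof.
move=> P0 PD; elim: s => [|i s IH] PU x; first by rewrite big_nil memv0 => /eqP ->.
rewrite big_cons => /memv_addP[y hy [z hz ->]]; apply: (PD _ _); first by apply: PU hy; exact: mem_head.
by apply: IH hz => j w js; apply: PU; rewrite inE js orbT.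
Qed.

Lemma big_space_sub (F : fieldType) (V : vectType F) (I : eqType) (s : seq I)
    (U : I -> {vspace V}) i : i \in s -> (U i <= \sum_(i <- s) U i)%VS.
Proof.
elim: s => // j s IH; rewrite inE big_cons => /predU1P[->|/IH h]; first exact: addvSl.
by apply: subv_trans h _; exact: addvSr.
Qed.

(** * Diagonalizing a Cartan subalgebra *)

Section RootSpaces.
Variables (F : fieldType) (L : lieType F) (T : tridec L).

Definition is_weight (a : weight (cartan T)) : bool :=
  [|| a == 0, a \in posroots T | - a \in posroots T].

Lemma rootspace_ind (P : L -> Prop) : P 0 -> (forall x y, P x -> P y -> P (x + y)) ->
  (forall a x, is_weight a -> x \in rootspace a -> P x) -> forall x, P x.
Proof.
move=> P0 PD PU x; have [y [h [z [hy hh hz ->]]]] := tridec_split T x.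
apply: (PD _ _); first apply: (PD _ _).
- apply: big_space_ind hy => // a w ha; apply: PU; by rewrite /is_weight opprK ha !orbT.
- by apply: (PU 0); rewrite ?cartan_centralizer // /is_weight eqxx.
by apply: big_space_ind hz => // a w ha; apply: PU; rewrite /is_weight ha orbT.
Qed.

Lemma cartan_bracket H x (a : weight (cartan T)) : H \in cartan T -> x \in rootspace a ->
  exists k : F, bracket H x = k *: x.
Proof.
by move=> hH /rootspaceP/(_ (Subvs hH)) /= e; exists (a (Subvs hH)).
Qed.

Lemma cartan_commute H H' : H \in cartan T -> H' \in cartan T -> bracket H H' = 0.
Proof.
move=> hH; rewrite -cartan_centralizer => /rootspaceP/(_ (Subvs hH)) /= ->.
by rewrite lfunE /= scale0r.
Qed.

End RootSpaces.

Section WeightBasis.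
Variables (F : numClosedFieldType) (L : lieType F) (T : tridec L) (n : nat).
Variable v : {linear L -> 'M[F]_n.+1}.
Hypothesis v_bracket : forall x y, v (bracket x y) = commx (v x) (v y).
Hypothesis v_irr : forall u w : 'rV_n.+1, u != 0 -> exists x, u *m v x = w.

Definition weight_vector (u : 'rV[F]_n.+1) : Prop :=
  forall H, H \in cartan T -> (u *m v H <= u)%MS.

Lemma weight_vector_neq0 : exists2 u, u != 0 & weight_vector u.
Proof.
pose As := [seq v H | H <- vbasis (cartan T)].
have [|u u0 hu] := @common_eigenvector F n.+1 As isT.
  move=> _ _ /mapP[H hH ->] /mapP[H' hH' ->]; apply/eqP; rewrite -subr_eq0.
  rewrite -[_ - _]/(commx _ _) -v_bracket.
  by rewrite (cartan_commute (vbasis_mem hH) (vbasis_mem hH')) raddf0.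
exists u => // H /coord_vbasis ->; rewrite linear_sum mulmx_sumr summx_sub // => i _.
rewrite linearZ /= -scalemxAr scalemx_sub //; move/allP: hu; apply.
by apply: map_f; apply: mem_nth; rewrite size_tuple.
Qed.

(** Any vector has the form u v(x) for a fixed weight vector u; splitting x into root vectors splits
    it into weight vectors. *)
Lemma weight_vector_spanning w : exists s : seq 'rV_n.+1,
  (forall u, u \in s -> weight_vector u) /\ w = \sum_(u <- s) u.
Proof.
have [u u0 hu] := weight_vector_neq0; have [x <-] := v_irr w u0.
elim/(rootspace_ind (T := T)) : x => [|x y [s [hs es]] [t [ht et]]|a x _ hx].
- by exists [::]; rewrite raddf0 mulmx0 big_nil.
- exists (s ++ t); rewrite big_cat -es -et raddfD mulmxDr; split=> // z.
  by rewrite mem_cat => /orP[/hs|/ht].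
exists [:: u *m v x]; rewrite big_seq1; split=> // z; rewrite inE => /eqP -> H hH.
have [k ek] := cartan_bracket hH hx; have /sub_rVP[l el] := hu H hH.
have -> : u *m v x *m v H = (l - k) *: (u *m v x).
  have := congr1 (fun z => u *m v z) ek; rewrite v_bracket linearZ /= /commx mulmxBr -scalemxAr.
  rewrite !mulmxA el -scalemxAl => e.
  by rewrite scalerBl -e opprB addrC subrK.
exact: scalemx_sub.
Qed.

Lemma weight_basis : exists2 P : 'M[F]_n.+1, P \in unitmx &
  forall H, H \in cartan T -> forall p q, p != q -> (P *m v H *m invmx P) p q = 0.
Proof.
have [f hf] := choice weight_vector_spanning.
(* Weight vectors whose sums give all standard basis vectors; [P] selects a basis among them as its
   rows. *)
pose s := flatten [seq f (delta_mx 0 i) | i <- enum 'I_n.+1].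
have hs u : u \in s -> weight_vector u.
  by move=> /flattenP[_ /mapP[i _ ->]]; apply: (hf _).1.
pose A := \matrix_(i < size s) s`_i.
have sA (u : 'rV_n.+1) : u \in s -> (u <= A)%MS.
  move=> us; have := us; rewrite -index_mem => lt.
  by rewrite -[u](nth_index 0 us) -[nth _ _ _](rowK (fun i : 'I_(size s) => s`_i) (Ordinal lt)) row_sub.
have fA : row_full A.
  rewrite -sub1mx; apply/row_subP => i; rewrite row1 (hf (delta_mx 0 i)).2 big_seq summx_sub // => u hu.
  by apply: sA; apply/flattenP; exists (f (delta_mx 0 i)) => //; rewrite map_f // mem_enum.
exists (rowsub (fullrankfun fA) A) => [|H hH p q pq]; first exact: fullrowsub_unit.
set P := rowsub _ _.
have Pu : P \in unitmx by exact: fullrowsub_unit.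
have rP : row p P = s`_(fullrankfun fA p) by rewrite row_rowsub rowK.
have /hs/(_ H hH) : s`_(fullrankfun fA p) \in s by rewrite mem_nth.
rewrite -rP => /sub_rVP[l el].
have -> : (P *m v H *m invmx P) p q = row p (P *m v H *m invmx P) 0 q by rewrite [RHS]mxE.
by rewrite !row_mul el -scalemxAl -row_mul mulmxV // row1 !mxE eqxx /= [q == p]eq_sym (negPf pq) mulr0.
Qed.

End WeightBasis.

(** * Conjugation of matrix realizations *)

Section MatrixConjugation.
Variables (F : fieldType) (n : nat).
Implicit Types P X Y : 'M[F]_n.+1.

Definition cjm P X := P *m X *m invmx P.

Lemma cjm_eq P X Y : P \in unitmx -> P *m X = Y *m P -> cjm P X = Y.
Proof. by move=> hP e; rewrite /cjm e mulmxK. Qed.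

Lemma cjm_comm P X Y : P \in unitmx -> cjm P (commx X Y) = commx (cjm P X) (cjm P Y).
Proof.
by move=> hP; rewrite /cjm /commx mulmxBr mulmxBl !mulmxA !(mulmxKV hP).
Qed.

Lemma cjmK P X : P \in unitmx -> cjm (invmx P) (cjm P X) = X.
Proof. by move=> hP; rewrite /cjm invmxK !mulmxA mulVmx // mul1mx mulmxKV. Qed.

Lemma cjmVK P X : P \in unitmx -> cjm P (cjm (invmx P) X) = X.
Proof. by move=> hP; rewrite -{1}[P]invmxK cjmK // unitmx_inv. Qed.

Lemma cjm_mul P Q X : P \in unitmx -> Q \in unitmx -> cjm Q (cjm P X) = cjm (Q *m P) X.
Proof.
move=> hP hQ; symmetry; apply: cjm_eq; first by rewrite unitmx_mul hQ.
by rewrite /cjm -!mulmxA mulKmx // mulVmx // mulmx1.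
Qed.

Lemma cjm_perm (s : 'S_n.+1) X : cjm (perm_mx s) X = \matrix_(p, q) X (s p) (s q).
Proof.
apply: cjm_eq; first exact: unitmx_perm.
have -> : \matrix_(p, q) X (s p) (s q) = row_perm s (col_perm s X).
  by apply/matrixP => p q; rewrite !mxE.
by rewrite row_permE col_permE -!mulmxA -perm_mxM mulVg perm_mx1 mulmx1.
Qed.

Lemma cjm_diag (d : 'rV[F]_n.+1) X : (forall p, d 0 p != 0) ->
  cjm (diag_mx d) X = \matrix_(p, q) (d 0 p * X p q / d 0 q).
Proof.
move=> d0; apply: cjm_eq.
  by rewrite unitmxE det_diag unitfE; apply/prodf_neq0 => p _.
by apply/matrixP => p q; rewrite mul_diag_mx mul_mx_diag !mxE mulfVK.
Qed.

End MatrixConjugation.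

Section Conjugate.
Variables (F : fieldType) (L : lieType F) (n : nat) (v : {linear L -> 'M[F]_n.+1}).
Variable P : 'M[F]_n.+1.

Definition conjrep (x : L) := cjm P (v x).

Lemma conjrep_linear : linear conjrep.
Proof.
by move=> a x y; rewrite /conjrep /cjm linearP mulmxDr mulmxDl -scalemxAr -scalemxAl.
Qed.

HB.instance Definition _ := GRing.isLinear.Build F L 'M[F]_n.+1 _ conjrep conjrep_linear.

Definition conj_rep : {linear L -> 'M[F]_n.+1} := conjrep.

Lemma conj_repE x : conj_rep x = cjm P (v x). Proof. by []. Qed.

End Conjugate.

Section MatrixRepresentation.
Variables (F : fieldType) (L : lieType F) (n : nat).
Implicit Types v : {linear L -> 'M[F]_n.+1}.

(** The last clause is stronger than irreducibility: a single element of L moves a given nonzero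
    vector to any prescribed one. It holds for the natural representations of sl and sp. *)
Definition matrix_rep v : Prop :=
  [/\ forall x y, v (bracket x y) = commx (v x) (v y), injective v &
   forall u w : 'rV_n.+1, u != 0 -> exists x, u *m v x = w].

Lemma conj_matrix_rep v P : P \in unitmx -> matrix_rep v -> matrix_rep (conj_rep v P).
Proof.
move=> hP [hb hi hr]; split=> [x y|x y /(congr1 (cjm (invmx P)))|u w u0].
- by rewrite /= /conjrep hb cjm_comm.
- by rewrite /= !cjmK // => /hi.
have [|x hx] := hr (u *m P) (w *m P).
  by apply: contra u0 => /eqP h; rewrite -[u](mulmxK hP) h mul0mx.
by exists x; rewrite /= /conjrep /cjm !mulmxA hx mulmxK.
Qed.

Lemma matrix_rep_entry v p q : matrix_rep v -> exists x, v x p q != 0.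
Proof.
case=> _ _ hr; have [|x hx] := hr (delta_mx 0 p) (delta_mx 0 q).
  by apply/eqP => /matrixP/(_ 0 p)/eqP; rewrite !mxE !eqxx oner_eq0.
exists x; have := congr1 (fun z : 'rV_n.+1 => z 0 q) hx.
by rewrite -rowE !mxE !eqxx => ->; exact: oner_neq0.
Qed.

End MatrixRepresentation.

Lemma sort_perm n (e : rel 'I_n) : transitive e -> (forall p q, p != q -> e p q || e q p) ->
  exists s : 'S_n, forall p q : 'I_n, (p < q)%N -> e (s p) (s q).
Proof.
move=> et etot; pose le p q := (p == q) || e p q.
have let_ : transitive le.
  move=> q p s /predU1P[->//|pq] /predU1P[<-|qs]; rewrite /le ?pq ?orbT //.
  by rewrite (et q) ?orbT.
have letot : total le.
  move=> p q; rewrite /le [q == p]eq_sym; case: eqVneq => //= pq; exact: etot.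
pose l := sort le (enum 'I_n).
have sl : size l = n by rewrite size_sort size_enum_ord.
have ul : uniq l by rewrite sort_uniq enum_uniq.
case: n e et etot @le let_ letot @l sl ul => [|n] e et etot le let_ letot l sl ul.
  by exists 1%g => -[].
pose f (p : 'I_n.+1) := nth ord0 l p.
have fi : injective f.
  by move=> p q /eqP; rewrite nth_uniq ?sl // => /eqP/val_inj.
exists (perm fi) => p q pq; rewrite !permE.
have := sorted_ltn_nth let_ ord0 (sort_sorted letot (enum 'I_n.+1)).
move=> /(_ p q); rewrite !inE -/l sl !ltn_ord => /(_ isT isT pq) /predU1P[/fi h|//].
by rewrite h ltnn in pq.
Qed.

(** * Weights and positive roots of a diagonal realization *)

Section DiagonalRealization.
Variables (F : fieldType) (L : lieType F) (T : tridec L) (n : nat).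
Variable v : {linear L -> 'M[F]_n.+1}.
Hypothesis v_rep : matrix_rep v.
Hypothesis v_diag : forall H, H \in cartan T -> forall p q, p != q -> v H p q = 0.
Local Notation h := (subvs_of (cartan T)).
Local Notation posroots := (posroots T).

Definition diag_entry (p : 'I_n.+1) (H : h) : F^o := v (vsval H) p p.

Fact diag_entry_linear p : linear (diag_entry p).
Proof. by move=> a H H'; rewrite /diag_entry !linearP !mxE. Qed.

HB.instance Definition _ p :=
  GRing.isLinear.Build F h F^o _ (diag_entry p) (diag_entry_linear p).

Definition mu (p : 'I_n.+1) : weight (cartan T) := linfun (diag_entry p).

Lemma muE p H : mu p H = v (vsval H) p p. Proof. by rewrite lfunE. Qed.

Lemma mul_diag_l H (Y : 'M_n.+1) p q : H \in cartan T -> (v H *m Y) p q = v H p p * Y p q.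
Proof.
move=> hH; rewrite mxE (bigD1 p) //= big1 ?addr0 // => s sp.
by rewrite v_diag ?mul0r // eq_sym.
Qed.

Lemma mul_diag_r H (Y : 'M_n.+1) p q : H \in cartan T -> (Y *m v H) p q = Y p q * v H q q.
Proof.
move=> hH; rewrite mxE (bigD1 q) //= big1 ?addr0 // => s sp.
by rewrite v_diag ?mulr0.
Qed.

Lemma bracket_entry H x p q : H \in cartan T ->
  v (bracket H x) p q = (v H p p - v H q q) * v x p q.
Proof.
move=> hH; have [-> _ _] := v_rep.
by rewrite /commx mxE [X in _ + X]mxE mul_diag_l // mul_diag_r // mulrBl [v x p q * _]mulrC.
Qed.

Lemma entry_weight a x p q : x \in rootspace a -> v x p q != 0 -> a = mu p - mu q.
Proof.
move=> /rootspaceP hx xpq; apply/lfunP => H.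
have := congr1 (fun z => v z p q) (hx H); rewrite bracket_entry ?subvsP // linearZ mxE /=.
by move/(mulIf xpq) => <-; rewrite !lfunE /= opp_lfunE !lfunE.
Qed.

Lemma mem_rootspace a x : (forall p q, v x p q != 0 -> mu p - mu q = a) -> x \in rootspace a.
Proof.
have [_ vi _] := v_rep; move=> hx; apply/rootspaceP => H; apply: vi; apply/matrixP => p q.
rewrite bracket_entry ?subvsP // linearZ mxE /=; have [->|/hx <-] := eqVneq (v x p q) 0.
  by rewrite !mulr0.
by rewrite !lfunE /= opp_lfunE !lfunE.
Qed.

Lemma diag_cartan x : (forall p q, p != q -> v x p q = 0) -> x \in cartan T.
Proof.
move=> hx; rewrite -cartan_centralizer; apply: mem_rootspace => p q.
by have [->|/hx -> /eqP //] := eqVneq p q; rewrite subrr.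
Qed.

(** Some x has a nonzero entry (p, q), hence so has one of its root components, whose weight is then
    forced. *)
Lemma weight_pair p q : is_weight (mu p - mu q) /\
  exists2 x, x \in rootspace (mu p - mu q) & v x p q != 0.
Proof.
have [x hx] := matrix_rep_entry p q v_rep.
elim/(rootspace_ind (T := T)) : x hx => [|x y hx hy|a x ha hx xpq].
- by rewrite raddf0 mxE eqxx.
- rewrite raddfD mxE; have [e|/hx //] := eqVneq (v x p q) 0.
  by rewrite e add0r.
by rewrite -(entry_weight hx xpq); split=> //; exists x.
Qed.

(** Positivity of mu p - mu q is a strict total order on indices: one of a nonzero weight and its
    opposite is positive, and transitivity is closure of the positive system, the sum being again a
    weight with a nonzero root space. *)
Lemma weight_order : injective mu -> exists s : 'S_n.+1,
  forall p q : 'I_n.+1, (p < q)%N -> mu (s p) - mu (s q) \in posroots.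
Proof.
move=> mi; pose e : rel 'I_n.+1 := fun p q => mu p - mu q \in posroots.
apply: (sort_perm (e := e)) => [q p s pq qs|p q pq]; last first.
  have [+ _] := weight_pair p q; rewrite /is_weight subr_eq0 opprB.
  by rewrite (inj_eq mi) (negPf pq).
rewrite /e -[mu p](subrK (mu q)) -addrA; apply: posroots_add => //.
rewrite addrA subrK; have [_ [x hx xps]] := weight_pair p s.
by apply: contra xps => /eqP hz; move: hx; rewrite hz memv0 => /eqP ->; rewrite raddf0 mxE.
Qed.

Hypothesis mu_ord : forall p q : 'I_n.+1, (p < q)%N -> mu p - mu q \in posroots.

Lemma posroot_lt a x p q : a \in posroots -> x \in rootspace a -> v x p q != 0 -> (p < q)%N.
Proof.
move=> ha hx xpq; have ea := entry_weight hx xpq; rewrite ltnNge leq_eqVlt; apply/negP.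
case/predU1P=> [/val_inj qp|qp].
  by have [] := posroots_root ha; rewrite ea qp subrr eqxx.
by have := posroots_opp ha; rewrite ea opprB mu_ord.
Qed.

Lemma nplus_upper x : x \in nplus T -> forall p q : 'I_n.+1, (q <= p)%N -> v x p q = 0.
Proof.
move=> hx p q qp; apply: (big_space_ind (P := fun x => v x p q = 0)) hx.
- by rewrite raddf0 mxE.
- by move=> y z hy hz; rewrite raddfD mxE hy hz addr0.
move=> a y ha hy; apply/eqP; apply: contraLR qp; rewrite -ltnNge => ypq; exact: posroot_lt ha hy ypq.
Qed.

Lemma nminus_lower x : x \in nminus T -> forall p q : 'I_n.+1, (p <= q)%N -> v x p q = 0.
Proof.
move=> hx p q pq; apply: (big_space_ind (P := fun x => v x p q = 0)) hx.
- by rewrite raddf0 mxE.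
- by move=> y z hy hz; rewrite raddfD mxE hy hz addr0.
move=> a y ha hy; apply/eqP; apply: contraLR pq; rewrite -ltnNge => ypq.
have ea : a = mu q - mu p by rewrite -(opprB (mu p)) -(entry_weight hy ypq) opprK.
rewrite ltnNge leq_eqVlt; apply/negP; case/predU1P=> [/val_inj qp|qp].
  by have [] := posroots_root ha; rewrite ea qp subrr eqxx.
by have := posroots_opp ha; rewrite ea opprB mu_ord.
Qed.

Lemma posroot_pair a : a \in posroots ->
  exists2 pq : 'I_n.+1 * 'I_n.+1, (pq.1 < pq.2)%N & a = mu pq.1 - mu pq.2.
Proof.
move=> ha; have [_ a0] := posroots_root ha; have [_ vi _] := v_rep.
pose x := vpick (rootspace a); have hx : x \in rootspace a by exact: memv_pick.
have x0 : v x != 0 by rewrite -(raddf0 v) (inj_eq vi) vpick0.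
have /existsP[p /existsP[q xpq]] : [exists p, [exists q, v x p q != 0]].
  move: x0; apply: contraNT; rewrite negb_exists => /forallP h0.
  by apply/eqP/matrixP => p q; rewrite mxE; have := h0 p; rewrite negb_exists => /forallP/(_ q); rewrite negbK => /eqP.
by exists (p, q); [exact: posroot_lt ha hx xpq | exact: entry_weight hx xpq].
Qed.

(** [R] is a set of pairs that represents every positive root exactly once: all pairs p < q for sl,
    about half of them for sp. *)
Lemma sum_posroots (R : pred ('I_n.+1 * 'I_n.+1)) H :
  (forall pq, R pq -> (pq.1 < pq.2)%N) ->
  (forall pq : 'I_n.+1 * 'I_n.+1, (pq.1 < pq.2)%N ->
    exists2 st, R st & mu pq.1 - mu pq.2 = mu st.1 - mu st.2) ->
  {in R &, injective (fun pq => mu pq.1 - mu pq.2)} ->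
  (\sum_(a <- posroots) a) H = \sum_(pq | R pq) (v (vsval H) pq.1 pq.1 - v (vsval H) pq.2 pq.2).
Proof.
move=> R1 R2 R3.
have /(perm_big _) -> : perm_eq posroots [seq mu pq.1 - mu pq.2 | pq <- enum R].
  apply: uniq_perm; first exact: posroots_uniq.
    by rewrite map_inj_in_uniq ?enum_uniq // => x y; rewrite !mem_enum; exact: R3.
  move=> a; apply/idP/mapP => [/posroot_pair[pq /R2[st Rst e] ->]|[pq]].
    by exists st => //; rewrite mem_enum.
  by rewrite mem_enum => /R1/mu_ord hpq ->.
rewrite big_map sum_lfunE big_enum; apply: eq_bigr => pq _.
by rewrite !lfunE /= opp_lfunE !lfunE.
Qed.

Lemma mu_regular p q : p != q ->
  exists2 H, H \in cartan T & v H p p != v H q q.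
Proof.
move=> pq; apply: contrapT => h0.
have e0 : mu p - mu q = 0.
  apply/lfunP => H; rewrite !lfunE /= opp_lfunE !lfunE; apply/eqP; rewrite subr_eq0.
  by apply: contraT => hH; case: h0; exists (vsval H); rewrite ?subvsP.
have := mu_ord; case: (ltngtP p q) pq => [pq _|qp _|/val_inj ->]; last by rewrite eqxx.
  by move=> /(_ _ _ pq)/posroots_root[]; rewrite e0 eqxx.
by move=> /(_ _ _ qp)/posroots_root[]; rewrite -(opprB (mu p)) e0 oppr0 eqxx.
Qed.

End DiagonalRealization.

Lemma lift_linear (F : fieldType) (V W : vectType F) (v : {linear V -> W}) (f : {linear W -> W}) :
  injective v -> (forall Y, exists x, v x = f Y) -> exists g : {linear W -> V}, forall Y, v (g Y) = f Y.
Proof.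
move=> vi vf; pose g := ((linfun v)^-1 \o linfun f)%VF.
exists g => Y; rewrite /= comp_lfunE [linfun f Y]lfunE; have [x ex] := vf Y.
rewrite -[LHS](lfunE v) limg_lfunVK //; rewrite -ex -[v x](lfunE v).
by apply: memv_img; exact: memvf.
Qed.

Section OrdinalSums.
Variables (R : pzRingType) (n : nat).

Lemma sum_gt_ord (p : 'I_n.+1) : \sum_(q < n.+1 | (p < q)%N) 1 = (n - p)%:R :> R.
Proof.
rewrite (reindex_inj rev_ord_inj) /= (eq_bigl (fun q : 'I_n.+1 => (q < n - p)%N)) => [|q].
  have le : (n - p <= n.+1)%N by lia.
  by rewrite -(big_ord_widen n.+1 (fun=> 1) le) sumr_const card_ord.
by have := ltn_ord q; have := ltn_ord p; rewrite subSS; lia.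
Qed.

Lemma sum_lt_ord (p : 'I_n.+1) : \sum_(q < n.+1 | (q < p)%N) 1 = p%:R :> R.
Proof. by rewrite (sum_ord_lt p (fun=> 1)) sumr_const card_ord. Qed.

Lemma sum_pair_diff (f : 'I_n.+1 -> R) :
  \sum_(pq : 'I_n.+1 * 'I_n.+1 | (pq.1 < pq.2)%N) (f pq.1 - f pq.2) =
  \sum_(p < n.+1) ((n - p)%:R * f p - p%:R * f p).
Proof.
rewrite sumrB [RHS]sumrB; congr (_ - _).
  rewrite -(pair_big_dep xpredT (fun p q : 'I_n.+1 => (p < q)%N) (fun p _ => f p)) /=.
  by apply: eq_bigr => p _; rewrite -sum_gt_ord mulr_suml; apply: eq_bigr => q _; rewrite mul1r.
rewrite -(pair_big_dep xpredT (fun p q : 'I_n.+1 => (p < q)%N) (fun _ q => f q)) /=.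
rewrite (exchange_big_dep xpredT) //=; apply: eq_bigr => q _.
by rewrite -sum_lt_ord mulr_suml; apply: eq_bigr => p _; rewrite mul1r.
Qed.

End OrdinalSums.

Section Trace.
Variables (F : numFieldType) (n : nat).

Lemma sum_trk (A : 'M[F]_n.+1) K : (K <= n)%N ->
  \sum_(k < K) trk k A = \sum_(p < n.+1) (K - p)%:R * A p p.
Proof.
move=> Kn; rewrite /trk (exchange_big_dep xpredT) //=; apply: eq_bigr => p _.
rewrite (eq_bigr (fun=> 1%N%:R * A p p)) => [|k _]; last by rewrite mul1r.
rewrite -mulr_suml -natr_sum; congr (_%:R * _).
elim: K {Kn} => [|K IH]; first by rewrite big_ord0.
by rewrite big_mkcond big_ord_recr -big_mkcond /= IH; case: leqP => ?; lia.
Qed.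

End Trace.

Definition ordered_rep (F : fieldType) (L : lieType F) (T : tridec L) n
    (v : {linear L -> 'M[F]_n.+1}) : Prop :=
  (forall H, H \in cartan T -> forall p q, p != q -> v H p q = 0) /\
  (forall p q : 'I_n.+1, (p < q)%N -> mu T v p - mu T v q \in posroots T).

(** The Cartan subalgebra is diagonalized, then the basis is permuted so that the weights decrease.
    The diagonalizing matrix is not known beforehand, so injectivity of the weights is asked of
    every conjugate. *)
Lemma ordered_conj (F : numClosedFieldType) (L : lieType F) (T : tridec L) n
    (v : {linear L -> 'M[F]_n.+1}) : matrix_rep v ->
  (forall P, P \in unitmx ->
    (forall H, H \in cartan T -> forall p q, p != q -> conj_rep v P H p q = 0) ->
    injective (mu T (conj_rep v P))) ->
  exists2 P, P \in unitmx & ordered_rep T (conj_rep v P).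
Proof.
move=> vr vi; have [vb _ virr] := vr; have [P hP hd] := weight_basis T vb virr.
have [s hs] := weight_order (conj_matrix_rep hP vr) hd (vi P hP hd).
have sE x p q : conj_rep v (perm_mx s *m P) x p q = conj_rep v P x (s p) (s q).
  by rewrite conj_repE -cjm_mul ?unitmx_perm // cjm_perm mxE.
exists (perm_mx s *m P); first by rewrite unitmx_mul unitmx_perm.
split=> [H hH p q pq|p q pq]; first by rewrite sE; apply: hd; rewrite ?(inj_eq perm_inj).
suff mE p' : mu T (conj_rep v (perm_mx s *m P)) p' = mu T (conj_rep v P) (s p').
  by rewrite !mE hs.
by apply/lfunP => H; rewrite !muE sE.
Qed.

(** * Realization of sl *)

Lemma bool_diff1 (F : numDomainType) (a b : bool) : a%:R - b%:R = 1 :> F -> a.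
Proof.
case: a => //; rewrite sub0r => h.
have : (b%:R + 1 : F) == 0 by rewrite -[X in _ + X]h addrN.
by rewrite natr1 pnatr_eq0.
Qed.

Section SpecialLinearRealization.
Variables (F : numClosedFieldType) (n : nat).
Local Notation N := n.+2.
Local Notation L := (sl F N).
Variable T : tridec L.
Implicit Types v : {linear L -> 'M[F]_N}.

Definition traceless_rep v := forall Y, (exists x, v x = Y) <-> \tr Y = 0.

Lemma conj_traceless v P : P \in unitmx -> traceless_rep v -> traceless_rep (conj_rep v P).
Proof.
move=> hP hv Y; have trc Q Z : Q \in unitmx -> \tr (cjm Q Z) = \tr Z :> F.
  by move=> hQ; rewrite /cjm mxtrace_mulC mulmxA mulVmx // mul1mx.
split=> [[x <-]|tY]; first by rewrite /= /conjrep trc //; apply/hv; exists x.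
have [_ /(_ _)[|x hx]] := hv (cjm (invmx P) Y); first by rewrite trc ?unitmx_inv.
by exists x; rewrite /= /conjrep hx cjmVK.
Qed.

Definition sl_val : {linear L -> 'M[F]_N} := @vsval _ _ (sl_space F N).

Lemma sl_val_traceless : traceless_rep sl_val.
Proof.
move=> Y; split=> [[x <-]|tY]; first by apply/eqP; rewrite -sl_spaceE subvsP.
by have hY : Y \in sl_space F N; [rewrite sl_spaceE tY | exists (Subvs hY)].
Qed.

Lemma sl_val_rep : matrix_rep sl_val.
Proof.
split=> // [x y|u w u0]; first exact: val_inj.
have [t ut] : exists t : 'cV_N, u *m t = 1%:M by apply/row_freeP; rewrite /row_free rank_rV u0.
have trN : \tr (1%:M - t *m u) = n.+1%:R.
  by rewrite linearB /= mxtrace_mulC ut !mxtrace1 -natrB.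
(* t w sends u to w, and 1 - t u is killed by u on the left; a multiple of it corrects the trace. *)
pose X := t *m w - (\tr (t *m w) / n.+1%:R) *: (1%:M - t *m u).
have [_ /(_ _)[|x hx]] := sl_val_traceless X.
  by rewrite linearB linearZ /= trN divfK ?subrr // pnatr_eq0.
exists x; rewrite hx mulmxBr mulmxA ut mul1mx -scalemxAr mulmxBr mulmxA ut mul1mx mulmx1.
by rewrite subrr scaler0 subr0.
Qed.

(** If two weights agree, E_pq commutes with the Cartan subalgebra and so belongs to it, but it is
    not diagonal. *)
Lemma sl_mu_inj v : matrix_rep v -> traceless_rep v ->
  (forall H, H \in cartan T -> forall p q, p != q -> v H p q = 0) -> injective (mu T v).
Proof.
move=> vr vt vd p q e; apply/eqP; apply: contraT => pq.
have [_ /(_ _)[|x hx]] := vt (delta_mx p q).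
  rewrite /mxtrace big1 // => i _; rewrite mxE; case: eqP => // ->; by rewrite (negPf pq).
have xc : x \in cartan T.
  rewrite -cartan_centralizer; apply: (mem_rootspace vr vd) => s t.
  rewrite hx mxE; case: andP => [[/eqP -> /eqP ->] _|_ /eqP //].
  by rewrite e subrr.
by have := vd x xc p q pq; rewrite hx mxE !eqxx => /eqP; rewrite oner_eq0.
Qed.

Lemma sl_ordered_rep : exists v, [/\ matrix_rep v, traceless_rep v & ordered_rep T v].
Proof.
have [|P hP ho] := @ordered_conj _ _ T _ _ sl_val_rep.
  move=> P hP; exact: sl_mu_inj (conj_matrix_rep hP sl_val_rep) (conj_traceless hP sl_val_traceless).
exists (conj_rep sl_val P); split=> //; first exact: conj_matrix_rep hP sl_val_rep.
exact: conj_traceless hP sl_val_traceless.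
Qed.

Section Ordered.
Variable v : {linear L -> 'M[F]_N}.
Hypotheses (v_rep : matrix_rep v) (v_tr : traceless_rep v) (v_ord : ordered_rep T v).

Let f (Y : 'M[F]_N) : 'M[F]_N := Y - (\tr Y / N%:R) *: 1%:M.

Let f_linear : linear f.
Proof.
move=> a Y Z; rewrite /f linearP /= mulrDl scalerDl opprD -mulrA -scalerA scalerBr.
by rewrite addrACA.
Qed.

Lemma sl_proj : exists g : {linear 'M[F]_N -> L}, forall Y, v (g Y) = Y - (\tr Y / N%:R) *: 1%:M.
Proof.
have [_ vi _] := v_rep.
pose fl : {linear 'M[F]_N -> 'M[F]_N} := HB.pack f (GRing.isLinear.Build _ _ _ _ _ f_linear).
apply: (@lift_linear _ _ _ v fl vi) => Y; apply/v_tr.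
by rewrite /= /f linearB linearZ /= mxtrace1 divfK ?subrr // pnatr_eq0.
Qed.

Lemma sl_diff_inj (p q s t : 'I_N) : p != q -> s != t ->
  mu T v p - mu T v q = mu T v s - mu T v t -> p = s /\ q = t.
Proof.
have [vd _] := v_ord; move=> pq st e.
(* The equality of roots is tested on the traceless diagonal matrix E_kk - 1/N. *)
have dg (k : 'I_N) : (p == k)%:R - (q == k)%:R = (s == k)%:R - (t == k)%:R :> F.
  have [_ /(_ _)[|x hx]] := v_tr (delta_mx k k - N%:R^-1 *: 1%:M).
    rewrite linearB linearZ /= mxtrace1 mulVf ?pnatr_eq0 // /mxtrace (bigD1 k) //= mxE !eqxx.
    by rewrite big1 ?addr0 ?subrr // => i /negPf ik; rewrite mxE ik.
  have xE i j : v x i j = (i == k)%:R *+ (i == j) - N%:R^-1 *+ (i == j).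
    rewrite hx !mxE mulr_natr; case: (eqVneq i j) => [->|ij]; first by rewrite andbb.
    by rewrite !mulr0n; case: (eqVneq i k) => // ik; rewrite -ik eq_sym (negPf ij).
  have xc : x \in cartan T.
    by apply: (diag_cartan v_rep vd) => i j ij; rewrite xE (negPf ij) !mulr0n subrr.
  have := congr1 (fun a : weight (cartan T) => a (Subvs xc)) e.
  rewrite !lfunE /= !opp_lfunE !muE /= !xE !eqxx !mulr1n.
  by rewrite !opprB !addrA !subrK.
have := dg q; have := dg p; rewrite !eqxx (negPf pq) eq_sym (negPf pq) subr0 sub0r.
move=> /esym/bool_diff1/eqP -> /(congr1 -%R); rewrite opprK opprB => /esym/bool_diff1/eqP -> //.
Qed.

(** The sum of positive roots has coefficient n+1-2p at place p, twice the sum of [trk] has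
    2(n+1-p); they differ by a multiple of the trace, which is 0. *)
Lemma sl_rho (H : subvs_of (cartan T)) :
  (rho T H : F) = \sum_(k < n.+1) trk k (v (vsval H)).
Proof.
have [vd vo] := v_ord; set A := v (vsval H).
have trA : \tr A = 0 by apply/v_tr; exists (vsval H).
rewrite /rho lfunE /= (sum_posroots v_rep vd vo (R := fun pq => (pq.1 < pq.2)%N)) //; first last.
- move=> [p q] [s t] pq st; have {}pq : (p < q)%N := pq; have {}st : (s < t)%N := st.
  by case/(sl_diff_inj (negbT (ltn_eqF pq)) (negbT (ltn_eqF st))) => -> ->.
- by move=> pq hpq; exists pq.
rewrite (sum_pair_diff (fun p => A p p)) (sum_trk A (leqnn n.+1)).
apply: (mulfI (_ : 2 != 0)); first by rewrite pnatr_eq0.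
rewrite mulVKf ?pnatr_eq0 // mulr_sumr; apply/eqP; rewrite -subr_eq0 -sumrB.
rewrite (eq_bigr (fun p => - n.+1%:R * A p p)) => [|p _]; last first.
  have -> : (n.+1 - p)%:R = n.+1%:R - p%:R :> F by rewrite natrB // -ltnS ltn_ord.
  by move: (n.+1%:R : F) (p%:R : F) => x y; ring.
by rewrite -mulr_sumr -/(\tr A) trA mulr0.
Qed.

End Ordered.

Lemma sl_realization : exists (ad : adapted T n.+1 (fun j => inord j : 'I_n.+1) 1) (kA : F),
  (forall p : 'I_N, rhoF ad (apr_proj ad (delta_mx p p)) = kA - p%:R) /\
  (forall p q : 'I_N, (q < p)%N -> apr ad (apr_proj ad (delta_mx q p)) q p = 1).
Proof.
have [v [vr vt vo]] := sl_ordered_rep; have [g hg] := sl_proj vr vt.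
have [vb vi virr] := vr; have [vd vord] := vo.
have tr_delta (p q : 'I_N) : \tr (delta_mx p q : 'M[F]_N) = (p == q)%:R.
  rewrite /mxtrace (bigD1 p) //= mxE eqxx /= big1 ?addr0 // => i /negPf ip.
  by rewrite mxE ip.
have inord_eq (j : 'I_n.+1) i : (inord j == i :> 'I_n.+1) = (j == i) by rewrite inord_val.
have inordD (j : 'I_n.+1) : (inord j == inord j.+1 :> 'I_N) = false.
  by have hj := ltn_ord j; apply/eqP => /(congr1 val) /=; rewrite !inordK; lia.
have /choice[e he] : forall i : 'I_n.+1, exists x,
    v x = \sum_(j < n.+1 | inord j == i :> 'I_n.+1) delta_mx (inord j) (inord j.+1).
  move=> i; apply/vt.
  by rewrite raddf_sum big1 // => j _; rewrite /= tr_delta inordD.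
have /choice[h hh] : forall i : 'I_n.+1, exists x,
    v x = \sum_(j < n.+1 | inord j == i :> 'I_n.+1)
      (delta_mx (inord j) (inord j) - delta_mx (inord j.+1) (inord j.+1)).
  move=> i; apply/vt.
  by rewrite raddf_sum big1 // => j _; rewrite /= raddfB /= !tr_delta !eqxx subrr.
have tr0 x : \tr (v x) = 0 by apply/vt; exists x.
have g1 x Y : g (commx (v x) Y) = bracket x (g Y).
  apply: vi; rewrite vb !hg /commx linearB /= mxtrace_mulC subrr mul0r scale0r subr0.
  by rewrite mulmxBr mulmxBl -scalemxAr -scalemxAl mulmx1 mul1mx opprB addrA subrK.
have g2 x : g (v x) = 1 *: x by apply: vi; rewrite hg tr0 mul0r scale0r subr0 scale1r.
have gE (p q s t : 'I_N) : s != t -> v (g (delta_mx p q)) s t = ((s == p) && (t == q))%:R.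
  by move=> st; rewrite hg !mxE (negPf st) mulr0 subr0.
have g3 p : g (delta_mx p p) \in cartan T.
  apply: (diag_cartan vr vd) => s t st; rewrite gE //; case: andP => // -[/eqP sp /eqP tp].
  by rewrite sp tp eqxx in st.
have gr (p q : 'I_N) : p != q -> g (delta_mx p q) \in rootspace (mu T v p - mu T v q).
  move=> pq; apply: (mem_rootspace vr vd) => s t; rewrite hg tr_delta (negPf pq) mul0r scale0r subr0 mxE.
  by case: andP => [[/eqP -> /eqP ->] //|_]; rewrite eqxx.
have g4 (p q : 'I_N) : (q < p)%N -> g (delta_mx q p) \in nplus T.
  move=> qp; have := gr q p (negbT (ltn_eqF qp)); apply/subvP: (g _).
  exact: (@big_space_sub _ _ _ _ (fun a => rootspace a) _ (vord _ _ qp)).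
have g5 (p q : 'I_N) : (p < q)%N -> g (delta_mx q p) \in nminus T.
  move=> pq; have := gr q p (negbT (gtn_eqF pq)); rewrite -(opprB (mu T v p)); apply/subvP: (g _).
  exact: (@big_space_sub _ _ _ _ (fun a => rootspace (- a)) _ (vord _ _ pq)).
have len i : 1 * #|[pred j : 'I_n.+1 | inord j == i :> 'I_n.+1]|%:R = 1 :> F.
  by rewrite mul1r (eq_card (inord_eq^~ i)) card1.
have hmax (p q : nat) : (p <= q)%N -> (q < n.+1)%N ->
    v (h (inord q)) (inord p) (inord p) <= v (h (inord q)) (inord q) (inord q).
  move=> pq qn; have vh (k : nat) : (k <= q)%N -> v (h (inord q)) (inord k) (inord k) = (k == q)%:R.
    move=> kq; rewrite hh (big_pred1 (inord q)) => [|j]; last by rewrite /= inord_eq.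
    rewrite !mxE -!val_eqE /= !inordK ?ltnS; try lia.
    by rewrite !andbb (@ltn_eqF k q.+1) ?subr0.
  by rewrite !vh // eqxx ler_nat leq_b1.
unshelve eexists (@Adapted F L T n.+1 n.+1 (fun j => inord j) 1 v vb vi vd
  (nplus_upper vr vd vord) (nminus_lower vr vd vord) (sl_rho vr vt vo)
  (leqnn _) (@inord_val _) _ _ e he h hh (fun=> 1) len ltr01
  (mu_regular vord) hmax g g1 1 (oner_neq0 _) g2 g3 g4 g5).
- by move=> x j jn; rewrite /psk inordK.
- by move=> x j _ jn; rewrite /alk inordK.
(* [kA] absorbs the contribution of the scalar matrix that the projection subtracts. *)
exists (n.+1%:R - N%:R^-1 * \sum_(k < N) (n.+1 - k)%:R); split=> /= [p|p q qp]; last first.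
  by rewrite gE ?eqxx // -val_eqE /= (ltn_eqF qp).
rewrite /rhoF /= sum_trk // (eq_bigr (fun q : 'I_N => (n.+1 - q)%:R * (q == p)%:R
    - N%:R^-1 * (n.+1 - q)%:R)) => [|q _]; last first.
  by rewrite hg tr_delta eqxx !mxE eqxx andbb mulrBr mulr1 mul1r [_ * N%:R^-1]mulrC.
rewrite sumrB -mulr_sumr (bigD1 p) //= eqxx big1 ?addr0 => [|q /negPf ->]; last by rewrite mulr0.
by rewrite mulr1 addrAC natrB // -ltnS.
Qed.

End SpecialLinearRealization.

(** * Realization of sp *)

Lemma decreasing_rev n (f : 'I_n.+1 -> 'I_n.+1) :
  (forall p q : 'I_n.+1, (p < q)%N -> (f q < f p)%N) -> forall p, f p = rev_ord p.
Proof.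
move=> fd.
(* Strict decrease gives only g p <= n - p; the opposite bound is the same statement for the
   conjugate of f by the reversal. *)
have le (g : 'I_n.+1 -> 'I_n.+1) : (forall p q : 'I_n.+1, (p < q)%N -> (g q < g p)%N) ->
    forall (k : nat) (p : 'I_n.+1), k = p -> (g p <= n - k)%N.
  move=> gd; elim=> [p kp|k IH p kp]; first by rewrite subn0 -ltnS ltn_ord.
  have kn : (k < n.+1)%N by rewrite ltnW // kp ltn_ord.
  have := IH (Ordinal kn) erefl; have := gd (Ordinal kn) p; rewrite /= -kp ltnSn => /(_ isT); lia.
pose g p := rev_ord (f (rev_ord p)) : 'I_n.+1.
have gd (p q : 'I_n.+1) : (p < q)%N -> (g q < g p)%N.
  move=> pq; have := fd (rev_ord q) (rev_ord p); rewrite /= => h.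
  have := ltn_ord (f (rev_ord p)); have := ltn_ord (f (rev_ord q)); have := ltn_ord q; lia.
move=> p; apply: val_inj => /=; have := le f fd p p erefl; have := le g gd (n - p)%N (rev_ord p).
rewrite /g rev_ordK /= subSS => /(_ erefl); have := ltn_ord p; have := ltn_ord (f p); lia.
Qed.

Section SymplecticForm.
Variables (F : numFieldType) (L : lieType F) (T : tridec L) (n : nat).
Implicit Types (v : {linear L -> 'M[F]_n.+1}) (P Q Y S : 'M[F]_n.+1).

(* The image of [v] is the Lie algebra of the form with matrix [invmx Q]. *)
Definition form_rep v Q : Prop := [/\ Q \in unitmx, Q^T = - Q &
  forall Y, (exists x, v x = Y) <-> (Y *m Q)^T = Y *m Q].

Lemma conj_form v P Q : P \in unitmx -> form_rep v Q ->
  form_rep (conj_rep v P) (P *m Q *m P^T).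
Proof.
move=> hP [hQ aQ hv]; split; first by rewrite !unitmx_mul hP hQ unitmx_tr.
  by rewrite !trmx_mul trmxK aQ mulNmx mulmxN mulmxA.
have sE Z : cjm P Z *m (P *m Q *m P^T) = P *m (Z *m Q) *m P^T.
  by rewrite /cjm !mulmxA mulmxKV.
move=> Y; split=> [[x <-]|sY].
  have hx : (v x *m Q)^T = v x *m Q by apply/hv; exists x.
  by rewrite conj_repE sE -{2}hx !trmx_mul trmxK !mulmxA.
have [_ /(_ _)[|x hx]] := hv (cjm (invmx P) Y); last by exists x; rewrite conj_repE hx cjmVK.
have hP' : P^T \in unitmx by rewrite unitmx_tr.
apply/(can_inj (mulKmx hP))/(can_inj (mulmxK hP')).
by rewrite -sE cjmVK // -sY -{2}(cjmVK Y hP) sE !trmx_mul trmxK -!mulmxA.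
Qed.

Lemma form_irr v Q : form_rep v Q -> forall u w : 'rV_n.+1, u != 0 -> exists x, u *m v x = w.
Proof.
move=> [hQ aQ hv] u w u0.
have [t ut] : exists t : 'cV_n.+1, u *m t = 1%:M by apply/row_freeP; rewrite /row_free rank_rV u0.
pose w' := w *m Q; pose k := (u *m w'^T) 0 0.
have uw : u *m w'^T = k%:M by rewrite [LHS]mx11_scalar.
(* A symmetric matrix with u S = w Q: the first term does the work, the second makes S symmetric,
   and the third cancels what the second adds to u S. *)
pose S := t *m w' + w'^T *m t^T - k *: (t *m t^T).
have [_ /(_ _)[|x hx]] := hv (S *m invmx Q).
  rewrite mulmxKV // /S linearB linearD linearZ /= !trmx_mul !trmxK.
  by rewrite [X in X - _ = _]addrC.
exists x; rewrite hx mulmxA /S mulmxBr mulmxDr !mulmxA ut mul1mx uw mul_scalar_mx -scalemxAr.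
by rewrite mulmxA ut mul1mx addrK mulmxK.
Qed.

Section Weights.
Variables (v : {linear L -> 'M[F]_n.+1}) (Q : 'M[F]_n.+1).
Hypotheses (v_rep : matrix_rep v) (v_form : form_rep v Q).
Hypothesis v_diag : forall H, H \in cartan T -> forall p q, p != q -> v H p q = 0.
Local Notation mu := (mu T v).

Lemma form_anticomm H : H \in cartan T -> v H *m Q = - (Q *m v H).
Proof.
move=> hH; have [_ aQ hv] := v_form.
have hs : (v H *m Q)^T = v H *m Q by apply/hv; exists H.
rewrite -[LHS]hs trmx_mul aQ mulNmx; congr (- (_ *m _)); apply/matrixP => p q.
by rewrite mxE; have [->//|pq] := eqVneq p q; rewrite !v_diag // 1?eq_sym.
Qed.

Lemma anticomm_mu (W : 'M[F]_n.+1) p q : (forall H, H \in cartan T -> v H *m W = - (W *m v H)) ->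
  W p q != 0 -> mu p = - mu q.
Proof.
move=> hW Wpq; apply/lfunP => H; rewrite opp_lfunE !muE.
have := congr1 (fun Z : 'M_n.+1 => Z p q) (hW _ (subvsP H)).
rewrite [RHS]mxE (mul_diag_l v_diag _ _ _ (subvsP H)) (mul_diag_r v_diag _ _ _ (subvsP H)).
by rewrite mulrC -mulrN => /(mulfI Wpq).
Qed.

Lemma form_mu p q : Q p q != 0 -> mu p = - mu q.
Proof. by apply: anticomm_mu => H hH; exact: form_anticomm. Qed.

Lemma invform_mu p q : invmx Q p q != 0 -> mu p = - mu q.
Proof.
have [hQ _ _] := v_form; apply: anticomm_mu => H hH; have := form_anticomm hH.
move=> /(congr1 (fun Z => invmx Q *m Z *m invmx Q)); rewrite mulmxN mulNmx !mulmxA mulVmx //.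
by rewrite mul1mx -!mulmxA mulmxV // mulmx1 => ->; rewrite opprK.
Qed.

Lemma form_row_neq0 (W : 'M[F]_n.+1) p : W \in unitmx -> exists q, W p q != 0.
Proof.
move=> hW; apply/existsP; apply: contraT; rewrite negb_exists => /forallP h0.
have : row p W *m invmx W = 0.
  rewrite (_ : row p W = 0) ?mul0mx //; apply/rowP => q; rewrite !mxE.
  by have := h0 q; rewrite negbK => /eqP.
rewrite -row_mul mulmxV // row1 => /rowP/(_ p)/eqP.
by rewrite !mxE !eqxx oner_eq0.
Qed.

Lemma antisym_diag (W : 'M[F]_n.+1) : W^T = - W -> forall p, W p p = 0.
Proof.
move=> aW p; have := congr1 (fun Z : 'M_n.+1 => Z p p) aW; rewrite !mxE => /eqP.
by rewrite -subr_eq0 opprK -mulr2n mulrn_eq0 => /eqP.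
Qed.

Lemma invform_antisym : (invmx Q)^T = - invmx Q.
Proof. by have [hQ aQ _] := v_form; rewrite trmx_inv aQ; exact: (invrN Q). Qed.

(** The matrix E_pq + E_qp is symmetric, hence of the form v(x) Q; the inverse of Q pairs only
    opposite weights, which gives the weight of x. *)
Lemma form_root p q : exists2 x, x \in rootspace (mu p + mu q) &
  v x *m Q = delta_mx p q + delta_mx q p.
Proof.
have [hQ aQ hv] := v_form.
have [_ /(_ _)[|x hx]] := hv ((delta_mx p q + delta_mx q p) *m invmx Q).
  by rewrite mulmxKV // linearD /= !trmx_delta addrC.
exists x; last by rewrite hx mulmxKV.
apply: (mem_rootspace v_rep v_diag) => s t; rewrite hx mxE => st.
have /existsP[k] : [exists k, (delta_mx p q + delta_mx q p : 'M[F]_n.+1) s k * invmx Q k t != 0].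
  move: st; apply: contraNT; rewrite negb_exists => /forallP h0.
  by rewrite big1 // => k _; apply/eqP; rewrite -[_ == _]negbK.
rewrite mulf_eq0 negb_or => /andP[+ /invform_mu ek]; rewrite !mxE.
have -> : mu t = - mu k by rewrite ek opprK.
rewrite opprK; case: andP => [[/eqP -> /eqP ->] _ //|_].
by case: andP => [[/eqP -> /eqP ->] _|_]; [rewrite addrC | rewrite addr0 eqxx].
Qed.

Lemma form_root0 p q : mu p + mu q = 0 -> exists2 x, x \in cartan T &
  v x *m Q = delta_mx p q + delta_mx q p.
Proof. by move=> e; have [x] := form_root p q; rewrite e cartan_centralizer; exists x. Qed.

(** If mu p = 0, the element x with v(x) Q = 2 E_pp lies in the Cartan subalgebra. But row p of the
    antisymmetric inverse of Q has a nonzero entry off the diagonal, and so has v(x). *)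
Lemma form_mu_neq0 p : mu p != 0.
Proof.
apply/eqP => p0; have [hQ aQ _] := v_form.
have [|x xc hx] := @form_root0 p p; first by rewrite p0 addr0.
have [t ht] : exists t, invmx Q p t != 0 by apply: form_row_neq0; rewrite unitmx_inv.
have pt : p != t by apply: contraNneq ht => <-; rewrite antisym_diag // invform_antisym.
have := v_diag xc pt; rewrite -[v x](mulmxK hQ) hx mxE (bigD1 p) //= !mxE !eqxx /=.
rewrite big1 ?addr0 => [/eqP|k kp]; last by rewrite !mxE (negPf kp) andbF addr0 mul0r.
by rewrite mulf_eq0 (negPf ht) orbF -natrD pnatr_eq0.
Qed.

(** Let Q pair q with s. If mu p = mu q, the element attached to E_ps + E_sp lies in the Cartan
    subalgebra, yet its diagonal entry is 0 at q and nonzero at p. *)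
Lemma form_mu_inj : injective mu.
Proof.
move=> p q e; apply/eqP; apply: contraT => pq; have [hQ aQ _] := v_form.
have [s qs] := form_row_neq0 q hQ; have es := form_mu qs.
have [|x xc hx] := @form_root0 p s; first by rewrite e es addNr.
have ss W : v x *m Q = W -> forall i j, v x i i * Q i j = W i j.
  by move=> <- i j; rewrite (mul_diag_l v_diag _ _ _ xc).
have qs' : q != s by apply: contraNneq qs => <-; rewrite antisym_diag.
have ps : p != s.
  apply/eqP => ps; have /negP[] := form_mu_neq0 p.
  have ep : mu p = - mu p by rewrite {1}e es ps.
  apply/eqP/lfunP => H; have := congr1 (fun a : weight (cartan T) => a H) ep.
  rewrite opp_lfunE !muE => /eqP; rewrite -addr_eq0 -mulr2n mulrn_eq0 => /eqP ->.
  by rewrite lfunE.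
have q0 : v x q q = 0.
  have := ss _ hx q s; rewrite !mxE (negPf qs') [q == p]eq_sym (negPf pq) addr0 => /eqP.
  by rewrite mulf_eq0 (negPf qs) orbF => /eqP.
have := congr1 (fun a : weight (cartan T) => a (Subvs xc)) e; rewrite /= !muE /= q0 => p0.
have := ss _ hx p s; rewrite p0 mul0r !mxE !eqxx (negPf ps) addr0 => /eqP.
by rewrite eq_sym oner_eq0.
Qed.

Hypothesis mu_ord : forall p q : 'I_n.+1, (p < q)%N -> mu p - mu q \in posroots T.

(** Q pairs p with the index of weight - mu p, and negation reverses the order of the weights. *)
Lemma form_antidiag p q : (Q p q != 0) = (q == rev_ord p).
Proof.
have [hQ aQ _] := v_form; have muI := form_mu_inj.
have /fin_all_exists[f hf] : forall p, exists q, Q p q != 0 by move=> s; exact: form_row_neq0.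
have fE s t : (Q s t != 0) = (t == f s).
  apply/idP/eqP => [hst|-> //]; apply: muI; apply: oppr_inj.
  by rewrite -(form_mu hst) -(form_mu (hf s)).
rewrite fE; congr (_ == _); apply: decreasing_rev => s t st; rewrite ltnNge leq_eqVlt; apply/negP => /predU1P[/val_inj ft|ft].
  by move: st; rewrite (muI s t) ?ltnn // (form_mu (hf s)) ft -(form_mu (hf t)).
have := posroots_opp (mu_ord st); rewrite (form_mu (hf s)) (form_mu (hf t)) opprB opprK.
by rewrite addrC mu_ord.
Qed.

End Weights.
End SymplecticForm.

Lemma sign_rev (R : pzRingType) n (p : 'I_n.+1) : odd n ->
  (-1) ^+ (rev_ord p) = - (-1) ^+ p :> R.
Proof.
move=> no; rewrite -signr_odd -[in RHS]signr_odd /= subSS oddB ?no; last by rewrite -ltnS.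
by case: (odd p); rewrite ?opprK.
Qed.

Definition skew_mx (F : fieldType) n (Y : 'M[F]_n.+1) : Prop := forall p q : 'I_n.+1,
  Y p q = - ((-1) ^+ (p + q) * Y (rev_ord q) (rev_ord p)).

Definition skew_rep (F : fieldType) (L : lieType F) n (v : {linear L -> 'M[F]_n.+1}) : Prop :=
  forall Y, (exists x, v x = Y) <-> skew_mx Y.

Section Rescaling.
Variables (F : numFieldType) (L : lieType F) (T : tridec L) (n : nat).
Variables (v : {linear L -> 'M[F]_n.+1}) (Q : 'M[F]_n.+1).
Hypotheses (n_odd : odd n) (v_rep : matrix_rep v) (v_form : form_rep v Q).
Hypothesis v_ord : ordered_rep T v.

(** A diagonal rescaling turns the antidiagonal form into the one with entries (-1)^p, for which
    membership in the Lie algebra is the sign rule [skew_mx]. *)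
Lemma skew_ordered_rep : exists v' : {linear L -> 'M[F]_n.+1},
  [/\ matrix_rep v', skew_rep v' & ordered_rep T v'].
Proof.
have [vd vo] := v_ord; have [hQ aQ hv] := v_form.
have Qr p q : (Q p q != 0) = (q == rev_ord p) by exact: (form_antidiag v_rep v_form vd vo).
(* Only the first half of the basis is rescaled; antisymmetry of Q and oddness of n then give the
   right signs in the second half. *)
pose d : 'rV[F]_n.+1 := \row_p (if (p < rev_ord p)%N then (-1) ^+ p / Q p (rev_ord p) else 1).
have d0 p : d 0 p != 0.
  rewrite mxE; case: ifP => _; last exact: oner_neq0.
  by rewrite mulf_neq0 ?signr_eq0 // invr_eq0 Qr.
have dE p q : d 0 p * Q p q * d 0 q = (-1) ^+ p * (q == rev_ord p)%:R.
  have [->|/negPf qp] := eqVneq q (rev_ord p); last first.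
    have /negPn/eqP -> : ~~ (Q p q != 0) by rewrite Qr qp.
    by rewrite !mulr0 mul0r.
  rewrite !mxE rev_ordK mulr1; have := sign_rev F p n_odd.
  have ne : rev_ord p != p :> nat.
    by apply/eqP => e; have := ltn_ord p; move: n_odd e => /= + e; lia.
  case: (ltngtP p (rev_ord p)) ne => // pr _ sr; first by rewrite divfK ?mulr1 // Qr.
  have := congr1 (fun Z : 'M_n.+1 => Z (rev_ord p) p) aQ; rewrite !mxE => ->.
  by rewrite sr mul1r !mulNr mulrN opprK mulrC divfK // Qr rev_ordK.
have du : diag_mx d \in unitmx.
  by rewrite unitmxE det_diag unitfE; apply/prodf_neq0 => p _.
have vE x p q : conj_rep v (diag_mx d) x p q = d 0 p * v x p q / d 0 q.
  by rewrite conj_repE cjm_diag // mxE.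
exists (conj_rep v (diag_mx d)); split; first exact: conj_matrix_rep.
  have [_ _ hf] := conj_form du v_form.
  have QE : diag_mx d *m Q *m (diag_mx d)^T = \matrix_(p, q) ((-1) ^+ p * (q == rev_ord p)%:R).
    by apply/matrixP => p q; rewrite tr_diag_mx mul_mx_diag mul_diag_mx [LHS]mxE [X in X * _]mxE [RHS]mxE dE.
  have YQ (Y : 'M[F]_n.+1) p q : (Y *m \matrix_(p, q) ((-1) ^+ p * (q == rev_ord p)%:R)) p q =
      - ((-1) ^+ q * Y p (rev_ord q)).
    rewrite mxE (bigD1 (rev_ord q)) //= big1 ?addr0 => [|k kq]; last first.
      rewrite mxE [q == _](_ : _ = false) ?mulr0 //.
      by apply: contraNF kq => /eqP ->; rewrite rev_ordK.
    by rewrite mxE rev_ordK eqxx mulr1 -[in X in _ * X]/(rev_ord q : nat) sign_rev // mulrN mulrC.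
  move=> Y; rewrite hf QE; split=> [/matrixP e p q|e].
    have := e (rev_ord q) p; rewrite [LHS]mxE !YQ rev_ordK sign_rev // mulNr => /oppr_inj.
    rewrite exprD; have := sqrr_sign F q; move: ((-1) ^+ q) ((-1) ^+ p) => a b aa h.
    transitivity (- (a * - (a * Y p q))); first by rewrite mulrN opprK mulrA -expr2 aa mul1r.
    by rewrite h; ring.
  apply/matrixP => p q; rewrite [LHS]mxE !YQ (e q (rev_ord p)) rev_ordK exprD sign_rev //.
  have := sqrr_sign F p; move: ((-1) ^+ q) ((-1) ^+ p) => a b bb.
  by rewrite -[in RHS](mul1r (Y _ _)) -bb; ring.
split=> [H hH p q pq|p q pq]; first by rewrite vE vd // mulr0 mul0r.
suff mE p' : mu T (conj_rep v (diag_mx d)) p' = mu T v p' by rewrite !mE vo.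
by apply/lfunP => H; rewrite !muE vE mulrAC mulfV // mul1r.
Qed.

End Rescaling.

Section SkewRealization.
Variables (F : numFieldType) (L : lieType F) (T : tridec L) (r : nat).
Local Notation n := (r + r.+1)%N.
Variable v : {linear L -> 'M[F]_n.+1}.
Hypotheses (v_rep : matrix_rep v) (v_skew : skew_rep v) (v_ord : ordered_rep T v).

(** The adjoint for the alternating antidiagonal form, an anti-involution whose -1 eigenspace is the
    image of L. *)
Definition rev_mx (Y : 'M[F]_n.+1) : 'M[F]_n.+1 :=
  \matrix_(p, q) ((-1) ^+ (p + q) * Y (rev_ord q) (rev_ord p)).

Lemma rev_mxM X Y : rev_mx (X *m Y) = rev_mx Y *m rev_mx X.
Proof.
apply/matrixP => p q; rewrite !mxE mulr_sumr (reindex_inj rev_ord_inj); apply: eq_bigr => k _.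
by rewrite !mxE -(sign_cancel F k q p); ring.
Qed.

Lemma rev_mx_linear : linear rev_mx.
Proof. by move=> a X Y; apply/matrixP => p q; rewrite !mxE; ring. Qed.

HB.instance Definition _ := GRing.isLinear.Build F _ _ _ rev_mx rev_mx_linear.

Lemma sum_delta (P : pred nat) (a b : nat) (p q : 'I_n.+1) : (a <= 1)%N -> (b <= 1)%N ->
  \sum_(j < n | P j) (delta_mx (inord (a + j)) (inord (b + j)) : 'M[F]_n.+1) p q =
  [&& (a <= p)%N, (p - a < n)%N, (q + a == p + b)%N & P (p - a)%N]%:R.
Proof.
move=> a1 b1; have eqn (k : 'I_n.+1) (j d : nat) : (d <= 1)%N -> (j < n)%N ->
    (k == inord (d + j)) = (k == d + j :> nat)%N.
  by move=> d1 jn; rewrite -val_eqE /= inordK //; lia.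
case: (boolP [&& _, _, _ & _]) => [/and4P[ap pn /eqP qp Pp]|h0].
  rewrite (bigD1 (Ordinal pn)) //= big1 ?addr0 => [|j /andP[_ jp]].
    by rewrite mxE !eqn //= (_ : _ && _) //; lia.
  rewrite mxE !eqn //; case: eqP => //= e; case/eqP: jp; apply: val_inj => /=; lia.
apply: big1 => j Pj; rewrite mxE !eqn //; case: andP => // -[/eqP e1 /eqP e2].
case/negP: h0; have e : (p - a = j)%N by lia.
by rewrite e Pj ltn_ord; lia.
Qed.

Lemma n_odd : odd n. Proof. by rewrite addnS /= oddD addbb. Qed.

Lemma rev_mxK : involutive rev_mx.
Proof.
move=> Y; apply/matrixP => p q; rewrite !mxE !rev_ordK mulrA !exprD !sign_rev ?n_odd //.
by rewrite mulrNN -(mulrA _ _ (_ * _)) (mulrA _ _ ((-1) ^+ p)) -expr2 sqrr_sign mul1r -expr2 sqrr_sign mul1r.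
Qed.

Lemma skew_mxP Y : skew_mx Y <-> rev_mx Y = - Y.
Proof.
split=> [hY|/matrixP hY p q]; first by apply/matrixP => p q; rewrite !mxE [Y p q]hY opprK.
by have := hY p q; rewrite !mxE => ->; rewrite opprK.
Qed.

Lemma rev_delta (p q : 'I_n.+1) :
  rev_mx (delta_mx p q) = (-1) ^+ (p + q) *: delta_mx (rev_ord q) (rev_ord p).
Proof.
apply/matrixP => s t; rewrite !mxE andbC.
have e (i j : 'I_n.+1) : (rev_ord i == j) = (i == rev_ord j).
  by apply/eqP/eqP => [<-|->]; rewrite rev_ordK.
rewrite !e; case: andP => [[/eqP -> /eqP ->]|_]; last by rewrite !mulr0.
by rewrite !exprD !sign_rev ?n_odd // mulrNN [_ ^+ q * _]mulrC.
Qed.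

Lemma rep_rev x : rev_mx (v x) = - v x.
Proof. by apply/skew_mxP/v_skew; exists x. Qed.

Lemma skew_proj : exists g : {linear 'M[F]_n.+1 -> L}, forall Y, v (g Y) = Y - rev_mx Y.
Proof.
have lin : linear (fun Y => Y - rev_mx Y).
  by move=> a Y Z; rewrite linearP opprD addrACA scalerBr.
have [_ vi _] := v_rep.
pose f : {linear 'M[F]_n.+1 -> 'M[F]_n.+1} :=
  HB.pack (fun Y => Y - rev_mx Y) (GRing.isLinear.Build _ _ _ _ _ lin).
apply: (@lift_linear _ _ _ v f vi) => Y; apply/v_skew/skew_mxP.
by rewrite /= raddfB /= rev_mxK opprB.
Qed.

Lemma skew_diag x (p : 'I_n.+1) : v x (rev_ord p) (rev_ord p) = - v x p p.
Proof.
have /v_skew/(_ p p) -> : exists y, v y = v x by exists x.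
by rewrite addnn -muln2 mulnC exprM sqrrN !expr1n mul1r opprK.
Qed.

Lemma mu_rev p : mu T v (rev_ord p) = - mu T v p.
Proof. by apply/lfunP => H; rewrite opp_lfunE !muE skew_diag. Qed.

(** (p, q) and (rev q, rev p) give the same root, and one of them is kept. The pairs with p + q = n,
    which are the long roots, are their own mirror. *)
Let R : pred ('I_n.+1 * 'I_n.+1) := fun pq => (pq.1 < pq.2)%N && (pq.1 + pq.2 <= n)%N.

Lemma skew_diff_inj : {in R &, injective (fun pq => mu T v pq.1 - mu T v pq.2)}.
Proof.
have [vd _] := v_ord.
(* Tested on the Cartan element E_kk - E_(rev k)(rev k), the root mu p - mu q is positive exactly
   when k is p or rev q, so the root determines this set. *)
have step (p q s t k : 'I_n.+1) : (p < q)%N -> (s < t)%N -> mu T v p - mu T v q = mu T v s - mu T v t ->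
    (k == p) || (k == rev_ord q) -> (k == s) || (k == rev_ord t).
  move=> pq st e hk.
  have [g hg] := skew_proj; pose x := g (delta_mx k k).
  have hx : v x = delta_mx k k - delta_mx (rev_ord k) (rev_ord k).
    by rewrite hg rev_delta addnn -muln2 mulnC exprM sqrrN !expr1n scale1r.
  have xE i : v x i i = (i == k)%:R - (i == rev_ord k)%:R by rewrite hx !mxE !andbb.
  have xc : x \in cartan T.
    apply: (diag_cartan v_rep vd) => i j ij; rewrite hx !mxE.
    have z (l : 'I_n.+1) : (i == l) && (j == l) = false.
      by apply/negP => /andP[/eqP il /eqP jl]; rewrite il jl eqxx in ij.
    by rewrite !z subrr.
  have := congr1 (fun a : weight (cartan T) => a (Subvs xc)) e.
  rewrite !lfunE /= !opp_lfunE !muE /= !xE.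
  have pq0 : p != q by rewrite neq_ltn pq.
  have rv (i : 'I_n.+1) : (i == rev_ord i) = false.
    by apply/eqP => /(congr1 val) /= h; have := ltn_ord i; have := n_odd; lia.
  have rr (i : 'I_n.+1) : (i == rev_ord k) = (k == rev_ord i).
    by apply/eqP/eqP => ->; rewrite rev_ordK.
  have lhs : exists b : nat, (p == k)%:R - (p == rev_ord k)%:R - ((q == k)%:R - (q == rev_ord k)%:R)
      = b.+1%:R :> F.
    case/orP: hk => /eqP hk; [exists (q == rev_ord k) | exists (p == k)].
      by rewrite hk eqxx rv eq_sym (negPf pq0) subr0 sub0r opprK nat1r.
    by rewrite !hk rev_ordK eqxx rv (negPf pq0) subr0 sub0r opprK natr1.
  case: lhs => b -> ; rewrite !rr ![_ == k]eq_sym; case: (k == s) => //; case: (k == rev_ord t) => //=.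
  rewrite sub0r subr0 -opprD -natrD => /eqP.
  by rewrite -subr_eq0 opprK -natrD pnatr_eq0.
move=> [p q] [s t] /andP[/= pq pqn] /andP[/= st stn] e.
have h1 := step p q s t _ pq st e; have h2 := step s t p q _ st pq (esym e).
have := h1 p; have := h1 (rev_ord q); have := h2 s; have := h2 (rev_ord t).
rewrite !eqxx !orbT /= => /(_ isT) + /(_ isT) + /(_ isT) + /(_ isT).
rewrite -!val_eqE /= !subSS => a1 a2 a3 a4.
have ep : (p : nat) = s by lia.
have eq : (q : nat) = t by lia.
by rewrite (val_inj ep) (val_inj eq).
Qed.

(** Summing over all p < q counts each positive root twice except the long ones, which are counted
    once: the total is 2S - D, with S the sum of the positive roots and D that of the long ones. *)
Lemma skew_rho (H : subvs_of (cartan T)) :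
  (rho T H : F) = \sum_(k < r.+1) trk k (v (vsval H)).
Proof.
have [vd vo] := v_ord.
have [a aE] : exists a : 'I_n.+1 -> F, forall p, v (vsval H) p p = a p by exists (fun p => v (vsval H) p p).
have ar p : a (rev_ord p) = - a p by rewrite -!aE skew_diag.
have rlt (p q : 'I_n.+1) : (rev_ord q < rev_ord p)%N = (p < q)%N.
  by have := ltn_ord p; have := ltn_ord q; rewrite /=; lia.
rewrite /rho lfunE /= (sum_posroots v_rep vd vo (R := R)); first last.
- exact: skew_diff_inj.
- move=> [p q] /= pq; have [pqn|npq] := leqP (p + q) n; first by exists (p, q); rewrite // /R /= pq.
  exists (rev_ord q, rev_ord p); first by rewrite /R /=; have := ltn_ord p; have := ltn_ord q; move: pq npq; lia.
  by rewrite /= !mu_rev opprK addrC.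
- by move=> pq /andP[].
rewrite (eq_bigr (fun pq => a pq.1 - a pq.2)) => [|pq _]; last by rewrite !aE.
set S := \sum_(pq | R pq) _.
pose D := \sum_(p < n.+1 | (p < r.+1)%N) (2 * a p).
have Dpair : \sum_(pq : 'I_n.+1 * 'I_n.+1 | (pq.1 < pq.2)%N && (pq.1 + pq.2 == n)%N) (a pq.1 - a pq.2) = D.
  rewrite -(pair_big_dep xpredT (fun p q : 'I_n.+1 => (p < q)%N && (p + q == n)%N) (fun p q => a p - a q)) /=.
  rewrite /D [RHS]big_mkcond; apply: eq_bigr => p _; have hp := ltn_ord p.
  case: ifP => pr; last by apply: big_pred0 => q; have := ltn_ord q; move: pr; lia.
  rewrite (big_pred1 (rev_ord p)) => [|q]; first by rewrite ar opprK mulr2n mulrDl !mul1r.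
  by rewrite /= -val_eqE /= subSS; have := ltn_ord q; move: pr; lia.
have SD : \sum_(pq : 'I_n.+1 * 'I_n.+1 | (pq.1 < pq.2)%N) (a pq.1 - a pq.2) = S + (S - D).
  rewrite (bigID (fun pq : 'I_n.+1 * 'I_n.+1 => (pq.1 + pq.2 <= n)%N)) /=; congr (_ + _).
  apply/eqP; rewrite eq_sym subr_eq -Dpair /S (bigID (fun pq : 'I_n.+1 * 'I_n.+1 => (pq.1 + pq.2 == n)%N)) /=.
  rewrite addrC; apply/eqP; congr (_ + _).
    pose rr (pq : 'I_n.+1 * 'I_n.+1) := (rev_ord pq.2, rev_ord pq.1).
    have rrI : injective rr by apply: (can_inj (g := rr)) => -[p q]; rewrite /rr /= !rev_ordK.
    rewrite (reindex_inj rrI); apply: eq_big => [[p q]|[p q] _] /=; last by rewrite !ar opprK addrC.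
    by rewrite /R /=; have := ltn_ord p; have := ltn_ord q; lia.
  by apply: eq_bigl => -[p q]; rewrite /R /=; lia.
rewrite sum_pair_diff (bigID (fun p : 'I_n.+1 => (p < r.+1)%N)) /= in SD.
rewrite [X in _ + X](reindex_inj rev_ord_inj) [X in _ + X](eq_big (fun p : 'I_n.+1 => (p < r.+1)%N)
    (fun p : 'I_n.+1 => (n - p)%:R * a p - p%:R * a p)) in SD; last 2 first.
- by move=> p /=; have := ltn_ord p; lia.
- move=> p _; rewrite ar rev_ordE subKn ?(leq_ord p) //; ring.
rewrite sum_trk ?leq_addl // (bigID (fun p : 'I_n.+1 => (p < r.+1)%N)) /= [X in _ = _ + X]big1 ?addr0; last first.
  by move=> p pr; rewrite (_ : (r.+1 - p)%N = 0%N) ?mul0r //; lia.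
have two0 : (2 != 0 :> F) by rewrite pnatr_eq0.
apply: (mulfI two0); rewrite -[2^-1 *: _]/(2^-1 * _) mulVKf //; apply: (mulfI two0).
have -> : 2 * S = S + (S - D) + D by ring.
rewrite -SD /D -!big_split !mulr_sumr; apply: eq_bigr => p pr /=; rewrite aE.
have -> : ((n - p)%:R = r%:R + r.+1%:R - p%:R :> F) by rewrite natrB ?(leq_ord p) // natrD.
by rewrite natrB ?(ltnW pr) // -natr1; ring.
Qed.

(** The symmetry j to 2r - j of the Dynkin diagram of gl_(2r+2). The fixed node r carries the long
    simple root. *)
Definition fold_idx (j : nat) : 'I_r.+1 := inord (minn j (r + r - j)).

Lemma fold_idxE j : (j < n)%N -> fold_idx j = minn j (r + r - j) :> nat.
Proof. by move=> jn; rewrite /fold_idx inordK //; lia. Qed.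

Lemma fold_idx_rev j : (j < n)%N -> fold_idx (n.-1 - j) = fold_idx j.
Proof. by move=> jn; apply: val_inj; rewrite /= !fold_idxE; lia. Qed.

Lemma fold_idx_eq i j : (i < n)%N -> (j < n)%N ->
  (fold_idx i == fold_idx j) = (i == j) || (i == n.-1 - j)%N.
Proof. by move=> hi hj; rewrite -val_eqE /= !fold_idxE //; lia. Qed.

Lemma skew_realization : exists ad : adapted T n fold_idx 2,
  [/\ forall p : 'I_n.+1, rhoF ad (apr_proj ad (delta_mx p p)) = cosign F r.+1 p * (colevel r.+1 p)%:R,
      forall p q : 'I_n.+1, (q < p)%N ->
        apr ad (apr_proj ad (delta_mx q p)) q p = 1 + (q == rev_ord p)%:R &
      forall x p q, apr ad x p q = - ((-1) ^+ (p + q) * apr ad x (rev_ord q) (rev_ord p))].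
Proof.
have [g hg] := skew_proj; have [vb vi virr] := v_rep; have [vd vord] := v_ord.
have vs x : skew_mx (v x) by apply/v_skew; exists x.
have rE (p : 'I_n.+1) : rev_ord p = (n - p)%N :> nat by exact: rev_ordE.
have revi (j : nat) : (j <= n)%N -> rev_ord (inord j : 'I_n.+1) = inord (n - j).
  by move=> jn; apply: val_inj; rewrite /= !inordK ?subSS //; lia.
have /choice[e he] : forall i : 'I_r.+1, exists x,
    v x = \sum_(j < n | fold_idx j == i) delta_mx (inord j) (inord j.+1).
  move=> i; apply/v_skew => p q; rewrite !summxE.
  rewrite !(sum_delta (fun j => fold_idx j == i) (a := 0) (b := 1)) // !subn0 !addn0 !addn1 !rE.
  have hp := ltn_ord p; have hq := ltn_ord q.
  case: (eqVneq (q : nat) p.+1) => [qp|qp]; last first.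
    have /negPf -> : (n - p)%N != (n - q).+1 by lia.
    by rewrite !andbF mulr0 oppr0.
  have -> : (n - p)%N = (n - q).+1 by lia.
  have -> : (n - q)%N = (n.-1 - p)%N by lia.
  have pn : (p < n)%N by lia.
  rewrite fold_idx_rev // qp (addnS p p) exprS addnn -muln2 mulnC exprM sqrrN !expr1n mulr1 mulN1r opprK eqxx pn /=.
  by rewrite (_ : (n.-1 - p < n)%N) //; lia.
have hE i (p q : 'I_n.+1) : (\sum_(j < n | fold_idx j == i)
      (delta_mx (inord j) (inord j) - delta_mx (inord j.+1) (inord j.+1)) : 'M[F]_n.+1) p q =
    (p == q)%:R * (((p < n)%N && (fold_idx p == i))%:R - ((0 < p)%N && (fold_idx p.-1 == i))%:R).
  rewrite summxE; under eq_bigr do rewrite mxE [X in _ + X]mxE.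
  rewrite sumrB (sum_delta (fun j => fold_idx j == i) (a := 0) (b := 0)) //.
  rewrite (sum_delta (fun j => fold_idx j == i) (a := 1) (b := 1)) // !subn0 !addn0 subn1 eqn_add2r.
  have qpE : ((q : nat) == p) = (p == q) by rewrite eq_sym.
  rewrite leq0n /= qpE.
  case: (p == q); last by rewrite !andbF mul0r subrr.
  rewrite mul1r /=; congr (_ - _%:R); have := ltn_ord p; case: (p : nat) => //= k.
  by rewrite ltnS => ->.
have /choice[h hh] : forall i : 'I_r.+1, exists x,
    v x = \sum_(j < n | fold_idx j == i)
      (delta_mx (inord j) (inord j) - delta_mx (inord j.+1) (inord j.+1)).
  move=> i; apply/v_skew => p q; rewrite !hE (inj_eq rev_ord_inj) [q == p]eq_sym.
  case: (eqVneq p q) => [<-|_]; last by rewrite !mul0r mulr0 oppr0.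
  rewrite addnn -muln2 mulnC exprM sqrrN !expr1n !mul1r opprB rE.
  have hp := ltn_ord p; congr (_%:R - _%:R).
    case: (leqP n p) => pn; first by rewrite (_ : (0 < n - p)%N = false) //; lia.
    by rewrite (_ : (n - p).-1 = (n.-1 - p)%N) ?fold_idx_rev ?subn_gt0 ?pn //; lia.
  case: (posnP p) => [->|p0]; first by rewrite subn0 ltnn.
  rewrite (_ : (n - p)%N = (n.-1 - p.-1)%N) ?fold_idx_rev; lia.
have g1 x Y : g (commx (v x) Y) = bracket x (g Y).
  apply: vi; rewrite vb !hg /commx raddfB /= !rev_mxM rep_rev.
  rewrite mulmxN mulNmx !mulmxBl !mulmxBr.
  move: (v x *m Y) (Y *m v x) (v x *m rev_mx Y) (rev_mx Y *m v x) => A B C D.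
  by apply/matrixP => s t; rewrite !mxE; ring.
have g2 x : g (v x) = 2 *: x by apply: vi; rewrite hg rep_rev opprK linearZ /= scaler_nat mulr2n.
have gE (p q : 'I_n.+1) : v (g (delta_mx p q)) =
    delta_mx p q - (-1) ^+ (p + q) *: delta_mx (rev_ord q) (rev_ord p).
  by rewrite hg rev_delta.
have gr (p q : 'I_n.+1) : g (delta_mx p q) \in rootspace (mu T v p - mu T v q).
  apply: (mem_rootspace v_rep vd) => s t; rewrite gE !mxE.
  case: andP => [[/eqP -> /eqP ->] //|_]; case: andP => [[/eqP -> /eqP ->] _|_].
    by rewrite !mu_rev opprK addrC.
  by rewrite mulr0 subrr eqxx.
have g3 p : g (delta_mx p p) \in cartan T.
  by rewrite -cartan_centralizer -(subrr (mu T v p)).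
have g4 (p q : 'I_n.+1) : (q < p)%N -> g (delta_mx q p) \in nplus T.
  move=> qp; have := gr q p; apply/subvP: (g _).
  exact: (@big_space_sub _ _ _ _ (fun a => rootspace a) _ (vord _ _ qp)).
have g5 (p q : 'I_n.+1) : (p < q)%N -> g (delta_mx q p) \in nminus T.
  move=> pq; have := gr q p; rewrite -(opprB (mu T v p)); apply/subvP: (g _).
  exact: (@big_space_sub _ _ _ _ (fun a => rootspace (- a)) _ (vord _ _ pq)).
have cnt0 (i : 'I_r.+1) : (#|[pred j : 'I_n | fold_idx j == i]|%:R != 0 :> F).
  rewrite pnatr_eq0 -lt0n; apply/card_gt0P.
  have hi : (i < n)%N by have := ltn_ord i; lia.
  exists (Ordinal hi); rewrite inE -val_eqE /= fold_idxE //; have := ltn_ord i; lia.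
have hmax (p q : nat) : (p <= q)%N -> (q < n)%N ->
    v (h (fold_idx q)) (inord p) (inord p) <= v (h (fold_idx q)) (inord q) (inord q).
  move=> pq qn; rewrite !hh !hE !eqxx !mul1r !inordK; try lia.
  have -> : (0 < q)%N && (fold_idx q.-1 == fold_idx q) = false.
    by case: q {pq} qn => //= q qn; rewrite fold_idx_eq; lia.
  rewrite qn eqxx subr0; case: (_ && _); case: (_ && _);
    by rewrite ?subrr ?subr0 ?sub0r ?ler01 ?lexx // lerNl (le_trans _ ler01) // oppr_le0 ler01.
have hfold x j : (j < n)%N -> v x (inord j.+1) (inord j) = psk (fold_idx j) (v x).
  move=> jn; rewrite /psk fold_idxE //; case: (leqP j (r + r - j)) => // _.
  rewrite vs !revi ?(ltnW jn) // !inordK ?ltnS ?(ltnW jn) //.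
  rewrite (addSn j j) addnn exprS -muln2 mulnC exprM sqrrN !expr1n mulr1 mulN1r opprK.
  by congr (v x (inord _) (inord _)); lia.
have hfoldh x j : x \in cartan T -> (j < n)%N ->
    v x (inord j) (inord j) - v x (inord j.+1) (inord j.+1) = alk (fold_idx j) (v x).
  move=> _ jn; rewrite /alk fold_idxE //; case: (leqP j (r + r - j)) => // _.
  have e1 : inord (r + r - j) = rev_ord (inord j.+1 : 'I_n.+1) by rewrite revi //; congr inord; lia.
  have e2 : inord (r + r - j).+1 = rev_ord (inord j : 'I_n.+1) by rewrite revi ?(ltnW jn) //; congr inord; lia.
  by rewrite e1 e2 !skew_diag opprK addrC.
have fid (k : 'I_r.+1) : fold_idx k = k.
  by apply: val_inj; rewrite /= fold_idxE //; have := ltn_ord k; lia.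
(* With tau = 2 the lengths are 1 for a short simple root, on which two nodes fold, and 2 for the
   long one. *)
have lenE (i : 'I_r.+1) : 2 / #|[pred j : 'I_n | fold_idx j == i]|%:R
    * #|[pred j : 'I_n | fold_idx j == i]|%:R = 2 :> F by rewrite divfK.
have two0 : 2 != 0 :> F by rewrite pnatr_eq0.
exists (@Adapted F L T n r.+1 fold_idx 2 v vb vi vd
  (nplus_upper v_rep vd vord) (nminus_lower v_rep vd vord) skew_rho
  (leq_addl _ _) fid hfold hfoldh e he h hh _ lenE (ltr0n _ 2)
  (mu_regular vord) hmax g g1 2 two0 g2 g3 g4 g5).
split=> /= [p|p q qp|x p q]; last exact: vs.
- rewrite /rhoF /= sum_trk ?leq_addl // (eq_bigr (fun q : 'I_n.+1 =>
    (r.+1 - q)%:R * (q == p)%:R - (r.+1 - q)%:R * (q == rev_ord p)%:R)) => [|q _]; last first.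
    rewrite gE !mxE !andbb addnn -muln2 mulnC exprM sqrrN !expr1n mul1r; ring.
  have ss (f : 'I_n.+1 -> F) t : \sum_q f q * (q == t)%:R = f t.
    by rewrite (bigD1 t) //= eqxx mulr1 big1 ?addr0 // => q /negPf ->; rewrite mulr0.
  rewrite sumrB !(ss (fun q : 'I_n.+1 => (r.+1 - q)%:R)) /= subSS /cosign /colevel; have hp := ltn_ord p; case: ltnP => pr.
    by rewrite (_ : (r.+1 - (n - p))%N = 0%N) ?subr0 ?mul1r //; lia.
  rewrite (_ : (r.+1 - p)%N = 0%N) ?sub0r ?mulN1r; last by lia.
  by congr (- _%:R); lia.
rewrite gE !mxE !eqxx /= -[p == rev_ord q]val_eqE -[q == rev_ord p]val_eqE /= !subSS.
case: eqVneq => [qr|qr]; last by rewrite mulr0 subr0 addr0.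
have hp := ltn_ord p; have -> : (q + p)%N = n by lia.
have -> : (p == n - q :> nat)%N by apply/eqP; lia.
by rewrite mulr1 -signr_odd n_odd expr1 opprK.
Qed.

End SkewRealization.

Section SymplecticRealization.
Variables (F : numClosedFieldType) (r : nat).
Local Notation n := (r + r.+1)%N.
Local Notation L := (sp F r.+1).
Variable T : tridec L.

Definition sp_val : {linear L -> 'M[F]_n.+1} := @vsval _ _ (sp_space F r.+1).

Lemma symp_form_sqr k : symp_form F k *m symp_form F k = - 1%:M.
Proof.
rewrite /symp_form mulmx_block !mul0mx !mulmx0 !mul1mx !mulmx1 !add0r !addr0.
by rewrite [X in _ = - X]scalar_mx_block opp_block_mx !oppr0.
Qed.

Lemma symp_form_tr k : (symp_form F k)^T = - symp_form F k.
Proof.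
by rewrite /symp_form tr_block_mx opp_block_mx !trmx0 linearN /= trmx1 oppr0 opprK.
Qed.

Lemma symp_formP k (A : 'M[F]_(k + k)) :
  (A \in sp_space F k) = ((A *m symp_form F k)^T == A *m symp_form F k).
Proof.
rewrite sp_spaceE trmx_mul symp_form_tr mulNmx; set J := symp_form F k.
have JJ Z : J *m (J *m Z) = - Z by rewrite mulmxA symp_form_sqr mulNmx mul1mx.
have ZJ Z : Z *m J *m J = - Z by rewrite -mulmxA symp_form_sqr mulmxN mulmx1.
rewrite addr_eq0; apply/eqP/eqP => [e|e].
  by have := congr1 (fun Z => J *m Z *m J) e; rewrite mulmxN JJ opprK mulmxA ZJ => ->.
have := congr1 (fun Z => J *m Z *m J) e.
by rewrite mulmxN JJ opprK mulmxA ZJ.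
Qed.

Lemma sp_val_form : form_rep sp_val (symp_form F r.+1).
Proof.
have /mulmx1_unit[uJ _] : symp_form F r.+1 *m - symp_form F r.+1 = 1%:M.
  by rewrite mulmxN symp_form_sqr opprK.
split=> [//||Y]; first exact (symp_form_tr r.+1).
split=> [[x <-]|sY].
  by have : vsval x \in sp_space F r.+1 := subvsP x; rewrite symp_formP => /eqP.
have hY : (Y : 'M_(r.+1 + r.+1)) \in sp_space F r.+1 by rewrite symp_formP; apply/eqP.
by exists (Subvs hY).
Qed.

Lemma sp_val_rep : matrix_rep sp_val.
Proof. by split=> // [x y|]; [exact: val_inj | exact: form_irr sp_val_form]. Qed.

Lemma sp_realization : exists ad : adapted T n (@fold_idx r) 2,
  [/\ forall p : 'I_n.+1, rhoF ad (apr_proj ad (delta_mx p p)) = cosign F r.+1 p * (colevel r.+1 p)%:R,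
      forall p q : 'I_n.+1, (q < p)%N ->
        apr ad (apr_proj ad (delta_mx q p)) q p = 1 + (q == rev_ord p)%:R &
      forall x p q, apr ad x p q = - ((-1) ^+ (p + q) * apr ad x (rev_ord q) (rev_ord p))].
Proof.
have [P hP hd|P hP ho] := ordered_conj (T := T) sp_val_rep.
  exact: form_mu_inj (conj_matrix_rep hP sp_val_rep) (conj_form hP sp_val_form) hd.
have [v [vr vs vo]] := skew_ordered_rep (n_odd r) (conj_matrix_rep hP sp_val_rep)
  (conj_form hP sp_val_form) ho.
exact: (skew_realization vr vs vo).
Qed.

End SymplecticRealization.

(** * The two filtrations *)

Section Filtrations.
Variables (F : numFieldType) (L : lieType F) (T : tridec L) (n K : nat).
Variables (c : nat -> 'I_K) (tau : F) (ad : adapted T n c tau).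

Lemma filtS_whit m : filtS T m =
  whit_image (@sym_ad F L) (@sym_filt F L) (slice_coef ad) m.
Proof.
rewrite /filtS /whit_image; apply: eq_imagel => t _; congr tens_val.
by apply/funext => j; rewrite /tens_map (ev_Ch ad).
Qed.

Lemma filtU_whit (om : 'X_{1..K} -> Uenv L -> F) : (forall u, ev (rho T) (hc T u) = om 0%MM u) -> forall m,
  filtU T m = whit_image (@env_ad F L) (@env_filt F L) om m.
Proof.
move=> om0 m; rewrite /filtU /whit_image; apply: eq_imagel => t _; congr tens_val.
by apply/funext => j; rewrite /tens_map om0.
Qed.

End Filtrations.

Theorem theorem1p4 (R : realType) (r : nat) (hr : (1 <= r)%N) :
  (forall (T : tridec (sl R[i] r.+1)) (m : nat), filtS T m = filtU T m) /\
  (forall (T : tridec (sp R[i] r)) (m : nat), filtS T m = filtU T m).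
Proof.
case: r hr => // r _; split=> T m.
  have [ad [kA [h1 h2]]] := sl_realization T; have [om [wm hom]] := env_model ad.
  (* The symmetric algebra is the case hb = 0 and the enveloping algebra hb = 1; both images equal
     the same [polyA]. *)
  rewrite (filtS_whit ad) (filtU_whit hom) (whit_imageA h1 h2 (sym_model ad) (lexx _)).
  by rewrite (whit_imageA h1 h2 wm ler01).
have [ad [h1 h2 h3]] := sp_realization T; have [om [wm hom]] := env_model ad.
have nr : (r + r.+1).+1 = (r.+1 + r.+1)%N by [].
have cr j : (j < r + r.+1)%N -> fold_idx r ((r + r.+1).-1 - j) = fold_idx r j by exact: fold_idx_rev.
rewrite (filtS_whit ad) (filtU_whit hom) (whit_imageC nr cr h1 h2 h3 (sym_model ad) (lexx _)).
by rewrite (whit_imageC nr cr h1 h2 h3 wm ler01).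
Qed.
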